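(* Let $(X,\mathscr A,\mu)$ be a $\sigma$-finite measure space, $w\colon X\to\mathbb C$ an $\mathscr A$-measurable function and $\phi\colon X\to X$ an $\mathscr A$-measurable transformation such that $\mu_w\circ\phi^{-1}\ll\mu$. Let $p\in(0,1)$. If $C_{\phi,w}$ is $p$-hyponormal and $\mathsf h_{\phi,w_{1-p}}<\infty$ a.e. $[\mu]$, then $\overline{\Delta_{1-p}(C_{\phi,w})}$ is hyponormal.
   Context: $\overline{\mathbb R}_+=[0,\infty]$. A transformation $\phi\colon X\to X$ is $\mathscr A$-measurable if $\phi^{-1}(\Delta)\in\mathscr A$ for all $\Delta\in\mathscr A$. $\mu_w(\Delta)=\int_\Delta|w|^2\,\mathrm d\mu$ and $\mu_w\circ\phi^{-1}(\Delta)=\mu_w(\phi^{-1}(\Delta))$ for $\Delta\in\mathscr A$. If $\mu_w\circ\phi^{-1}\ll\mu$, then $\mathsf h_{\phi,w}\colon X\to\overline{\mathbb R}_+$ is the ($\mu$-a.e. unique) Radon–Nikodym derivative: $\mu_w\circ\phi^{-1}(\Delta)=\int_\Delta\mathsf h_{\phi,w}\,\mathrm d\mu$, $\Delta\in\mathscr A$, and the weighted composition operator $C_{\phi,w}$ in $L^2(\mu)$ is defined by $\mathcal D(C_{\phi,w})=\{f\in L^2(\mu)\colon w\cdot(f\circ\phi)\in L^2(\mu)\}$, $C_{\phi,w}f=w\cdot(f\circ\phi)$; it is a closed operator and it is densely defined iff $\mathsf h_{\phi,w}<\infty$ a.e. $[\mu]$. For $\alpha\in(0,1]$ and densely defined $C_{\phi,w}$,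 $w_\alpha\colon X\to\mathbb C$ is an $\mathscr A$-measurable function with $w_\alpha=w\cdot\big(\frac{\mathsf h_{\phi,w}}{\mathsf h_{\phi,w}\circ\phi}\big)^{\alpha/2}$ a.e. $[\mu]$ (one has $\mathsf h_{\phi,w}\circ\phi>0$ a.e. $[\mu_w]$; $w_\alpha=0$ a.e. on $\{w=0\}$). Moreover $\mu_{w_\alpha}\circ\phi^{-1}\ll\mu$, where $\mu_{w_\alpha}(\Delta)=\int_\Delta|w_\alpha|^2\,\mathrm d\mu$ and $\mu_{w_\alpha}\circ\phi^{-1}(\Delta)=\mu_{w_\alpha}(\phi^{-1}(\Delta))$ for $\Delta\in\mathscr A$, so $\mathsf h_{\phi,w_\alpha}$ is defined: it is the ($\mu$-a.e. unique) $\mathscr A$-measurable function $\mathsf h_{\phi,w_\alpha}\colon X\to\overline{\mathbb R}_+$ such that $\mu_{w_\alpha}\circ\phi^{-1}(\Delta)=\int_\Delta\mathsf h_{\phi,w_\alpha}\,\mathrm d\mu$ for $\Delta\in\mathscr A$. For a closed densely defined operator $A$ with polar decomposition $A=U|A|$ and $\alpha\in(0,1]$, the $\alpha$-Aluthge transform of $A$ is $\Delta_\alpha(A)=|A|^\alpha U|A|^{1-\alpha}$ (with its natural domain; $|A|^0$ is the identity). The operator $\Delta_\alpha(C_{\phi,w})$ is closable for densely defined $C_{\phi,w}$; the bar denotes closure. A closed densely defined operator $A$ is $p$-hyponormal ($p\in(0,\infty)$) if $\mathcal D(|A|^p)\subseteq\mathcal D(|A^*|^p)$ and $\||A^*|^pf\|\leqslant\||A|^pf\|$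 for every $f\in\mathcal D(|A|^p)$; hyponormal means $1$-hyponormal. *)

(* Defs.v *)
From HB Require Import structures.
From mathcomp Require Import all_boot all_order all_algebra.
From mathcomp Require Import all_classical all_reals all_analysis.
From mathcomp Require Import measurable_realfun sesquilinear ring_quotient.
From mathcomp Require Import ring lra.
From mathcomp.real_closed Require Import complex.
Set Implicit Arguments.
Unset Strict Implicit.
Unset Printing Implicit Defensive.
Import Order.TTheory GRing.Theory Num.Def Num.Theory.
Import numFieldNormedType.Exports.
Local Open Scope classical_set_scope.
Local Open Scope ring_scope.
Local Open Scope quotient_scope.

Section L2.
Context {d : measure_display} {X : measurableType d} {R : realType}.
Variable mu : {measure set X -> \bar R}.

(* Borel measurability of complex functions *)
Definition cmeasurable (f : X -> R[i]) :=
  measurable_fun setT (fun x => complex.Re (f x)) /\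
  measurable_fun setT (fun x => complex.Im (f x)).

Definition sqnorm (z : R[i]) : R := Normc.normc z ^+ 2.

Lemma sqnormE (z : R[i]) : sqnorm z = complex.Re z ^+ 2 + complex.Im z ^+ 2.
Proof.
by case: z => a b; rewrite /sqnorm /= sqr_sqrtr// addr_ge0// sqr_ge0.
Qed.

Lemma sqnorm_ge0 (z : R[i]) : 0 <= sqnorm z.
Proof. exact: sqr_ge0. Qed.

Lemma sqnorm_lin (a z z' : R[i]) :
  sqnorm (a * z + z') <= 2 * sqnorm a * sqnorm z + 2 * sqnorm z'.
Proof.
rewrite !sqnormE; case: a z z' => [a b] [u v] [u' v'] /=.
move: (sqr_ge0 (a * u - b * v - u')) (sqr_ge0 (a * v + b * u - v')); nra.
Qed.

Lemma measurable_sqnorm f : cmeasurable f ->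
  measurable_fun setT ((fun x => (sqnorm (f x))%:E) : X -> \bar R).
Proof.
move=> [mr mi]; apply/measurable_EFinP.
under eq_fun do rewrite sqnormE.
by apply: measurable_funD; apply: measurable_funX.
Qed.

Definition L2pred : {pred X -> R[i]} :=
  mem [set f | cmeasurable f /\ (\int[mu]_x (sqnorm (f x))%:E < +oo)%E].

Lemma cmeasurableM f g : cmeasurable f -> cmeasurable g ->
  cmeasurable (fun x => f x * g x).
Proof.
move=> [fr fi] [gr gi]; split.
- rewrite (_ : (fun x => _) = (fun x => complex.Re (f x) * complex.Re (g x) -
    complex.Im (f x) * complex.Im (g x))); last first.
    by apply/funext => x; case: (f x) (g x) => [a b] [a' b'].
  by apply: measurable_funB; apply: measurable_funM.
- rewrite (_ : (fun x => _) = (fun x => complex.Re (f x) * complex.Im (g x) +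
    complex.Im (f x) * complex.Re (g x))); last first.
    by apply/funext => x; case: (f x) (g x) => [a b] [a' b'].
  by apply: measurable_funD; apply: measurable_funM.
Qed.

Lemma cmeasurableD f g : cmeasurable f -> cmeasurable g ->
  cmeasurable (fun x => f x + g x).
Proof.
move=> [fr fi] [gr gi]; split.
- rewrite (_ : (fun x => _) = (fun x => complex.Re (f x) + complex.Re (g x))).
    exact: measurable_funD.
  by apply/funext => x; case: (f x) (g x) => [a b] [a' b'].
- rewrite (_ : (fun x => _) = (fun x => complex.Im (f x) + complex.Im (g x))).
    exact: measurable_funD.
  by apply/funext => x; case: (f x) (g x) => [a b] [a' b'].
Qed.

Lemma cmeasurable_conj f : cmeasurable f -> cmeasurable (fun x => (f x)^*%C).
Proof.
move=> [fr fi]; split.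
- rewrite (_ : (fun x => _) = (fun x => complex.Re (f x)))//.
  by apply/funext => x; case: (f x).
- rewrite (_ : (fun x => _) = (fun x => - complex.Im (f x))).
    exact: measurableT_comp.
  by apply/funext => x; case: (f x).
Qed.

Lemma cmeasurable_cst c : cmeasurable (fun=> c).
Proof. by split; exact: measurable_cst. Qed.

Lemma L2pred_submod_closed : submod_closed L2pred.
Proof.
split.
  rewrite inE/=; split; first exact: cmeasurable_cst.
  under eq_integral do rewrite sqnormE/= expr0n/= addr0.
  by rewrite integral0.
move=> a f g; rewrite !inE/= => -[mf If] [mg Ig].
have mfg : cmeasurable (a *: f + g).
  exact: (cmeasurableD (cmeasurableM (cmeasurable_cst a) mf) mg).
split=> //.
have m2 := measurable_sqnorm.
apply: (@le_lt_trans _ _ (\int[mu]_x ((2 * sqnorm a)%:E * (sqnorm (f x))%:E +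
    2%:E * (sqnorm (g x))%:E))%E).
  apply: ge0_le_integral => //.
  - by move=> x _; rewrite lee_fin sqnorm_ge0.
  - exact: m2.
  - by apply: emeasurable_funD; apply: measurable_funeM; exact: m2.
  - move=> x _; rewrite -!EFinM -EFinD lee_fin.
    exact: sqnorm_lin.
have n2 h (x : X) : setT x -> (0 <= (sqnorm (h x))%:E)%E.
  by move=> _; rewrite lee_fin sqnorm_ge0.
have a2 : 0 <= 2 * sqnorm a by rewrite mulr_ge0// sqnorm_ge0.
rewrite ge0_integralD//.
- rewrite !ge0_integralZl//; [|exact: m2|exact: n2|exact: m2|exact: n2].
  by rewrite lte_add_pinfty// lte_mul_pinfty.
- by move=> x _; rewrite mule_ge0// n2.
- by apply: measurable_funeM; exact: m2.
- by move=> x _; rewrite mule_ge0// n2.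
- by apply: measurable_funeM; exact: m2.
Qed.

HB.instance Definition _ :=
  GRing.isSubmodClosed.Build R[i] (X -> R[i]) L2pred L2pred_submod_closed.

Record L2fun := MkL2fun { L2val :> X -> R[i]; L2valP : L2val \in L2pred }.
HB.instance Definition _ := [isSub for L2val].
HB.instance Definition _ := [Choice of L2fun by <:].
HB.instance Definition _ := [SubChoice_isSubLmodule of L2fun by <:].

Definition ae0 : {pred L2fun} :=
  mem [set f : L2fun | {ae mu, forall x, f x = 0}].

Lemma ae0_zmod_closed : zmod_closed ae0.
Proof.
split; first by rewrite inE/=; apply: aeW.
move=> f g; rewrite !inE/= => f0 g0.
by apply: filterS2 f0 g0 => x /= f0 g0; rewrite -[LHS]/(f x - g x) f0 g0 subr0.
Qed.

HB.instance Definition _ := GRing.isZmodClosed.Build L2fun ae0 ae0_zmod_closed.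

(* square-integrable functions modulo equality almost everywhere *)
Definition L2 : Type := Quotient.quot ae0.
HB.instance Definition _ := GRing.Zmodule.on L2.
HB.instance Definition _ := EqQuotient.on L2.

(* a representative of the class *)
Definition L2fn (q : L2) : X -> R[i] := repr q.

Lemma L2fn_pi (f : L2fun) : {ae mu, forall x, L2fn (\pi_L2 f) x = f x}.
Proof.
have : f - repr (\pi_L2 f) \in ae0 by rewrite Quotient.idealrBE reprK.
rewrite inE/=; apply: filterS => x /= fx; apply/eqP.
by rewrite eq_sym -subr_eq0; apply/eqP.
Qed.

Lemma L2_eqP (q r : L2) : {ae mu, forall x, L2fn q x = L2fn r x} -> q = r.
Proof.
move=> qr; rewrite -[q]reprK -[r]reprK; apply/eqP; rewrite -Quotient.idealrBE.
rewrite inE/=; apply: filterS qr => x /= qrx.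
by rewrite -[LHS]/(L2fn q x - L2fn r x) qrx subrr.
Qed.

Lemma L2fnD (q r : L2) :
  {ae mu, forall x, L2fn (q + r) x = L2fn q x + L2fn r x}.
Proof.
have -> : q + r = \pi_L2 (repr q + repr r) by rewrite [RHS]Quotient.pi_add !reprK.
exact: L2fn_pi.
Qed.

Definition L2scale (a : R[i]) (q : L2) : L2 := \pi_L2 (a *: repr q).

Lemma L2fn_scale (a : R[i]) (q : L2) :
  {ae mu, forall x, L2fn (L2scale a q) x = a * L2fn q x}.
Proof. exact: L2fn_pi. Qed.

Lemma L2scaleA a b q : L2scale a (L2scale b q) = L2scale (a * b) q.
Proof.
apply: L2_eqP; near=> x.
have -> : L2fn (L2scale a (L2scale b q)) x = a * L2fn (L2scale b q) x.
  by near: x; exact: L2fn_scale.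
have -> : L2fn (L2scale b q) x = b * L2fn q x by near: x; exact: L2fn_scale.
have -> : L2fn (L2scale (a * b) q) x = a * b * L2fn q x.
  by near: x; exact: L2fn_scale.
by rewrite mulrA.
Unshelve. all: by end_near. Qed.

Lemma L2scale1 : left_id 1 L2scale.
Proof.
move=> q; apply: L2_eqP; apply: filterS (L2fn_scale 1 q) => x ->.
by rewrite mul1r.
Qed.

Lemma L2scaleDr : right_distributive L2scale +%R.
Proof.
move=> a q r; apply: L2_eqP; near=> x.
have -> : L2fn (L2scale a (q + r)) x = a * L2fn (q + r) x.
  by near: x; exact: L2fn_scale.
have -> : L2fn (q + r) x = L2fn q x + L2fn r x by near: x; exact: L2fnD.
have -> : L2fn (L2scale a q + L2scale a r) x =
    L2fn (L2scale a q) x + L2fn (L2scale a r) x by near: x; exact: L2fnD.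
have -> : L2fn (L2scale a q) x = a * L2fn q x by near: x; exact: L2fn_scale.
have -> : L2fn (L2scale a r) x = a * L2fn r x by near: x; exact: L2fn_scale.
by rewrite mulrDr.
Unshelve. all: by end_near. Qed.

Lemma L2scaleDl q : {morph L2scale^~ q : a b / a + b}.
Proof.
move=> a b; apply: L2_eqP; near=> x.
have -> : L2fn (L2scale (a + b) q) x = (a + b) * L2fn q x.
  by near: x; exact: L2fn_scale.
have -> : L2fn (L2scale a q + L2scale b q) x =
    L2fn (L2scale a q) x + L2fn (L2scale b q) x by near: x; exact: L2fnD.
have -> : L2fn (L2scale a q) x = a * L2fn q x by near: x; exact: L2fn_scale.
have -> : L2fn (L2scale b q) x = b * L2fn q x by near: x; exact: L2fn_scale.
by rewrite mulrDl.
Unshelve. all: by end_near. Qed.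

HB.instance Definition _ := GRing.Zmodule_isLmodule.Build R[i] L2
  L2scaleA L2scale1 L2scaleDr L2scaleDl.

Lemma L2fnZ (a : R[i]) (q : L2) :
  {ae mu, forall x, L2fn (a *: q) x = a * L2fn q x}.
Proof. exact: L2fn_scale. Qed.

Lemma L2fnP (q : L2) :
  cmeasurable (L2fn q) /\ (\int[mu]_x (sqnorm (L2fn q x))%:E < +oo)%E.
Proof. by have := L2valP (repr q); rewrite inE. Qed.

Definition cintegrable (f : X -> R[i]) :=
  mu.-integrable setT (fun x => (complex.Re (f x))%:E) /\
  mu.-integrable setT (fun x => (complex.Im (f x))%:E).

Definition cintegral (f : X -> R[i]) : R[i] :=
  ((\int[mu]_x complex.Re (f x)) +i* (\int[mu]_x complex.Im (f x)))%C.

Lemma cintegrable_lin a f g : cintegrable f -> cintegrable g ->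
  cintegrable (fun x => a * f x + g x).
Proof.
case: a => a b [fr fi] [gr gi]; split.
- rewrite (_ : (fun x => _) = (((fun x => a%:E * (complex.Re (f x))%:E) \-
    (fun x => b%:E * (complex.Im (f x))%:E)) \+
    (fun x => (complex.Re (g x))%:E))%E); last first.
    by apply/funext => x /=; case: (f x) (g x) => [u v] [u' v'] /=.
  by apply: integrableD => //; apply: integrableB => //; exact: integrableZl.
- rewrite (_ : (fun x => _) = (((fun x => a%:E * (complex.Im (f x))%:E) \+
    (fun x => b%:E * (complex.Re (f x))%:E)) \+
    (fun x => (complex.Im (g x))%:E))%E); last first.
    by apply/funext => x /=; case: (f x) (g x) => [u v] [u' v'] /=.
  by apply: integrableD => //; apply: integrableD => //; exact: integrableZl.
Qed.

Lemma cintegral_lin a f g : cintegrable f -> cintegrable g ->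
  cintegral (fun x => a * f x + g x) = a * cintegral f + cintegral g.
Proof.
case: a => a b [fr fi] [gr gi]; rewrite /cintegral.
have iZ (c : R) (h : X -> R) : mu.-integrable setT (fun x => (h x)%:E) ->
    mu.-integrable setT (EFin \o (fun x => c * h x)).
  by move=> ih; rewrite (_ : _ \o _ = fun x => (c%:E * (h x)%:E)%E)//;
    exact: integrableZl.
have -> : \int[mu]_x complex.Re ((a +i* b)%C * f x + g x) =
    a * (\int[mu]_x complex.Re (f x)) - b * (\int[mu]_x complex.Im (f x)) +
    \int[mu]_x complex.Re (g x).
  rewrite -!RintegralZl// -RintegralB//; try exact: iZ.
  rewrite -RintegralD//.
    by apply: eq_Rintegral => x _; case: (f x) (g x) => [u v] [u' v'].
  exact: (integrableB measurableT (iZ _ _ fr) (iZ _ _ fi)).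
have -> : \int[mu]_x complex.Im ((a +i* b)%C * f x + g x) =
    a * (\int[mu]_x complex.Im (f x)) + b * (\int[mu]_x complex.Re (f x)) +
    \int[mu]_x complex.Im (g x).
  rewrite -!RintegralZl// -RintegralD//; try exact: iZ.
  rewrite -RintegralD//.
    by apply: eq_Rintegral => x _; case: (f x) (g x) => [u v] [u' v'].
  exact: (integrableD measurableT (iZ _ _ fi) (iZ _ _ fr)).
by [].
Qed.

Lemma ae_eq_cintegral f g : cmeasurable f -> cmeasurable g ->
  {ae mu, forall x, f x = g x} -> cintegral f = cintegral g.
Proof.
move=> [fr fi] [gr gi] fg; rewrite /cintegral /Rintegral; congr (fine _ +i* fine _)%C.
- apply: ae_eq_integral => //; [exact/measurable_EFinP|exact/measurable_EFinP|].
  by apply: filterS fg => x -> .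
- apply: ae_eq_integral => //; [exact/measurable_EFinP|exact/measurable_EFinP|].
  by apply: filterS fg => x -> .
Qed.

Lemma cintegral_conj f : cintegrable f ->
  cintegral (fun x => (f x)^*%C) = (cintegral f)^*%C.
Proof.
move=> [fr fi]; rewrite /cintegral /=; congr (_ +i* _)%C.
  by apply: eq_Rintegral => x _; case: (f x).
rewrite -mulN1r -RintegralZl//.
by apply: eq_Rintegral => x _; rewrite mulN1r; case: (f x).
Qed.

Definition L2dot (q r : L2) : R[i] :=
  cintegral (fun x => L2fn q x * (L2fn r x)^*%C).

Lemma cmeasurable_dot (q r : L2) :
  cmeasurable (fun x => L2fn q x * (L2fn r x)^*%C).
Proof.
apply: cmeasurableM; first by have [] := L2fnP q.
by apply: cmeasurable_conj; have [] := L2fnP r.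
Qed.

Lemma cintegrable_dot (q r : L2) :
  cintegrable (fun x => L2fn q x * (L2fn r x)^*%C).
Proof.
have [mq iq] := L2fnP q; have [mr ir] := L2fnP r.
have isq (s : L2) : mu.-integrable setT (fun x => (sqnorm (L2fn s x))%:E).
  have [ms is_] := L2fnP s; apply/integrableP; split.
    exact: measurable_sqnorm.
  by under eq_integral do rewrite gee0_abs ?lee_fin ?sqnorm_ge0//.
have iqr : mu.-integrable setT
    ((fun x => (sqnorm (L2fn q x))%:E) \+ (fun x => (sqnorm (L2fn r x))%:E))%E.
  by apply: integrableD.
have [m1 m2] := cmeasurable_dot q r.
split; apply: (le_integrable _ _ _ iqr) => //.
- exact/measurable_EFinP.
- move=> x _; rewrite /= lee_fin [leRHS]ger0_norm ?addr_ge0 ?sqnorm_ge0//.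
  rewrite !sqnormE; case: (L2fn q x) (L2fn r x) => [u v] [u' v'] /=.
  rewrite ler_norml; apply/andP; split.
    by move: (sqr_ge0 (u + u')) (sqr_ge0 (v + v')) (sqr_ge0 u) (sqr_ge0 v)
      (sqr_ge0 u') (sqr_ge0 v'); nra.
  by move: (sqr_ge0 (u - u')) (sqr_ge0 (v - v')) (sqr_ge0 u) (sqr_ge0 v)
      (sqr_ge0 u') (sqr_ge0 v'); nra.
- exact/measurable_EFinP.
- move=> x _; rewrite /= lee_fin [leRHS]ger0_norm ?addr_ge0 ?sqnorm_ge0//.
  rewrite !sqnormE; case: (L2fn q x) (L2fn r x) => [u v] [u' v'] /=.
  rewrite ler_norml; apply/andP; split.
    by move: (sqr_ge0 (u - v')) (sqr_ge0 (v + u')) (sqr_ge0 u) (sqr_ge0 v)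
      (sqr_ge0 u') (sqr_ge0 v'); nra.
  by move: (sqr_ge0 (u + v')) (sqr_ge0 (v - u')) (sqr_ge0 u) (sqr_ge0 v)
      (sqr_ge0 u') (sqr_ge0 v'); nra.
Qed.

Lemma L2dotC (q r : L2) : L2dot q r = (L2dot r q)^*%C.
Proof.
rewrite /L2dot -cintegral_conj; last exact: cintegrable_dot.
by congr cintegral; apply/funext => x; rewrite rmorphM/= conjcK mulrC.
Qed.

Lemma L2dot_linl (r : L2) (a : R[i]) (q q' : L2) :
  L2dot (a *: q + q') r = a * L2dot q r + L2dot q' r.
Proof.
rewrite /L2dot -cintegral_lin; [|exact: cintegrable_dot|exact: cintegrable_dot].
apply: ae_eq_cintegral; first exact: cmeasurable_dot.
  apply: cmeasurableD; last exact: cmeasurable_dot.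
  by apply: cmeasurableM (cmeasurable_cst _) (cmeasurable_dot _ _).
near=> x.
have -> : L2fn (a *: q + q') x = L2fn (a *: q) x + L2fn q' x.
  by near: x; exact: L2fnD.
have -> : L2fn (a *: q) x = a * L2fn q x by near: x; exact: L2fnZ.
by rewrite mulrDl mulrA.
Unshelve. all: by end_near. Qed.

Lemma L2dot_bilinear : bilinear_for *%R (conjC \; *%R) L2dot.
Proof.
split=> [r a q q' | q a r r']; first exact: L2dot_linl.
by rewrite [LHS]L2dotC L2dot_linl [L2dot q r]L2dotC [L2dot q r']L2dotC rmorphD rmorphM.
Qed.

HB.instance Definition _ :=
  bilinear_isBilinear.Build R[i] L2 L2 R[i] *%R (conjC \; *%R) L2dot
    L2dot_bilinear.

Lemma L2dot_hermitian (q r : L2) :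
  L2dot q r = (-1) ^+ false * conjC (L2dot r q).
Proof. by rewrite mul1r; exact: L2dotC. Qed.

HB.instance Definition _ :=
  isHermitianSesquilinear.Build R[i] L2 false conjC L2dot L2dot_hermitian.

Lemma L2dot_gt0 (q : L2) : q != 0 -> 0 < L2dot q q.
Proof.
move=> q0.
have -> : L2dot q q = ((\int[mu]_x sqnorm (L2fn q x))%:C)%C.
  rewrite /L2dot /cintegral; congr (_ +i* _)%C.
    apply: eq_Rintegral => x _; rewrite sqnormE.
    by case: (L2fn q x) => u v /=; rewrite mulrN opprK -!expr2.
  under eq_Rintegral => x _.
    have -> : complex.Im (L2fn q x * (L2fn q x)^*%C) = 0.
      by case: (L2fn q x) => u v /=; rewrite mulrN [v * u]mulrC addNr.
    over.
  by rewrite Rintegral_cst// mul0r.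
have [mq iq] := L2fnP q.
rewrite ltcR lt_neqAle; apply/andP; split; last first.
  by apply: Rintegral_ge0 => x _; exact: sqnorm_ge0.
apply: contra q0 => /eqP/esym q0; apply/eqP/L2_eqP.
have /(ae_eq_integral_abs mu measurableT) : (\int[mu]_x `|(sqnorm (L2fn q x))%:E| = 0)%E.
  under eq_integral do rewrite gee0_abs ?lee_fin ?sqnorm_ge0//.
  rewrite -[LHS]fineK; first by rewrite -[fine _]/(\int[mu]_x _) q0.
  by rewrite ge0_fin_numE// integral_ge0// => x _; rewrite lee_fin sqnorm_ge0.
move=> /(_ (measurable_sqnorm mq)) qx0.
have z0 : {ae mu, forall x, L2fn 0 x = 0}.
  by have := L2fnZ 0 q; rewrite scale0r; apply: filterS => x ->; rewrite mul0r.
apply: filterS2 qx0 z0 => x /(_ I)/= [] qx ->.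
by apply: Normc.eq0_normc; apply/eqP; rewrite -sqrf_eq0; apply/eqP.
Qed.

HB.instance Definition _ := isDotProduct.Build R[i] L2 L2dot L2dot_gt0.

End L2.

Arguments L2dot {d X R} mu q r.

(* An operator in H (not necessarily everywhere defined or bounded) is
   represented by its graph. *)
Definition operator (K : nzRingType) (H : lmodType K) : Type := set (H * H).

Section operators.
Context {R : realType} {H : lmodType R[i]}.
Variable dot : {dot H for conjC}.
Implicit Types (A B T : operator H) (E : set R -> H -> H).

Definition hnorm (u : H) : R := Num.sqrt (complex.Re (dot u u)).

Definition dom A : set H := [set u | exists v, A (u, v)].

Definition is_operator A :=
  [/\ A (0, 0),
      forall (a : R[i]) x y, A x -> A y -> A (a *: x + y) &
      forall u v v', A (u, v) -> A (u, v') -> v = v'].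

Definition graph_of (f : H -> H) : operator H := [set x | x.2 = f x.1].

(* product [A B] on its natural domain *)
Definition comp_op A B : operator H :=
  [set x | exists v, B (x.1, v) /\ A (v, x.2)].

Definition densely_defined A :=
  forall u (e : R), 0 < e -> exists v, dom A v /\ hnorm (u - v) < e.

Definition closure_op A : operator H :=
  [set x | forall e : R, 0 < e ->
    exists y, [/\ A y, hnorm (x.1 - y.1) < e & hnorm (x.2 - y.2) < e]].

Definition closed_op A := closure_op A = A.

Definition adjoint A : operator H :=
  [set x | forall y, A y -> dot y.2 x.1 = dot y.1 x.2].

Definition selfadjoint A :=
  [/\ is_operator A, densely_defined A & adjoint A = A].

Definition positive_op A := forall x, A x -> 0 <= dot x.2 x.1.

Definition is_abs A P :=
  [/\ selfadjoint P, positive_op P & comp_op P P = comp_op (adjoint A) A].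

(* For closed densely defined [A] there is exactly one such operator; [set0] is a
   default value. *)
Definition abs_op A : operator H := xget set0 [set P | is_abs A P].

Definition orthogonal_projection (P : H -> H) :=
  [/\ linear P, forall u, P (P u) = P u & forall u v, dot (P u) v = dot u (P v)].

Definition is_spectral_measure E :=
  [/\ forall D, measurable D -> orthogonal_projection (E D),
      E setT = id &
      forall F : (set R)^nat, (forall n, measurable (F n)) -> trivIset setT F ->
        forall u, (fun n => hnorm (E (\bigcup_k F k) u - \sum_(k < n) E (F k) u))
          @ \oo --> (0 : R)].

Definition smeasure E (u : H) (D : set R) : \bar R :=
  (complex.Re (dot (E D u) u))%:E.

Definition spectral_dom E (f : R -> R) : set H :=
  [set u | (\int[smeasure E u]_t (f t ^+ 2)%:E < +oo)%E].

(* Integral of [f] against the complex measure [D |-> dot (E D u) v], which is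
   defined from positive measures by polarization. *)
Definition sintegral_dot E (f : R -> R) (u v : H) : R[i] :=
  4%:R^-1 * \sum_(k < 4) 'i%C ^+ k *
    (fine (\int[smeasure E (u + 'i%C ^+ k *: v)]_t (f t)%:E)%E)%:C%C.

Definition spectral_integral E (f : R -> R) : operator H :=
  [set x | spectral_dom E f x.1 /\
    forall v, spectral_dom E f v -> dot x.2 v = sintegral_dot E f x.1 v].

(* A selfadjoint operator has a spectral measure, unique on Borel sets, and only
   the Borel sets matter for [spectral_integral]. *)
Definition spectral_measure T : set R -> H -> H :=
  xget ((fun _ u => u) : set R -> H -> H)
    [set E | is_spectral_measure E /\ T = spectral_integral E id].

(* [T] is meant to be positive, so that the spectral measure lives on the
   nonnegative reals, where [t `^ a] is the usual power, with [t `^ 0 = 1]. *)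
Definition pow_op T (a : R) : operator H :=
  spectral_integral (spectral_measure T) (fun t => t `^ a).

Definition partial_isometry (U : H -> H) :=
  [/\ linear U, exists M : R, forall u, hnorm (U u) <= M * hnorm u &
      forall u, (forall v, U v = 0 -> dot u v = 0) -> hnorm (U u) = hnorm u].

(* [A = U |A|] is the polar decomposition of [A]. *)
Definition is_phase A U :=
  [/\ partial_isometry U, forall u, U u = 0 <-> A (u, 0) &
      A = comp_op (graph_of U) (abs_op A)].

Definition phase A : H -> H := xget (id : H -> H) [set U | is_phase A U].

Definition aluthge (a : R) A : operator H :=
  comp_op (pow_op (abs_op A) a)
    (comp_op (graph_of (phase A)) (pow_op (abs_op A) (1 - a))).

Definition p_hyponormal (p : R) A :=
  [/\ is_operator A, densely_defined A, closed_op A,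
      dom (pow_op (abs_op A) p) `<=` dom (pow_op (abs_op (adjoint A)) p) &
      forall f g g', pow_op (abs_op A) p (f, g) ->
        pow_op (abs_op (adjoint A)) p (f, g') -> hnorm g' <= hnorm g].

Definition hyponormal A := p_hyponormal 1 A.

End operators.

Section weighted_composition.
Context {d : measure_display} {X : measurableType d} {R : realType}.
Variable mu : {measure set X -> \bar R}.
Implicit Types (phi : X -> X) (w : X -> R[i]) (h : X -> \bar R).

Definition wmeasure w (D : set X) : \bar R := (\int[mu]_(x in D) (sqnorm (w x))%:E)%E.

(* [h] is (a version of) the Radon-Nikodym derivative of the measure
   [D |-> wmeasure w (phi @^-1` D)], which need not be sigma-finite, so that
   the derivative of the library is not applicable. *)
Definition is_hphi phi w h :=
  [/\ measurable_fun setT h, forall x, (0 <= h x)%E &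
      forall D, measurable D ->
        pushforward (wmeasure w) phi D = (\int[mu]_(x in D) h x)%E].

(* Membership of the image in [L2 mu] is part of the type, which yields the
   maximal domain. *)
Definition wcomp phi w : operator (L2 mu) :=
  [set x | {ae mu, forall t, L2fn x.2 t = w t * L2fn x.1 (phi t)}].

(* If [wcomp phi w] is densely defined then, almost everywhere on [w != 0], [h]
   is finite and [h \o phi] is finite and positive, so that [fine] and the
   inverse of 0 are harmless; on [w = 0] the right-hand side is 0. *)
Definition is_walpha phi w h (a : R) (wa : X -> R[i]) :=
  cmeasurable wa /\
  {ae mu, forall t,
     wa t = w t * (((fine (h t) / fine (h (phi t))) `^ (a / 2))%:C)%C}.

End weighted_composition.

Arguments wcomp {d X R} mu phi w _.

(* Main.v *)
(** Write [h] for [h_{phi,w}], [g] for its square root and [h'] for [h_{phi,w_{1-p}}].  Then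
    [C_{phi,w} = U M_g], where [M_g] is the multiplication by [g] and [U] is a partial isometry with
    initial space [L^2({g != 0})], and this is the polar decomposition.  Uniqueness of positive
    square roots and of spectral measures gives [|C|^a = M_g^a] and [|C^*|^a = U M_g^a U^*], so
    [p]-hyponormality reads [|M_g^p U^* f| <= |M_g^p f|], and the closure of the Aluthge transform
    [M_g^(1-p) U M_g^p] is the weighted composition operator with weight [w_{1-p}].

    Testing [p]-hyponormality on [f = max(g, e)^(-2p) U (g^(1+p) 1_D)] bounds
    [\int_(phi^-1 D) |w|^2 (g o phi)^(2p) / max(g, e)^(2p)] by [\int_D h]; Young's inequality
    [1 <= p t^(2(1-p)) + (1-p) t^(-2p)] with [t = max(g, e) / (g o phi)] then yields, as [e] tends
    to 0, [\int_D h <= \int_D h'], whence [h <= h'].  If [g' f] is square integrable, with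
    [g'] the square root of [h'], so is [g f], the adjoint of the transform sends [f] to
    [M_g^p U^* M_g^(1-p) f], and the norm of this is at most [|g f| <= |g' f|]. *)
Require Import Defs.
From HB Require Import structures.
From mathcomp Require Import all_boot all_order all_algebra.
From mathcomp Require Import all_classical all_reals all_analysis.
From mathcomp Require Import measurable_realfun sesquilinear ring_quotient.
From mathcomp Require Import ring lra.
From mathcomp.real_closed Require Import complex.
Set Implicit Arguments.
Unset Strict Implicit.
Unset Printing Implicit Defensive.
Import Order.TTheory GRing.Theory Num.Def Num.Theory.
Import numFieldNormedType.Exports.
Local Open Scope classical_set_scope.
Local Open Scope ring_scope.

(** The modulus, the spectral measure and the phase are chosen by a defining property, so explicit
    candidates become usable only through uniqueness theorems for unbounded operators. Uniqueness of
    square roots and of spectral measures both reduce to one growth comparison, [pow_contract]: a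
    nonzero vector cannot grow at least like b^n and at most like a^n with a < b. The iterations run
    on subspaces where multiplication by g is bounded.

    In the test vector, [e] keeps the negative power of g bounded, so that f is square integrable
    and lies in the domain. The powers of t in Young's inequality are dictated by the data: t^(-2p)
    is the integrand that the test controls, and t^(2(1-p)) is, up to [e], the ratio of |w_{1-p}|^2
    to |w|^2. The controlled term enters with the coefficient 1-p < 1, so it can be absorbed,
    provided that the integral of h over D is finite; hence D is taken inside a set where g is
    bounded.

    An almost everywhere identity may be composed with [phi] only where w is nonzero, whence the
    recurring case distinctions on [w x]. *)

Section complex_re.
Context {R : realType}.
Implicit Types (a b : R[i]) (r : R).

Lemma ReD a b : complex.Re (a + b) = complex.Re a + complex.Re b.
Proof. by case: a b => ? ? []. Qed.

Lemma ReN a : complex.Re (- a) = - complex.Re a.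
Proof. by case: a. Qed.

Lemma ImD a b : complex.Im (a + b) = complex.Im a + complex.Im b.
Proof. by case: a b => ? ? []. Qed.

Lemma ImN a : complex.Im (- a) = - complex.Im a.
Proof. by case: a. Qed.

Lemma Re_conj a : complex.Re (conjC a) = complex.Re a.
Proof. by case: a. Qed.

Lemma ReZ r a : complex.Re (r%:C%C * a) = r * complex.Re a.
Proof. by case: a => x y /=; rewrite mul0r subr0. Qed.

Lemma Re_iM a : complex.Re ('i%C * a) = - complex.Im a.
Proof. by case: a => x y /=; rewrite mul0r mul1r sub0r. Qed.

End complex_re.

(** * The underlying real inner product, closures and adjoints *)

Section real_inner_product.
Context {R : realType} {H : lmodType R[i]}.
Variable dot : {dot H for conjC}.
Implicit Types (u v z : H) (x y : H * H) (r : R) (A B T P : operator H).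

(** Estimates are made in the underlying real inner product space; a complex identity is recovered
    by testing the real one also against ['i%C *: v]. *)
Definition rdot u v : R := complex.Re (dot u v).
Definition nsq u : R := rdot u u.

Local Notation iu u := ('i%C *: u).

Lemma rdotC u v : rdot u v = rdot v u.
Proof.
by rewrite /rdot (hermC dot u v) expr0 mul1r Re_conj.
Qed.

Lemma rdotDl u v z : rdot (u + v) z = rdot u z + rdot v z.
Proof. by rewrite /rdot linearDl ReD. Qed.

Lemma rdotDr u v z : rdot z (u + v) = rdot z u + rdot z v.
Proof. by rewrite rdotC rdotDl !(rdotC z). Qed.

Lemma rdotZl r u v : rdot (r%:C%C *: u) v = r * rdot u v.
Proof. by rewrite /rdot linearZl_LR ReZ. Qed.

Lemma rdotZr r u v : rdot u (r%:C%C *: v) = r * rdot u v.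
Proof. by rewrite rdotC rdotZl rdotC. Qed.

Lemma rdotNl u v : rdot (- u) v = - rdot u v.
Proof. by rewrite /rdot linearNl ReN. Qed.

Lemma rdotNr u v : rdot u (- v) = - rdot u v.
Proof. by rewrite rdotC rdotNl rdotC. Qed.

Lemma rdotBl u v z : rdot (u - v) z = rdot u z - rdot v z.
Proof. by rewrite rdotDl rdotNl. Qed.

Lemma rdotBr u v z : rdot z (u - v) = rdot z u - rdot z v.
Proof. by rewrite rdotDr rdotNr. Qed.

Lemma rdot0l u : rdot 0 u = 0.
Proof. by rewrite /rdot linear0l. Qed.

Lemma rdot0r u : rdot u 0 = 0.
Proof. by rewrite rdotC rdot0l. Qed.

Lemma dot_ir u v : dot u (iu v) = - 'i%C * dot u v.
Proof. by rewrite linearZr_LR /=; congr (_ * _); apply/eqP; rewrite eq_complex /= oppr0 !eqxx. Qed.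

Lemma dot_rdot u v : dot u v = (rdot u v +i* rdot u (iu v))%C.
Proof.
rewrite /rdot dot_ir mulNr ReN Re_iM opprK.
by apply/eqP; rewrite eq_complex /= !eqxx.
Qed.

Lemma dot_eqP u v (y : H) z :
  dot u v = dot y z <->
  rdot u v = rdot y z /\ rdot u (iu v) = rdot y (iu z).
Proof.
split=> [e|[e1 e2]]; last by rewrite !dot_rdot e1 e2.
by rewrite /rdot !dot_ir e.
Qed.

Lemma rdot_ii u v : rdot (iu u) (iu v) = rdot u v.
Proof.
rewrite /rdot dot_ir linearZl_LR mulrA mulNr -expr2 sqr_i opprK mul1r //.
Qed.

Lemma iuiu u : iu (iu u) = - u.
Proof.
rewrite scalerA -scaleN1r; congr (_ *: _); apply/eqP; rewrite eq_complex /=.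
by apply/andP; split; apply/eqP; ring.
Qed.

Lemma rdot_ir u v : rdot u (iu v) = - rdot (iu u) v.
Proof. by rewrite -rdot_ii iuiu rdotNr. Qed.

Lemma dot_nsq u : dot u u = (nsq u)%:C%C.
Proof.
rewrite dot_rdot; congr (_ +i* _)%C.
have := rdot_ir u u; rewrite rdotC => /eqP.
by rewrite -subr_eq0 opprK -mulr2n mulrn_eq0 /= => /eqP; rewrite rdotC.
Qed.

Lemma nsq_ge0 u : 0 <= nsq u.
Proof. by have := dnorm_ge0 dot u; rewrite dot_nsq lecR. Qed.

Lemma nsq_eq0 u : nsq u = 0 -> u = 0.
Proof. by move=> e; apply/eqP; rewrite -(dnorm_eq0 dot) dot_nsq e. Qed.

Lemma nsq_rdot u : nsq u = rdot u u.
Proof. by []. Qed.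

Lemma nsq0 : nsq 0 = 0. Proof. exact: rdot0l. Qed.

Lemma nsqN u : nsq (- u) = nsq u.
Proof. by rewrite /nsq rdotNl rdotNr opprK. Qed.

Lemma nsqD u v : nsq (u + v) = nsq u + nsq v + 2 * rdot u v.
Proof. by rewrite /nsq rdotDl !rdotDr (rdotC v u); ring. Qed.

Lemma nsqB u v : nsq (u - v) = nsq u + nsq v - 2 * rdot u v.
Proof. by rewrite nsqD nsqN rdotNr mulrN. Qed.

Lemma nsqZ r u : nsq (r%:C%C *: u) = r ^+ 2 * nsq u.
Proof. by rewrite /nsq rdotZl rdotZr mulrA expr2. Qed.

Lemma nsqi u : nsq (iu u) = nsq u.
Proof. exact: rdot_ii. Qed.

Lemma rdot_CS u v : rdot u v ^+ 2 <= nsq u * nsq v.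
Proof.
have [->|v0] := eqVneq v 0; first by rewrite rdot0r nsq0 mulr0 expr0n.
have nv : 0 < nsq v.
  rewrite lt_neqAle nsq_ge0 andbT eq_sym; apply: contra v0 => /eqP/nsq_eq0 ->.
  exact: eqxx.
(* A multiple of the component of [u] orthogonal to [v], which avoids a division. *)
have := nsq_ge0 ((nsq v)%:C%C *: u - (rdot u v)%:C%C *: v).
rewrite nsqB !nsqZ rdotZl rdotZr.
rewrite (_ : _ - _ = nsq v * (nsq u * nsq v - rdot u v ^+ 2)); last by ring.
by rewrite pmulr_rge0// subr_ge0.
Qed.

Local Notation hn := (hnorm dot).

Lemma hnorm_ge0 u : 0 <= hn u. Proof. exact: sqrtr_ge0. Qed.

Lemma hnorm_sqr u : hn u ^+ 2 = nsq u.
Proof. by rewrite sqr_sqrtr// nsq_ge0. Qed.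

Lemma hnorm0 : hn 0 = 0.
Proof. by rewrite /hnorm -/(rdot 0 0) rdot0l sqrtr0. Qed.

Lemma hnorm_eq0 u : hn u = 0 -> u = 0.
Proof. by move=> e; apply: nsq_eq0; rewrite -hnorm_sqr e expr0n. Qed.

Lemma hnorm_gt0 u : u != 0 -> 0 < hn u.
Proof.
move=> u0; rewrite lt_neqAle hnorm_ge0 andbT eq_sym.
by apply: contra u0 => /eqP/hnorm_eq0 ->.
Qed.

Lemma hnormN u : hn (- u) = hn u.
Proof. by rewrite /hnorm -/(rdot _ _) -/(nsq _) nsqN. Qed.

Lemma hnorm_le u v : nsq u <= nsq v -> hn u <= hn v.
Proof. by move=> e; rewrite ler_wsqrtr. Qed.

Lemma hnorm_leM (C : R) u v : 0 <= C -> nsq u <= C ^+ 2 * nsq v -> hn u <= C * hn v.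
Proof.
move=> C0 h; rewrite -(@ler_sqr _ (hn u)) ?nnegrE ?mulr_ge0 ?hnorm_ge0//.
by rewrite exprMn !hnorm_sqr.
Qed.

Lemma nsq_le u v : hn u <= hn v -> nsq u <= nsq v.
Proof. by move=> e; rewrite -!hnorm_sqr ler_sqr// nnegrE hnorm_ge0. Qed.

Lemma hnormZ r u : hn (r%:C%C *: u) = `|r| * hn u.
Proof.
by rewrite /hnorm -/(rdot _ _) -/(nsq _) nsqZ sqrtrM ?sqr_ge0// sqrtr_sqr.
Qed.

Lemma rdot_le u v : `|rdot u v| <= hn u * hn v.
Proof.
rewrite -(@ler_sqr _ `|_|) ?nnegrE ?mulr_ge0 ?hnorm_ge0//.
by rewrite exprMn !hnorm_sqr real_normK ?num_real// rdot_CS.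
Qed.

Lemma hnorm_ge_rdot (C : R) u v : C * nsq u <= rdot v u -> C * hn u <= hn v.
Proof.
move=> h; have [->|u0] := eqVneq u 0; first by rewrite hnorm0 mulr0 hnorm_ge0.
rewrite -(ler_pM2r (hnorm_gt0 u0)) -mulrA -expr2 hnorm_sqr; apply: le_trans h _.
by apply: le_trans (ler_norm _) _; exact: rdot_le.
Qed.

Lemma hnormD u v : hn (u + v) <= hn u + hn v.
Proof.
rewrite -(@ler_sqr _ (hn _)) ?nnegrE ?addr_ge0 ?hnorm_ge0//.
rewrite sqrrD !hnorm_sqr nsqD.
by have := le_trans (ler_norm _) (rdot_le u v); lra.
Qed.

Lemma hnormB u v : hn (u - v) <= hn u + hn v.
Proof. by rewrite -(hnormN v) hnormD. Qed.

Lemma rdot_inj u v : (forall z, rdot u z = rdot v z) -> u = v.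
Proof.
move=> e; apply/subr0_eq/nsq_eq0.
by rewrite /nsq rdotBl e subrr.
Qed.

Lemma small_hnorm u : (forall e, 0 < e -> hn u <= e) -> u = 0.
Proof.
move=> e; apply: hnorm_eq0; apply/eqP; rewrite eq_le hnorm_ge0 andbT.
by apply/ler_addgt0Pl => x x0; rewrite addr0; exact: e.
Qed.

(** A [z] of the domain closer to [u - v] than the norm of [u - v] makes [nsq (u - v)] smaller than
    itself. *)
Lemma dense_rdot_inj A u v : densely_defined dot A ->
  (forall z, dom A z -> rdot u z = rdot v z) -> u = v.
Proof.
move=> dA e; apply/subr0_eq/eqP; apply: contraT => uv0.
have [z [Az zl]] := dA (u - v) _ (hnorm_gt0 uv0).
have : nsq (u - v) < nsq (u - v).
  rewrite {1}/nsq -[X in rdot _ X](subrK z) rdotDr [X in _ + X]rdotBl e// subrr addr0.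
  apply: le_lt_trans (ler_norm _) _; apply: le_lt_trans (rdot_le _ _) _.
  by rewrite -hnorm_sqr expr2 ltr_pM2l// hnorm_gt0.
by rewrite ltxx.
Qed.

Lemma closure_sub A : A `<=` closure_op dot A.
Proof. by move=> x Ax e e0; exists x; rewrite !subrr hnorm0. Qed.

(** Stability of the graph under multiplication by i turns the real adjoint identity into the
    complex one. *)
Lemma adjoint_rdotP A x :
  (forall y, A y -> A ('i%C *: y)) ->
  (forall y, A y -> rdot y.2 x.1 = rdot y.1 x.2) -> adjoint dot A x.
Proof.
move=> Ai h y Ay; apply/dot_eqP; split; first exact: h.
by rewrite !rdot_ir; have := h _ (Ai _ Ay) => /= ->.
Qed.

Lemma adjoint_rdot A x y : adjoint dot A x -> A y -> rdot y.2 x.1 = rdot y.1 x.2.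
Proof. by move=> Ax /Ax e; rewrite /rdot e. Qed.


Lemma closed_adjoint A : closed_op dot (adjoint dot A).
Proof.
apply/seteqP; split; last exact: closure_sub.
move=> x cx y Ay.
(* Continuity of the adjoint identity in [x], for general [z] and [w] because it serves both the
   real and the imaginary part. *)
have key z w : (forall x', adjoint dot A x' ->
     rdot y.2 x'.1 = rdot y.1 x'.2 /\ rdot z x'.1 = rdot w x'.2) ->
   rdot z x.1 = rdot w x.2.
  move=> h; apply/subr0_eq/eqP; rewrite -normr_eq0 eq_le normr_ge0 andbT.
  apply/ler_addgt0Pl => e e0; rewrite addr0.
  set c := 1 + hn z + hn w.
  have c0 : 0 < c by rewrite /c; have := hnorm_ge0 z; have := hnorm_ge0 w; lra.
  have [x' [Ax' l1 l2]] := cx (e / c) (divr_gt0 e0 c0).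
  have -> : rdot z x.1 - rdot w x.2 = rdot z (x.1 - x'.1) - rdot w (x.2 - x'.2).
    by rewrite !rdotBr (h _ Ax').2; ring.
  apply: le_trans (ler_normB _ _) _.
  apply: le_trans (lerD (rdot_le _ _) (rdot_le _ _)) _.
  have -> : e = c * (e / c) by rewrite mulrCA divff ?mulr1// gt_eqF.
  have := hnorm_ge0 z; have := hnorm_ge0 w.
  have := hnorm_ge0 (x.1 - x'.1); have := hnorm_ge0 (x.2 - x'.2).
  by rewrite /c; move: l1 l2; nra.
apply/dot_eqP; split; first by apply: key => x' Ax'; split; exact: (adjoint_rdot Ax' Ay).
rewrite !rdot_ir; congr (- _); apply: key => x' Ax'; split; first exact: (adjoint_rdot Ax' Ay).
have /dot_eqP[_] := Ax' _ Ay; rewrite !rdot_ir => /oppr_inj //.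
Qed.

Lemma adjoint_anti A B : A `<=` B -> adjoint dot B `<=` adjoint dot A.
Proof. by move=> AB x Bx y /AB /Bx. Qed.

(** Adjoints reverse inclusions, so of two nested selfadjoint operators neither can be properly
    larger. *)
Lemma selfadjoint_max T P : selfadjoint dot T -> selfadjoint dot P ->
  P `<=` T -> T = P.
Proof.
move=> [_ _ Ta] [_ _ Pa] PT; apply/seteqP; split=> //.
by rewrite -{1}Ta -Pa; exact: adjoint_anti.
Qed.

Lemma is_operator_scale A a x : is_operator A -> A x -> A (a *: x).
Proof.
move=> [A0 Al _] Ax; have := Al a x (0, 0) Ax A0.
by rewrite [X in A X](_ : _ = a *: x)//; case: x {Ax} => x1 x2; congr pair; rewrite /= addr0.
Qed.

Lemma is_operator_add A x y : is_operator A -> A x -> A y -> A (x + y).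
Proof. by move=> [A0 Al _] Ax Ay; have := Al 1 x y Ax Ay; rewrite scale1r. Qed.

Lemma is_operator_sub A x y : is_operator A -> A x -> A y -> A (x - y).
Proof.
move=> hA Ax Ay; apply: is_operator_add => //; rewrite -scaleN1r.
exact: is_operator_scale.
Qed.

Lemma positive_rdot T x : positive_op dot T -> T x -> 0 <= rdot x.2 x.1.
Proof. by move=> pT /pT; rewrite /rdot; case: (dot _ _) => a b /=; rewrite lecE /= => /andP[]. Qed.

End real_inner_product.

(** * Spectral measures, their scalar measures and spectral integrals *)

Import HBSimple HBNNSimple.

(** Integrals are built from simple functions, whose level sets are measurable. This allows the bare
    set function [smeasure] to be replaced by a measure. *)
Lemma eq_integral_on_measurable d (T : measurableType d) (R : realType)
    (m1 m2 : set T -> \bar R) (f : T -> \bar R) :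
  (forall D, measurable D -> m1 D = m2 D) -> (\int[m1]_x f x = \int[m2]_x f x)%E.
Proof.
move=> e.
have se (h : {nnsfun T >-> R}) : sintegral m1 h = sintegral m2 h.
  by apply: eq_fsbigr => r _; rewrite e//; exact: measurable_funPTI.
by rewrite /integral; congr (ereal_sup _ - ereal_sup _)%E;
  apply/seteqP; split=> _ [h hf <-]; exists h.
Qed.

Lemma sqr_integrable d (T : measurableType d) (R : realType)
    (m : {measure set T -> \bar R}) (f : T -> R) :
  (m setT < +oo)%E -> measurable_fun setT f ->
  (\int[m]_t (f t ^+ 2)%:E < +oo)%E -> m.-integrable setT (EFin \o f).
Proof.
move=> fm mf du.
have mf2 : measurable_fun setT (fun t => (f t ^+ 2)%:E).
  by apply/measurable_EFinP; exact: measurable_funX.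
have mf' : measurable_fun setT (EFin \o f) by exact/measurable_EFinP.
have f2_ge0 t : (0 <= (f t ^+ 2)%:E)%E by rewrite lee_fin sqr_ge0.
apply/integrableP; split => //.
apply: (@le_lt_trans _ _ (\int[m]_t (1 + (f t ^+ 2)%:E))%E).
  apply: ge0_le_integral => //.
  - exact: measurableT_comp.
  - by apply: emeasurable_funD => //; exact: measurable_cst.
  - move=> t _ /=; rewrite -EFinD lee_fin.
    by have [] := lerP 0 (f t) => ?; [rewrite ger0_norm//|rewrite ltr0_norm//]; nra.
rewrite ge0_integralD//.
by rewrite integral_cst// mul1e lte_add_pinfty.
Qed.

Section spectral_measures.
Context {R : realType} {H : lmodType R[i]}.
Variable dot : {dot H for conjC}.
Implicit Types (u v : H) (D : set R).

Local Notation rd := (rdot dot).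
Local Notation nsq := (nsq dot).
Local Notation hn := (hnorm dot).

Section one_measure.
Variable E : set R -> H -> H.
Hypothesis hE : is_spectral_measure dot E.

Lemma spectral_linear D a u v : measurable D ->
  E D (a *: u + v) = a *: E D u + E D v.
Proof. by move=> mD; have [/(_ _ mD)[lE _ _] _ _] := hE; rewrite lE. Qed.

Lemma spectralD D u v : measurable D -> E D (u + v) = E D u + E D v.
Proof. by move=> mD; rewrite -[u in LHS]scale1r spectral_linear// scale1r. Qed.

Lemma spectral0 D : measurable D -> E D 0 = 0.
Proof.
by move=> mD; have := spectralD 0 0 mD; rewrite addr0 -{1}[E D 0]addr0 => /addrI.
Qed.

Lemma spectralZ D a u : measurable D -> E D (a *: u) = a *: E D u.
Proof. by move=> mD; rewrite -[a *: u]addr0 spectral_linear// spectral0// addr0. Qed.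

Lemma spectralN D u : measurable D -> E D (- u) = - E D u.
Proof. by move=> mD; rewrite -scaleN1r spectralZ// scaleN1r. Qed.

Lemma spectralB D u v : measurable D -> E D (u - v) = E D u - E D v.
Proof. by move=> mD; rewrite spectralD// spectralN. Qed.

Lemma spectralK D u : measurable D -> E D (E D u) = E D u.
Proof. by move=> mD; have [/(_ _ mD)[_ -> _] _ _] := hE. Qed.

Lemma spectral_sym D u v : measurable D -> rd (E D u) v = rd u (E D v).
Proof. by move=> mD; have [/(_ _ mD)[_ _ s] _ _] := hE; rewrite /rdot s. Qed.

Lemma spectralT u : E setT u = u.
Proof. by have [_ -> _] := hE. Qed.

Lemma spectral_nsq D u : measurable D -> rd (E D u) u = nsq (E D u).
Proof. by move=> mD; rewrite -[in LHS]spectralK// spectral_sym. Qed.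

Lemma spectral_nsq_le D u : measurable D -> nsq (E D u) <= nsq u.
Proof.
move=> mD; have := rdot_CS dot (E D u) u; rewrite spectral_nsq// expr2.
have [->|e0] := eqVneq (nsq (E D u)) 0; first by rewrite nsq_ge0.
by rewrite ler_pM2l// lt_neqAle eq_sym e0 nsq_ge0.
Qed.

(** Countable additivity for the constant sequence [set0] makes large multiples of [E set0 u]
    small. *)
Lemma spectral_set0 u : E set0 u = 0.
Proof.
apply: (@small_hnorm R _ dot) => e e0; have [_ _ /(_ (fun=> set0))] := hE.
rewrite bigcup0//.
move=> /(_ (fun=> measurable0) (@trivIset_set0 _ _ _) u)/cvgrPdist_lt/(_ e e0)[N _].
(* Subtracting [N.+2] terms leaves [- N.+1] copies of [E set0 u], and at least one copy is enough
   for the bound. *)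
move=> /(_ N.+2 (ltnW (leqnSn _)))/=.
rewrite sub0r normrN ger0_norm ?hnorm_ge0// sumr_const card_ord.
rewrite (_ : _ - _ = - ((N.+1%:R)%:C%C *: E set0 u)); last first.
  by rewrite rmorph_nat scaler_nat mulrS opprD addrA subrr add0r.
rewrite hnormN hnormZ normr_nat => /ltW; apply: le_trans.
by rewrite ler_peMl ?hnorm_ge0// ler1n.
Qed.


Lemma spectralU A B u : measurable A -> measurable B -> [disjoint A & B] ->
  E (A `|` B) u = E A u + E B u.
Proof.
move=> mA mB AB; apply/subr0_eq/(@small_hnorm R _ dot) => e e0.
have mF n : measurable (bigcup2 A B n) by case: n => [|[|n]] //; exact: measurable0.
have [_ _ /(_ _ mF)] := hE; rewrite bigcup2E.
have tF : trivIset setT (bigcup2 A B) by rewrite -trivIset_bigcup2; exact/disj_set2P.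
move=> /(_ tF u)/cvgrPdist_lt/(_ e e0)[N _].
move=> /(_ N.+2 (ltnW (leqnSn _)))/=.
rewrite sub0r normrN ger0_norm ?hnorm_ge0// !big_ord_recl/= big1 ?addr0.
  by move=> /ltW.
by move=> i _; rewrite spectral_set0.
Qed.

(** For the projection of the union, [nsq] equals [rd] against the vector [x]; expanding both, only
    the former has a cross term, which therefore vanishes. With [E A x] in place of [x] the cross
    term is [nsq (E B (E A x))]. *)
Lemma spectral_orth A B u v : measurable A -> measurable B -> [disjoint A & B] ->
  rd (E A u) (E B v) = 0.
Proof.
move=> mA mB AB.
have mAB : measurable (A `|` B) by exact: measurableU.
have orth x : rd (E A x) (E B x) = 0.
  have := spectral_nsq x mAB; rewrite spectralU// nsqD rdotDl !spectral_nsq//.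
  by lra.
suff EBA x : E B (E A x) = 0 by rewrite -spectral_sym// EBA rdot0l.
apply: (@nsq_eq0 R _ dot); have := orth (E A x).
by rewrite spectralK// rdotC spectral_nsq.
Qed.

Lemma spectralI A B u : measurable A -> measurable B -> E A (E B u) = E (A `&` B) u.
Proof.
move=> mA mB.
have mI : measurable (A `&` B) by exact: measurableI.
have mBA : measurable (B `\` A) by exact: measurableD.
have mAB : measurable (A `\` B) by exact: measurableD.
have dis C D : C `&` D = set0 -> [disjoint C & D] by move=> h; apply/disj_setPS; rewrite h.
apply: (@rdot_inj R _ dot) => z; rewrite -[in LHS](setUIDK B A) (setIC B A).
rewrite spectralU//; last by apply: dis; rewrite -subset0 => t /=; tauto.
rewrite spectral_sym// rdotDl.
have -> : rd (E (B `\` A) u) (E A z) = 0.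
  by apply: spectral_orth => //; apply: dis; rewrite setDE -setIA setICl setI0.
rewrite addr0 -[in X in rd _ (X z)](setUIDK A B) spectralU//; last first.
  by apply: dis; rewrite -subset0 => t /=; tauto.
rewrite rdotDr (spectral_orth _ _ mI mAB); last first.
  by apply: dis; rewrite -subset0 => t /=; tauto.
by rewrite addr0 -spectral_sym// spectralK.
Qed.


(** A measure must be nonnegative on all sets, while [E] is arbitrary off the Borel sets; hence the
    value 0 there. *)
Definition smeas_fun u D : \bar R :=
  if `[< measurable D >] then (nsq (E D u))%:E else 0%E.

Lemma smeas_funE u D : measurable D -> smeas_fun u D = (nsq (E D u))%:E.
Proof. by move=> mD; rewrite /smeas_fun asboolT. Qed.

Let smeas0 u : smeas_fun u set0 = 0%E.
Proof. by rewrite smeas_funE// spectral_set0 nsq0. Qed.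

Let smeas_ge0 u D : (0 <= smeas_fun u D)%E.
Proof. by rewrite /smeas_fun; case: asboolP => // _; rewrite lee_fin nsq_ge0. Qed.

Let smeas_sigma_additive u : semi_sigma_additive (smeas_fun u).
Proof.
move=> F mF tF mU.
rewrite (_ : (fun n => _) = EFin \o (fun n => \sum_(i < n) nsq (E (F i) u))); last first.
  apply/funext => n /=; rewrite -sumEFin big_mkord.
  by apply: eq_bigr => i _; rewrite smeas_funE.
rewrite smeas_funE//; apply: cvg_EFin; first by near=> n.
have [_ _ /(_ _ mF tF u) c] := hE.
apply/cvgrPdist_le => e e0.
move/cvgrPdist_lt : c => /(_ (e / (1 + hn u))).
have c0 : 0 < 1 + hn u by have := hnorm_ge0 dot u; lra.
move=> /(_ (divr_gt0 e0 c0)); apply: filterS => n /=.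
rewrite sub0r normrN ger0_norm ?hnorm_ge0// => l.
rewrite -spectral_nsq//.
rewrite (_ : _ - _ = rd (E (\bigcup_k F k) u - \sum_(k < n) E (F k) u) u); last first.
  rewrite rdotBl; congr (_ - _); elim/big_rec2 : _ => [|i y z _ ->].
    by rewrite rdot0l.
  by rewrite rdotDl spectral_nsq.
apply: le_trans (rdot_le _ _ _) _.
rewrite -[leRHS](divfK (lt0r_neq0 c0)).
by apply: ler_pM; rewrite ?hnorm_ge0 ?ltW//; lra.
Unshelve. all: by end_near. Qed.

Lemma smeas_exists u : {m : {measure set R -> \bar R} |
  forall D, measurable D -> m D = (nsq (E D u))%:E}.
Proof.
have := isMeasure.Build _ _ _ (smeas_fun u) (smeas0 u) (@smeas_ge0 u)
  (@smeas_sigma_additive u).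
move=> b; pose m : {measure set R -> \bar R} := HB.pack (smeas_fun u) b.
by exists m => D mD; exact: smeas_funE.
Qed.

Definition smeas u : {measure set R -> \bar R} := sval (smeas_exists u).

Lemma smeasE u D : measurable D -> smeas u D = (nsq (E D u))%:E.
Proof. exact: (svalP (smeas_exists u)). Qed.

Lemma smeasureE u D : measurable D -> smeasure dot E u D = (nsq (E D u))%:E.
Proof. by move=> mD; rewrite /smeasure -/(rd _ _) spectral_nsq. Qed.


Local Notation dm := (spectral_dom dot E).
Local Notation iu u := ('i%C *: u).

Lemma integral_smeasure u (f : R -> \bar R) :
  (\int[smeasure dot E u]_t f t = \int[smeas u]_t f t)%E.
Proof.
by apply: eq_integral_on_measurable => D mD; rewrite smeasE// smeasureE.
Qed.

Lemma smeas_finite u : (smeas u setT < +oo)%E.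
Proof. by rewrite smeasE// ltry. Qed.

Lemma smeas_integrable_cst u D (b : R) : measurable D ->
  (smeas u).-integrable D (cst b%:E).
Proof.
move=> mD; apply/integrableP; split; first exact: measurable_cst.
by under eq_integral do rewrite abse_EFin; rewrite integral_cst// smeasE// -EFinM ltry.
Qed.

(** The mixed vector has the scalar measure of [u] inside [D] and that of [v] outside. *)
Lemma integral_smeas_mix D u v (f : R -> \bar R) :
  measurable D -> measurable_fun setT f ->
  (\int[smeas (E D u + E (~` D) v)]_t f t =
   \int[smeas u]_(t in D) f t + \int[smeas v]_(t in ~` D) f t)%E.
Proof.
move=> mD mf; have mC := measurableC mD.
rewrite -(setUv D) integral_setU//; last 2 first.
- by rewrite setUv.
- by apply/disj_set2P; rewrite setICr.
have EI A B x : measurable A -> measurable B -> A `<=` B -> E A (E B x) = E A x.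
  by move=> mA mB AB; rewrite spectralI// setIidl.
have E0 A B x : measurable A -> measurable B -> A `<=` ~` B -> E A (E B x) = 0.
  move=> mA mB AB; rewrite spectralI// (_ : A `&` B = set0) ?spectral_set0//.
  by rewrite -subset0 => t [/AB].
congr (_ + _)%E; apply: eq_measure_integral => A mA AD;
  rewrite !smeasE// spectralD//.
  by rewrite EI// E0 ?addr0// setCK.
by rewrite E0// add0r EI.
Qed.

Lemma integral_smeas0 (f : R -> \bar R) A : (\int[smeas 0]_(t in A) f t = 0)%E.
Proof.
rewrite (@eq_measure_integral _ _ _ _ mzero); first exact: integral_measure_zero.
by move=> B mB _; rewrite smeasE// spectral0// nsq0.
Qed.

Lemma integral_smeas_proj D u (f : R -> \bar R) :
  measurable D -> measurable_fun setT f ->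
  (\int[smeas (E D u)]_t f t = \int[smeas u]_(t in D) f t)%E.
Proof.
move=> mD mf; have mC := measurableC mD.
have := integral_smeas_mix u 0 mD mf.
by rewrite spectral0// addr0 integral_smeas0 adde0.
Qed.

Lemma integral_smeasN u (f : R -> \bar R) A :
  (\int[smeas (- u)]_(t in A) f t = \int[smeas u]_(t in A) f t)%E.
Proof.
by apply: eq_measure_integral => B mB _; rewrite !smeasE// spectralN// nsqN.
Qed.

(** The parallelogram law holds set by set. It shows that domains are stable under sums and that
    [sint] is a quadratic form. *)
Lemma integral_smeas_parallelogram u v (f : R -> \bar R) :
  (\int[measure_add (smeas (u + v)) (smeas (u - v))]_t f t =
   \int[measure_add (measure_add (smeas u) (smeas u))
                    (measure_add (smeas v) (smeas v))]_t f t)%E.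
Proof.
apply: eq_integral_on_measurable => B mB.
apply: etrans (measure_addE _ _ _) _; apply: etrans _ (esym (measure_addE _ _ _)).
apply: etrans _ (esym (congr2 (@adde R) (measure_addE _ _ _) (measure_addE _ _ _))).
rewrite !smeasE//.
rewrite -!EFinD spectralD// spectralB// nsqD nsqB; congr EFin; ring.
Qed.

Section one_function.
Variable f : R -> R.
Hypothesis mf : measurable_fun setT f.

Let mf2 : measurable_fun setT (fun t => (f t ^+ 2)%:E).
Proof. by apply/measurable_EFinP; exact: measurable_funX. Qed.

Let f2_ge0 A (t : R) : A t -> (0 <= (f t ^+ 2)%:E)%E.
Proof. by rewrite lee_fin sqr_ge0. Qed.

Lemma spectral_domDB u v : dm f u -> dm f v -> dm f (u + v) /\ dm f (u - v).
Proof.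
rewrite /spectral_dom /= !integral_smeasure => du dv.
have := integral_smeas_parallelogram u v (fun t => (f t ^+ 2)%:E).
rewrite !ge0_integral_measure_add//; do ?by move=> t _; exact: f2_ge0.
move=> e.
have lt : (\int[smeas (u + v)]_t (f t ^+ 2)%:E + \int[smeas (u - v)]_t (f t ^+ 2)%:E < +oo)%E.
  rewrite e; exact: (lte_add_pinfty (lte_add_pinfty du du) (lte_add_pinfty dv dv)).
split; apply: le_lt_trans lt.
  by rewrite leeDl// integral_ge0// => t _; exact: f2_ge0.
by rewrite leeDr// integral_ge0// => t _; exact: f2_ge0.
Qed.

Lemma spectral_dom_proj D u : measurable D -> dm f u -> dm f (E D u).
Proof.
rewrite /spectral_dom /= !integral_smeasure => mD.
rewrite integral_smeas_proj//; apply: le_lt_trans.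
by apply: ge0_subset_integral => //; move=> t _; exact: f2_ge0.
Qed.

Lemma spectral_domi u : dm f u -> dm f (iu u).
Proof.
rewrite /spectral_dom /= !integral_smeasure; apply: le_lt_trans.
rewrite (@eq_measure_integral _ _ _ _ (smeas u)) // => B mB _.
by rewrite !smeasE// spectralZ// nsqi.
Qed.

Lemma spectral_integrable u : dm f u -> (smeas u).-integrable setT (EFin \o f).
Proof.
rewrite /spectral_dom /= !integral_smeasure => du.
by apply: sqr_integrable => //; exact: smeas_finite.
Qed.

End one_function.

Definition sint (f : R -> R) u : R := fine (\int[smeasure dot E u]_t (f t)%:E)%E.

(** Real polarization of the quadratic form [sint f]; the four terms of [sintegral_dot] are two
    copies of it. *)
Definition sint2 f u v : R := (sint f (u + v) - sint f (u - v)) / 4.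

Lemma sintegral_dotE f u v :
  sintegral_dot dot E f u v = (sint2 f u v +i* sint2 f u (iu v))%C.
Proof.
rewrite /sintegral_dot !big_ord_recl big_ord0 /= !expr0 !expr1 /bump /=.
rewrite !addn0 -[(1 + 1)%N]/2%N -[(1 + 2)%N]/3%N !exprS expr0 mulr1 scale1r.
rewrite -expr2 sqr_i mulrN1 !scaleNr scale1r addr0 !mulNr !mul1r.
rewrite -/(sint f (u + v)) -/(sint f (u - v)) -/(sint f (u + iu v)) -/(sint f (u - iu v)).
rewrite (_ : 4%:R^-1 = (4^-1 : R)%:C%C); last by rewrite fmorphV rmorph_nat.
by apply/eqP; rewrite eq_complex /sint2 /=; apply/andP; split; apply/eqP; ring.
Qed.

Lemma spectral_integralP f x :
  spectral_integral dot E f x <->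
  dm f x.1 /\ forall v, dm f v -> rd x.2 v = sint2 f x.1 v.
Proof.
split=> -[dx h]; split=> // v dv.
  by have := h v dv; rewrite sintegral_dotE /rdot => ->.
by rewrite sintegral_dotE dot_rdot h// h//; exact: spectral_domi.
Qed.

Section linear_part.
Variable f : R -> R.
Hypothesis mf : measurable_fun setT f.

Let mfE : measurable_fun setT (EFin \o f).
Proof. exact/measurable_EFinP. Qed.

Lemma sint0 : sint f 0 = 0.
Proof. by rewrite /sint integral_smeasure integral_smeas0. Qed.

Lemma sint_parallelogram u v : dm f u -> dm f v ->
  sint f (u + v) + sint f (u - v) = 2 * sint f u + 2 * sint f v.
Proof.
move=> du dv; have [dD dB] := spectral_domDB mf du dv.
have iD := spectral_integrable mf dD; have iB := spectral_integrable mf dB.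
have iu := spectral_integrable mf du; have iv := spectral_integrable mf dv.
have := integral_smeas_parallelogram u v (EFin \o f).
have iadd (m : {measure set R -> \bar R}) : m.-integrable setT (EFin \o f) ->
    (measure_add m m).-integrable setT (EFin \o f).
  move=> /integrableP[_ im]; apply/integrableP; split=> //.
  by rewrite ge0_integral_measure_add//; [exact: lte_add_pinfty|exact: measurableT_comp].
rewrite !integral_measure_add//; [|exact: iadd|exact: iadd].
rewrite /sint !integral_smeasure.
have key (a b c d : \bar R) : a \is a fin_num -> b \is a fin_num ->
    c \is a fin_num -> d \is a fin_num -> (a + b = c + c + (d + d))%E ->
    fine a + fine b = 2 * fine c + 2 * fine d.
  by move: a b c d => [a||] [b||] [c||] [d||]//= _ _ _ _ [->]; ring.
by apply: key; exact: integrable_fin_num.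
Qed.

Lemma sint2_diag u : dm f u -> sint2 f u u = sint f u.
Proof.
move=> du; have := sint_parallelogram du du.
by rewrite /sint2 subrr sint0 => e; lra.
Qed.

Lemma sint_mix D u v : measurable D -> dm f u -> dm f v ->
  sint f (E D u + E (~` D) v) =
  fine (\int[smeas u]_(t in D) (f t)%:E)%E + fine (\int[smeas v]_(t in ~` D) (f t)%:E)%E.
Proof.
move=> mD du dv; have mC := measurableC mD.
rewrite /sint integral_smeasure integral_smeas_mix// fineD// integrable_fin_num//.
  exact: integrableS (spectral_integrable mf du).
exact: integrableS (spectral_integrable mf dv).
Qed.

Lemma spectral_split D u : measurable D -> u = E D u + E (~` D) u.
Proof.
move=> mD; rewrite -spectralU ?setUv ?spectralT//; first exact: measurableC.
by apply/disj_set2P; rewrite setICr.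
Qed.

(** Inside [D], both [E D u + v] and [u + E D v] look like [u + v]. Outside [D] only [v],
    respectively [u], contributes, and this cancels in the difference that defines [sint2]. *)
Lemma sint2_proj D u v : measurable D -> dm f u -> dm f v ->
  sint2 f (E D u) v = sint2 f u (E D v).
Proof.
move=> mD du dv; have mC := measurableC mD.
have [dD dB] := spectral_domDB mf du dv.
have dN w : dm f w -> dm f (- w).
  by move=> dw; rewrite -sub0r; apply: (spectral_domDB mf _ dw).2;
    rewrite -(subrr w); exact: (spectral_domDB mf dw dw).2.
have e1 : E D u + v = E D (u + v) + E (~` D) v.
  by rewrite {1}(spectral_split v mD) addrA -spectralD.
have e2 : E D u - v = E D (u - v) + E (~` D) (- v).
  by rewrite {1}(spectral_split v mD) spectralB// spectralN// opprD addrA.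
have e3 : u + E D v = E D (u + v) + E (~` D) u.
  by rewrite {1}(spectral_split u mD) addrAC -spectralD.
have e4 : u - E D v = E D (u - v) + E (~` D) u.
  by rewrite {1}(spectral_split u mD) addrAC -spectralB.
rewrite /sint2 e1 e2 e3 e4 !sint_mix//; last exact: dN.
by rewrite integral_smeasN; ring.
Qed.

Lemma spectral_integral_proj D x : measurable D ->
  spectral_integral dot E f x -> spectral_integral dot E f (E D x.1, E D x.2).
Proof.
move=> mD /spectral_integralP[dx h]; apply/spectral_integralP.
split=> [|v dv] /=; first exact: spectral_dom_proj.
by rewrite spectral_sym// h ?sint2_proj//; exact: spectral_dom_proj.
Qed.

Lemma spectral_integral_rdot x : spectral_integral dot E f x ->
  rd x.2 x.1 = sint f x.1.
Proof. by move=> /spectral_integralP[dx ->//]; rewrite sint2_diag. Qed.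

Lemma sint_ge D u b : measurable D -> dm f u -> (forall t, D t -> b <= f t) ->
  E D u = u -> b * nsq u <= sint f u.
Proof.
move=> mD du bf Eu; rewrite /sint -[in X in _ <= X]Eu integral_smeasure integral_smeas_proj//.
have iu := spectral_integrable mf du.
have iD : (smeas u).-integrable D (EFin \o f) by exact: integrableS iu.
rewrite -lee_fin fineK ?integrable_fin_num//.
have <- : (\int[smeas u]_(t in D) b%:E = (b * nsq u)%:E)%E.
  by rewrite integral_cst// EFinM -[in RHS]Eu smeasE.
apply: le_integral => //; first exact: smeas_integrable_cst.
by move=> t; rewrite inE lee_fin => /bf.
Qed.

Lemma sint_le D u b : measurable D -> dm f u -> (forall t, D t -> f t <= b) ->
  E D u = u -> sint f u <= b * nsq u.
Proof.
move=> mD du bf Eu; rewrite /sint -[in X in X <= _]Eu integral_smeasure integral_smeas_proj//.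
have iu := spectral_integrable mf du.
have iD : (smeas u).-integrable D (EFin \o f) by exact: integrableS iu.
rewrite -lee_fin fineK ?integrable_fin_num//.
have <- : (\int[smeas u]_(t in D) b%:E = (b * nsq u)%:E)%E.
  by rewrite integral_cst// EFinM -[in RHS]Eu smeasE.
apply: le_integral => //; first exact: smeas_integrable_cst.
by move=> t; rewrite inE lee_fin => /bf.
Qed.

End linear_part.

End one_measure.
End spectral_measures.

(** * Uniqueness of the spectral measure of a positive selfadjoint operator *)

Section spectral_uniqueness.
Context {R : realType} {H : lmodType R[i]}.
Variable dot : {dot H for conjC}.

Local Notation rd := (rdot dot).
Local Notation nsq := (nsq dot).
Local Notation hn := (hnorm dot).
Local Notation gt a := (`]a, +oo[%classic : set R).
Local Notation le a := (`]-oo, a]%classic : set R).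

(** The ray is the union of the rays from [a + n.+1%:R^-1], and scalar measures are countably
    subadditive. *)
Lemma spectral_gt_cont E (u : H) a : is_spectral_measure dot E ->
  (forall b, a < b -> E (gt b) u = 0) -> E (gt a) u = 0.
Proof.
move=> hE h; apply: (@nsq_eq0 R _ dot); apply/eqP; rewrite eq_le nsq_ge0 andbT.
rewrite -lee_fin -(smeasE hE)//.
have := @measure_sigma_subadditive _ _ _ (smeas hE u) (gt a)
  (fun n => gt (a + n.+1%:R^-1)).
move=> /(_ _ _ _)/le_trans; apply => //.
  move=> t /=; rewrite in_itv /= andbT => ta.
  have [n nt] := ltr_add_invr ta; exists n => //=.
  by rewrite in_itv /= andbT.
rewrite eseries0// => n _ _.
by rewrite smeasE// h ?nsq0// ltrDl invr_gt0.
Qed.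

Lemma itv_setC_le a : ~` le a = gt a.
Proof. by rewrite setCitvl. Qed.

(** The two bounds give [hn (y 0%N) <= (a / b) ^+ n * c], which tends to 0. *)
Lemma pow_contract (a b : R) (y : nat -> H) c : 0 <= a < b ->
  (forall n, b * hn (y n) <= hn (y n.+1)) ->
  (forall n, hn (y n) <= a ^+ n * c) -> y 0%N = 0.
Proof.
move=> /andP[a0 ab] low up; have b0 : 0 < b by exact: le_lt_trans ab.
have bn n : b ^+ n * hn (y 0%N) <= hn (y n).
  elim: n => [|n ih]; first by rewrite expr0 mul1r.
  by rewrite exprS -mulrA; apply: le_trans (low n); rewrite ler_pM2l.
have q1 : `|a / b| < 1.
  by rewrite ger0_norm ?divr_ge0 ?(ltW b0)// ltr_pdivrMr// mul1r.
have := cvg_expr q1 => /cvgrPdist_lt cv.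
apply: (@small_hnorm R _ dot) => e e0.
have c1 : 0 < 1 + `|c| by have := normr_ge0 c; lra.
have [N _ /(_ N (leqnn N))] := cv _ (divr_gt0 e0 c1).
rewrite /= sub0r normrN ger0_norm ?exprn_ge0 ?divr_ge0 ?(ltW b0)// => qe.
have : hn (y 0%N) <= (a / b) ^+ N * c.
  rewrite expr_div_n mulrAC ler_pdivlMr ?exprn_gt0// mulrC.
  exact: le_trans (bn N) (up N).
move/le_trans; apply; apply: (@le_trans _ _ ((a / b) ^+ N * (1 + `|c|))).
  apply: ler_wpM2l; first by rewrite exprn_ge0 ?divr_ge0 ?(ltW b0).
  by have := ler_norm c; lra.
by rewrite -ler_pdivlMr// ltW.
Qed.

Variable T : operator H.
Hypothesis sT : selfadjoint dot T.
Hypothesis pT : positive_op dot T.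

Let mid : measurable_fun setT (@id R).
Proof. exact: measurable_id. Qed.

Section one.
Variable E : set R -> H -> H.
Hypothesis hE : is_spectral_measure dot E.
Hypothesis TE : T = spectral_integral dot E id.

Let Tproj D x : measurable D -> T x -> T (E D x.1, E D x.2).
Proof. by rewrite TE; exact: spectral_integral_proj. Qed.

Let Trdot x : T x -> rd x.2 x.1 = sint dot E id x.1.
Proof. by rewrite TE; exact: spectral_integral_rdot. Qed.

Let Tdom x : T x -> spectral_dom dot E id x.1.
Proof. by rewrite TE => -[]. Qed.

Lemma spectral_dense_eq0 D u : measurable D ->
  (forall z, dom T z -> E D z = 0) -> E D u = 0.
Proof.
move=> mD h; have [_ dT _] := sT; apply: (dense_rdot_inj dT) => z /h z0.
by rewrite (spectral_sym hE)// z0 rdot0l rdot0r.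
Qed.

(** On the range of [E (le c)] the form of [T] is at most [c * nsq], and yet it is nonnegative. *)
Lemma spectral_neg c u : c < 0 -> E (le c) u = 0.
Proof.
move=> c0; apply: spectral_dense_eq0 => // z [z' Tz].
have := Tproj (measurable_itv _ : measurable (le c)) Tz => /= Tz'.
have := positive_rdot pT Tz'; rewrite (Trdot Tz') /= => ge0.
have h : sint dot E id (E (le c) z) <= c * nsq (E (le c) z).
  apply: (@sint_le _ _ _ _ hE id mid (le c)) => //.
  - exact: (Tdom Tz').
  - exact: (spectralK hE).
apply: (@nsq_eq0 R _ dot); apply/eqP; rewrite eq_le nsq_ge0 andbT.
by rewrite -(ler_nM2l c0) mulr0; exact: le_trans ge0 h.
Qed.

Lemma spectral_gt_lower x b : 0 <= b -> T x -> E (gt b) x.1 = x.1 ->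
  b * hn x.1 <= hn x.2.
Proof.
move=> b0 Tx Ex.
have := sint_ge hE mid (measurable_itv _ : measurable (gt b)) (Tdom Tx) _ Ex.
move=> /(_ b) h; have {}h : b * nsq x.1 <= rd x.2 x.1.
  by rewrite Trdot//; apply: h => t /=; rewrite in_itv /= andbT => /ltW.
exact: hnorm_ge_rdot.
Qed.

(** Iterating [T] within [S] shrinks norms by the factor [a], while the components in the range of
    [E (gt b)] grow by the factor [b]; [pow_contract] applies to these components. *)
Lemma spectral_low_orth a b (S : set H) x : 0 <= a < b ->
  (forall u, S u -> exists u', [/\ S u', T (u, u') & hn u' <= a * hn u]) ->
  S x -> E (gt b) x = 0.
Proof.
move=> ab hS Sx; have /andP[a0 _] := ab.
have [f fP] : exists f : H -> H, forall u, S u -> [/\ S (f u), T (u, f u) & hn (f u) <= a * hn u].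
  have /choice[f fP] : forall u, exists u', S u -> [/\ S u', T (u, u') & hn u' <= a * hn u].
    by move=> u; have [/hS[u' h]|nS] := pselect (S u); [exists u'|exists 0].
  by exists f.
pose y n := iter n f x.
have Sy n : S (y n) by elim: n => // n ih; have [] := fP _ ih.
have mb : measurable (gt b) by [].
apply: (@pow_contract a b (fun n => E (gt b) (y n)) (hn x) ab).
  move=> n; have [_ Ty _] := fP _ (Sy n).
  apply: (spectral_gt_lower _ (Tproj mb Ty)) => /=; last exact: (spectralK hE).
  by case/andP: ab => a0' /ltW; exact: le_trans.
move=> n; apply: (@le_trans _ _ (hn (y n))).
  by apply/hnorm_le/spectral_nsq_le.
elim: n => [|n ih]; first by rewrite expr0 mul1r.
have [_ _ /le_trans] := fP _ (Sy n); apply; rewrite exprS -mulrA.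
exact: ler_wpM2l.
Qed.

End one.

Variables E F : set R -> H -> H.
Hypothesis hE : is_spectral_measure dot E.
Hypothesis hF : is_spectral_measure dot F.
Hypothesis TE : T = spectral_integral dot E id.
Hypothesis TF : T = spectral_integral dot F id.
(** The asymmetry between the two measures: [F] is the explicit one, whose bounded spectral
    subspaces are seen directly to lie in the domain of [T] and to be invariant. *)
Hypothesis F_low : forall a u, 0 <= a -> F (le a) u = u ->
  exists u', [/\ F (le a) u' = u', T (u, u') & hn u' <= a * hn u].

Let mle a : measurable (le a). Proof. by []. Qed.
Let mgt a : measurable (gt a). Proof. by []. Qed.

(** For every [b > a] the component in the range of [E (gt b)] vanishes by comparison of growth;
    then [b] tends to [a]. *)
Lemma spectral_low a u : 0 <= a -> E (le a) (F (le a) u) = F (le a) u.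
Proof.
move=> a0; rewrite [RHS](spectral_split hE _ (mle a)) itv_setC_le.
rewrite [X in _ + X](_ : _ = 0) ?addr0//.
apply: spectral_gt_cont => // b ab.
apply: (@spectral_low_orth E hE TE a b [set u | F (le a) u = u]); rewrite ?a0//.
  by move=> v; exact: F_low.
by rewrite /= (spectralK hF).
Qed.

Lemma spectral_low_sym a u : 0 <= a -> F (le a) (E (le a) u) = F (le a) u.
Proof.
move=> a0; apply: (@rdot_inj R _ dot) => z.
by rewrite !(spectral_sym hF)// (spectral_sym hE)// spectral_low.
Qed.

(** A vector [z] in the ranges of both [E (le a)] and [F (gt a)] is 0: by [E] its form is at most
    [a * nsq z], and by [F] it is larger as soon as [F (gt b) z] is nonzero for some [b > a]. *)
Lemma spectral_high a u : 0 <= a -> E (le a) (F (gt a) u) = 0.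
Proof.
move=> a0; have [_ dT _] := sT; apply: (dense_rdot_inj dT) => x [x' Tx].
rewrite rdot0l (spectral_sym hE)// (spectral_sym hF)//.
set z := F (gt a) (E (le a) x); suff -> : z = 0 by rewrite rdot0r.
have FEgt w : F (gt a) (E (le a) w) = E (le a) (F (gt a) w).
  have eF v : F (gt a) v = v - F (le a) v.
    by rewrite [in X in X - _](spectral_split hF v (mle a)) itv_setC_le addrC addKr.
  by rewrite !eF (spectralB hE)// spectral_low// spectral_low_sym.
have zF : F (gt a) z = z by rewrite /z (spectralK hF).
have zE : E (le a) z = z by rewrite /z FEgt (spectralK hE).
have Tz : T (z, F (gt a) (E (le a) x')).
  have /= := spectral_integral_proj hE mid (mle a) (_ : spectral_integral dot E id (x, x')).
  rewrite -TE => /(_ Tx); rewrite TF => T1.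
  exact: (spectral_integral_proj hF mid (mgt a) T1).
have dE : spectral_dom dot E id z by move: Tz; rewrite TE => -[].
have dF : spectral_dom dot F id z by move: Tz; rewrite TF => -[].
have sEF : sint dot E id z = sint dot F id z.
  have TEz := Tz; have TFz := Tz; rewrite TE in TEz; rewrite TF in TFz.
  by rewrite -(spectral_integral_rdot hE mid TEz) -(spectral_integral_rdot hF mid TFz).
rewrite -zF; apply: spectral_gt_cont => // b ab.
have upper : sint dot E id z <= a * nsq z.
  by apply: (sint_le hE mid (mle a)) => // t /=; rewrite in_itv.
set v := F (gt b) z.
have zb : z = v + F (~` gt b) z by exact: (spectral_split hF).
have mCb : measurable (~` gt b) by exact: measurableC.
have dv : spectral_dom dot F id v by exact: spectral_dom_proj.
have dw : spectral_dom dot F id (F (~` gt b) z) by exact: spectral_dom_proj.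
have vw : rd v (F (~` gt b) z) = 0.
  by apply: (spectral_orth hF) => //; apply/disj_set2P; rewrite setICr.
have szE : sint dot F id z = sint dot F id v + sint dot F id (F (~` gt b) z).
  have := sint_mix hF mid (mgt b) dF dF; rewrite -(spectral_split hF)// => ->.
  by rewrite /sint !(integral_smeasure hF) !(integral_smeas_proj hF)//;
    exact/measurable_EFinP.
have lv : b * nsq v <= sint dot F id v.
  apply: (sint_ge hF mid (mgt b)) => //; last exact: (spectralK hF).
  by move=> t /=; rewrite in_itv /= andbT => /ltW.
have lw : a * nsq (F (~` gt b) z) <= sint dot F id (F (~` gt b) z).
  apply: (sint_ge hF mid (mgt a)) => //.
    by move=> t /=; rewrite in_itv /= andbT => /ltW.
  by rewrite (spectralI hF)// setIC -(spectralI hF)// zF.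
have nz : nsq z = nsq v + nsq (F (~` gt b) z) by rewrite zb nsqD vw -zb; ring.
apply: (@nsq_eq0 R _ dot); apply/eqP; rewrite eq_le nsq_ge0 andbT.
have ba : 0 < b - a by rewrite subr_gt0.
by rewrite -(pmulr_rle0 _ ba); move: upper; rewrite sEF szE nz; lra.
Qed.

Lemma spectral_le_eq a u : E (le a) u = F (le a) u.
Proof.
have [a0|a0] := lerP 0 a; last first.
  by rewrite (spectral_neg hE TE)// (spectral_neg hF TF).
rewrite {1}(spectral_split hF u (mle a)) itv_setC_le (spectralD hE)//.
by rewrite spectral_low// spectral_high// addr0.
Qed.

Lemma spectral_unique D u : measurable D -> smeasure dot E u D = smeasure dot F u D.
Proof.
move=> mD; rewrite (smeasureE hE)// (smeasureE hF)// -(smeasE hE)// -(smeasE hF)//.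
apply: (@measure_unique _ _ _ (@RGenOInfty.G R) (fun k => `]- k%:R, +oo[%classic)) => //.
- exact: RGenOInfty.measurableE.
- move=> _ _ [x ->] [y ->]; exists (Num.max x y).
  by apply/seteqP; split=> t /=; rewrite !in_itv /= !andbT gt_max;
    [move=> [-> ->]|move/andP].
- by move=> k; exists (- k%:R).
- apply/seteqP; split=> // t _; exists (truncn `|t|).+1 => //=.
  rewrite in_itv /= andbT ltrNl; apply: le_lt_trans (ler_norm _) _.
  by rewrite normrN truncnS_gt.
- move=> _ [a ->]; rewrite !smeasE//.
  have e G (hG : is_spectral_measure dot G) : G (gt a) u = u - G (le a) u.
    by rewrite [in X in X - _](spectral_split hG u (mle a)) itv_setC_le addrC addKr.
  by rewrite (e _ hE) (e _ hF) spectral_le_eq.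
- by move=> k; rewrite smeasE// ltry.
Qed.

Lemma spectral_integral_unique f :
  spectral_integral dot E f = spectral_integral dot F f.
Proof.
have e u (g : R -> \bar R) : (\int[smeasure dot E u]_t g t = \int[smeasure dot F u]_t g t)%E.
  by apply: eq_integral_on_measurable => D mD; exact: spectral_unique.
have ed : spectral_dom dot E f = spectral_dom dot F f.
  by apply/seteqP; split=> u; rewrite /spectral_dom /= e.
have es u v : sintegral_dot dot E f u v = sintegral_dot dot F f u v.
  by rewrite /sintegral_dot; congr (_ * _); apply: eq_bigr => k _; rewrite e.
by rewrite /spectral_integral ed; apply/seteqP; split=> x [dx h]; split=> // v /h;
  rewrite es.
Qed.

End spectral_uniqueness.

(** * Measures given by a density and their images under a map *)

Section densities.
Local Open Scope ereal_scope.
Context d (T : measurableType d) (R : realType).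
Variable mu : {measure set T -> \bar R}.

Lemma density_measure (r : T -> \bar R) : measurable_fun setT r -> (forall x, 0 <= r x) ->
  {m : {measure set T -> \bar R} | forall D, m D = \int[mu]_(x in D) r x}.
Proof.
move=> mr r0; pose m D := \int[mu]_(x in D) r x.
have m0 : m set0 = 0 by exact: integral_set0.
have mge D : 0 <= m D by exact: integral_ge0.
have ms : semi_sigma_additive m.
  move=> F mF tF mU; rewrite /m ge0_integral_bigcup//; last exact: measurable_funTS.
  by apply: is_cvg_nneseries_cond => n _ _; exact: integral_ge0.
pose M : {measure set T -> \bar R} := HB.pack m (isMeasure.Build _ _ _ m m0 mge ms).
by exists M.
Qed.

(** Monotone convergence along simple approximations of [f] reduces this to indicators, for which it
    is the assumption on [m]. *)
Lemma integral_density (r : T -> R) (m : {measure set T -> \bar R}) (f : T -> \bar R) :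
  measurable_fun setT r -> (forall x, (0 <= r x)%R) ->
  (forall D, measurable D -> m D = \int[mu]_(x in D) (r x)%:E) ->
  measurable_fun setT f -> (forall x, 0 <= f x) ->
  \int[m]_x f x = \int[mu]_x (f x * (r x)%:E).
Proof.
move=> mr r0 mE mf f0; have mrE : measurable_fun setT (EFin \o r) by exact/measurable_EFinP.
pose h := nnsfun_approx measurableT mf.
have -> : \int[m]_x f x = lim (\int[m]_x (EFin \o h n) x @[n --> \oo]).
  have fE x : setT x -> f x = lim ((EFin \o h n) x @[n --> \oo]).
    by move=> Ex; apply/esym/cvg_lim => //; exact: cvg_nnsfun_approx.
  under eq_integral => x /[!inE] /fE -> //.
  apply: monotone_convergence => //.
  - by move=> n; apply/measurable_EFinP; exact/measurable_funP.
  - by move=> n x Ex //=; rewrite lee_fin.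
  - by move=> x Ex a b ab; rewrite lee_fin; exact/lefP/nd_nnsfun_approx.
have -> : \int[mu]_x (f \* (EFin \o r)) x =
    lim (\int[mu]_x ((EFin \o h n) \* (EFin \o r)) x @[n --> \oo]).
  have fg x : setT x -> f x * (r x)%:E = lim (((EFin \o h n) \* (EFin \o r)) x @[n --> \oo]).
    by move=> Ex; apply/esym/cvg_lim => //; apply: cvgeZr => //; exact: cvg_nnsfun_approx.
  under eq_integral => x /[!inE] /fg -> //.
  apply: monotone_convergence => //.
  - by move=> n; apply/emeasurable_funM => //; exact/measurable_EFinP.
  - by move=> n x Ex /=; rewrite mule_ge0 ?lee_fin.
  - by move=> x Ex a b ab/=; rewrite lee_wpmul2r ?lee_fin//; exact/lefP/nd_nnsfun_approx.
suff suf n : \int[mu]_x ((EFin \o h n) x * (r x)%:E) = \int[m]_x (EFin \o h n) x.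
  by under [in RHS]eq_fun do rewrite suf.
transitivity (\int[m]_x
   (\sum_(y \in range (h n)) (y * \1_(h n @^-1` [set y]) x)%:E)); last first.
  by apply: eq_integral => t tE; rewrite /= fimfunE -fsumEFin.
have indich k q : measurable_fun setT (fun x => (q * \1_(h k @^-1` [set q]) x)%:E).
  by apply: (measurable_comp measurableT) => //; exact: measurable_funM.
rewrite ge0_integral_fsum//; last by move=> k y Ey; exact: nnfun_muleindic_ge0.
transitivity (\int[mu]_x (\sum_(y \in range (h n))
    (y * \1_(h n @^-1` [set y]) x)%:E * (r x)%:E)).
  under [RHS]eq_integral => x xE.
    rewrite -ge0_mule_fsuml => [|y]; last exact: nnfun_muleindic_ge0.
    rewrite fsumEFin // -(fimfunE _ x); over.
  by [].
rewrite ge0_integral_fsum//; last 2 first.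
  - by move=> y; apply: emeasurable_funM.
  - by move=> k y Ey; apply: mule_ge0; [rewrite EFinM; exact: nnfun_muleindic_ge0|rewrite lee_fin].
apply: eq_fsbigr => q rhn.
have q0 : (0 <= q)%R by move: rhn; rewrite inE => -[t _ <-].
under [RHS]eq_integral do rewrite EFinM.
rewrite ge0_integralZl//; last by apply/measurable_EFinP; exact: measurable_indic.
under eq_integral do rewrite EFinM -muleA.
rewrite ge0_integralZl//.
- rewrite integral_indic// setIT mE//; congr (_ * _).
  rewrite [RHS]integral_mkcond; apply: eq_integral => x _.
  by rewrite patchE indicE; case: ifPn => _; rewrite ?mul1e ?mul0e.
- by apply: emeasurable_funM => //; apply/measurable_EFinP; exact: measurable_indic.
- by move=> t Et; rewrite mule_ge0 ?lee_fin.
Qed.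

End densities.

Section image_densities.
Local Open Scope ereal_scope.
Context d d' (T : measurableType d) (T' : measurableType d') (R : realType).
Variables (mu : {measure set T -> \bar R}) (phi : T -> T') (r : T -> R).
Hypothesis mphi : measurable_fun setT phi.
Hypothesis mr : measurable_fun setT r.
Hypothesis r0 : forall x, (0 <= r x)%R.

Let mpre D : measurable D -> measurable (phi @^-1` D).
Proof. by move=> mD; rewrite -[X in measurable X]setTI; exact: mphi. Qed.

Lemma image_density_measure : {m : {measure set T' -> \bar R} | forall D, measurable D ->
  m D = \int[mu]_(x in phi @^-1` D) (r x)%:E}.
Proof.
have mrE : measurable_fun setT (EFin \o r) by exact/measurable_EFinP.
pose m D := \int[mu]_(x in phi @^-1` D) (r x)%:E.
have m0 : m set0 = 0 by rewrite /m preimage_set0 integral_set0.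
have mge D : 0 <= m D by apply: integral_ge0 => x _; rewrite lee_fin.
have ms : semi_sigma_additive m.
  move=> F mF tF mU; rewrite /m preimage_bigcup ge0_integral_bigcup//.
  - by apply: is_cvg_nneseries_cond => n _ _; apply: integral_ge0 => x _; rewrite lee_fin.
  - by move=> k; exact: mpre.
  - exact: measurable_funTS.
  - by move=> x _; rewrite lee_fin.
  - apply/trivIsetP => i j _ _ ij; rewrite -preimage_setI.
    by move/trivIsetP : tF => /(_ _ _ I I ij) ->; rewrite preimage_set0.
pose M : {measure set T' -> \bar R} := HB.pack m (isMeasure.Build _ _ _ m m0 mge ms).
by exists M.
Qed.

Lemma integral_image_density (m : {measure set T' -> \bar R}) (f : T' -> \bar R) :
  (forall D, measurable D -> m D = \int[mu]_(x in phi @^-1` D) (r x)%:E) ->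
  measurable_fun setT f -> (forall x, 0 <= f x) ->
  \int[m]_y f y = \int[mu]_x (f (phi x) * (r x)%:E).
Proof.
move=> mE mf f0; have mrE : measurable_fun setT (EFin \o r) by exact/measurable_EFinP.
have rE0 x : 0 <= (r x)%:E by rewrite lee_fin.
have [nu nuE] := density_measure mu mrE rE0.
rewrite (@eq_integral_on_measurable _ _ _ m (pushforward nu phi)); last first.
  by move=> D mD; rewrite mE// /pushforward nuE.
rewrite (ge0_integral_pushforward mphi)//.
rewrite preimage_setT (@integral_density _ _ _ mu r nu)//.
- exact: measurableT_comp.
- by move=> x /=; exact: f0.
Qed.

End image_densities.

(** * Square-integrable functions: truncation and completeness *)

(** Adding and subtracting the remainder [2 * K / 2 ^+ n] of the geometric series gives the ends of
    nested intervals; the limit is the supremum of the left ends. *)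
Lemma geometric_cauchy (R : realType) (c : nat -> R) (K : R) :
  (forall n, `|c n.+1 - c n| <= K / 2 ^+ n) ->
  exists l, c @ \oo --> l /\ forall n, `|l - c n| <= 2 * K / 2 ^+ n.
Proof.
move=> hc.
pose d n := c n - 2 * K / 2 ^+ n; pose e n := c n + 2 * K / 2 ^+ n.
have half n : 2 * K / 2 ^+ n.+1 = K / 2 ^+ n.
  by rewrite exprS invfM; field; rewrite expf_neq0.
have dS n : d n <= d n.+1.
  by rewrite /d half; have := hc n; rewrite ler_norml; lra.
have eS n : e n.+1 <= e n.
  by rewrite /e half; have := hc n; rewrite ler_norml; lra.
have K0 : 0 <= K by have := le_trans (normr_ge0 _) (hc 0%N); rewrite expr0 divr1.
have de n m : d n <= e m.
  have dmono a b : (a <= b)%N -> d a <= d b by exact: (homo_leq (@lexx _ _) le_trans).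
  have emono a b : (a <= b)%N -> e b <= e a.
    by move/(@homo_leq _ e (fun x y => y <= x)); apply => // x y z xy yz; exact: le_trans yz xy.
  have dm k : d k <= e k.
    by rewrite /d /e; have : 0 <= K / 2 ^+ k by [rewrite divr_ge0 ?exprn_ge0]; lra.
  apply: le_trans (dmono _ _ (leq_maxl n m)) _.
  exact: le_trans (dm _) (emono _ _ (leq_maxr n m)).
have supd : has_sup (range d).
  by split; [exists (d 0%N); exists 0%N|exists (e 0%N) => _ [n _ <-]].
pose l := sup (range d).
have hl n : `|l - c n| <= 2 * K / 2 ^+ n.
  have dl : d n <= l by apply: sup_upper_bound => //; exists n.
  have le : l <= e n by apply: ge_sup => [|_ [k _ <-]//]; exact: supd.1.
  by rewrite ler_norml; move: dl le; rewrite /d /e; lra.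
exists l; split=> //; apply/cvgrPdist_le => x x0.
have q1 : `|2^-1 : R| < 1 by rewrite ger0_norm ?invr_ge0// invf_lt1// ltr1n.
have := cvg_expr q1 => /cvgrPdist_lt /(_ (x / (2 * K + 1))) [|N _ hN].
  by rewrite divr_gt0//; lra.
exists N => // n /hN /=; rewrite sub0r normrN ger0_norm ?exprn_ge0 ?invr_ge0// => hx.
apply: le_trans (hl n) _; rewrite -exprVn.
have : 0 <= (2^-1 : R) ^+ n by rewrite exprn_ge0 ?invr_ge0.
move: hx; rewrite ltr_pdivlMr; last by lra.
nra.
Qed.

Section L2_space.
Context {d : measure_display} {X : measurableType d} {R : realType}.
Variable mu : {measure set X -> \bar R}.
Implicit Types (f g : X -> R[i]) (u v : L2 mu) (k : X -> R) (D : set X).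

Local Notation dot := (L2dot mu).
Local Notation rd := (@rdot R _ (L2dot mu)).
Local Notation nsq := (@nsq R _ (L2dot mu)).
Local Notation hn := (@hnorm R _ (L2dot mu)).

Definition isL2 f := cmeasurable f /\ (\int[mu]_x (sqnorm (f x))%:E < +oo)%E.

(** The class of 0 is the default for an [f] that is not square integrable. *)
Definition L2of f : L2 mu := (\pi_(L2 mu) (insubd (0 : L2fun mu) f))%qT.

Lemma L2ofE f : isL2 f -> {ae mu, forall x, L2fn (L2of f) x = f x}.
Proof.
move=> hf; apply: filterS (L2fn_pi (insubd (0 : L2fun mu) f)) => x e.
apply: etrans e _; have fP : f \in L2pred mu by rewrite inE.
exact: (congr1 (fun g : X -> R[i] => g x) (insubdK (0 : L2fun mu) fP)).
Qed.

Lemma isL2_dominated f g (C : R) : cmeasurable f -> isL2 g ->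
  {ae mu, forall x, sqnorm (f x) <= C * sqnorm (g x)} -> isL2 f.
Proof.
move=> mf [mg ig] fg; split=> //.
(* The sign of [C] is unknown, and the integral should be linear in a nonnegative constant. *)
apply: (@le_lt_trans _ _ (\int[mu]_x (`|C|%:E * (sqnorm (g x))%:E))%E).
  apply: ae_ge0_le_integral => //.
  - by move=> x _; rewrite lee_fin sqnorm_ge0.
  - exact: measurable_sqnorm.
  - by move=> x _; rewrite -EFinM lee_fin mulr_ge0// sqnorm_ge0.
  - by apply: measurable_funeM; exact: measurable_sqnorm.
  - apply: filterS fg => x fg _; rewrite -EFinM lee_fin; apply: le_trans fg _.
    by rewrite ler_wpM2r ?sqnorm_ge0// ler_norm.
rewrite ge0_integralZl//; last 2 first.
- exact: measurable_sqnorm.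
- by move=> x _; rewrite lee_fin sqnorm_ge0.
by rewrite lte_mul_pinfty.
Qed.

Lemma isL2_ae f g : cmeasurable f -> isL2 g -> {ae mu, forall x, f x = g x} -> isL2 f.
Proof.
move=> mf hg fg; apply: (@isL2_dominated _ g 1) => //.
by apply: filterS fg => x ->; rewrite mul1r.
Qed.

Lemma isL2_L2fn u : isL2 (L2fn u). Proof. exact: L2fnP. Qed.

Lemma cmeasurable_L2fn u : cmeasurable (L2fn u).
Proof. by have [] := L2fnP u. Qed.

Lemma nsq_int u : (nsq u)%:E = (\int[mu]_x (sqnorm (L2fn u x))%:E)%E.
Proof.
have [mq iq] := L2fnP u.
rewrite -[RHS]fineK; last first.
  by rewrite ge0_fin_numE// integral_ge0// => x _; rewrite lee_fin sqnorm_ge0.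
congr EFin; apply: eq_Rintegral => x _; rewrite sqnormE.
by case: (L2fn u x) => a b /=; rewrite mulrN opprK -!expr2.
Qed.

Lemma nsq_le_ae u v (C : R) : 0 <= C ->
  {ae mu, forall x, sqnorm (L2fn u x) <= C * sqnorm (L2fn v x)} -> nsq u <= C * nsq v.
Proof.
move=> C0 uv; rewrite -lee_fin EFinM !nsq_int.
have m2 w : measurable_fun setT (fun x => (sqnorm (L2fn w x))%:E).
  by apply: measurable_sqnorm; have [] := L2fnP w.
have p2 (w : L2 mu) (x : X) : (0 <= (sqnorm (L2fn w x))%:E)%E by rewrite lee_fin sqnorm_ge0.
have <- : (\int[mu]_x (C%:E * (sqnorm (L2fn v x))%:E) =
    C%:E * \int[mu]_x (sqnorm (L2fn v x))%:E)%E by apply: ge0_integralZl => //.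
apply: ae_ge0_le_integral => //.
- by move=> x _; rewrite mule_ge0.
- exact: measurable_funeM.
- by apply: filterS uv => x h _; rewrite -EFinM lee_fin.
Qed.

Lemma eq_sqnorm_int f g : cmeasurable f -> cmeasurable g ->
  {ae mu, forall x, f x = g x} ->
  (\int[mu]_x (sqnorm (f x))%:E = \int[mu]_x (sqnorm (g x))%:E)%E.
Proof.
move=> mf mg fg; apply: ae_eq_integral => //; [exact: measurable_sqnorm..|].
by apply: filterS fg => x ->.
Qed.

Lemma nsq_ae u f : cmeasurable f -> {ae mu, forall x, L2fn u x = f x} ->
  (nsq u)%:E = (\int[mu]_x (sqnorm (f x))%:E)%E.
Proof.
by move=> mf uf; rewrite nsq_int; apply: eq_sqnorm_int => //; exact: cmeasurable_L2fn.
Qed.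

Lemma dot_ae u v u' v' :
  {ae mu, forall x, L2fn u x * (L2fn v x)^*%C = L2fn u' x * (L2fn v' x)^*%C} ->
  dot u v = dot u' v'.
Proof. by apply: ae_eq_cintegral; exact: cmeasurable_dot. Qed.

Lemma rdot_ae u v u' v' :
  {ae mu, forall x, L2fn u x * (L2fn v x)^*%C = L2fn u' x * (L2fn v' x)^*%C} ->
  rd u v = rd u' v'.
Proof. by move=> /dot_ae e; exact: (congr1 (@complex.Re R) e). Qed.

Lemma cmeasurable_mulr k f : measurable_fun setT k -> cmeasurable f ->
  cmeasurable (fun x => (k x)%:C%C * f x).
Proof.
move=> mk; apply: (@cmeasurableM _ _ _ (fun x => (k x)%:C%C)).
by split => //=; exact: measurable_cst.
Qed.

Lemma sqnorm_mulr (a : R) (z : R[i]) : sqnorm (a%:C%C * z) = a ^+ 2 * sqnorm z.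
Proof. by rewrite !sqnormE; case: z => x y /=; ring. Qed.

Definition mul_dom k u := isL2 (fun x => (k x)%:C%C * L2fn u x).

(* [mulf] and [ind] are sealed, because comparing elements of [L2 mu] by unfolding them to
   representatives is hopeless. *)
Lemma mulf_exists k u : {v : L2 mu |
  mul_dom k u -> {ae mu, forall x, L2fn v x = (k x)%:C%C * L2fn u x}}.
Proof. by exists (L2of (fun x => (k x)%:C%C * L2fn u x)); exact: L2ofE. Qed.

Definition mulf k u : L2 mu := sval (mulf_exists k u).

Lemma mulfE k u : mul_dom k u ->
  {ae mu, forall x, L2fn (mulf k u) x = (k x)%:C%C * L2fn u x}.
Proof. exact: (svalP (mulf_exists k u)). Qed.

Lemma mul_dom_bounded k u (C : R) : measurable_fun setT k ->
  (forall x, `|k x| <= C) -> mul_dom k u.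
Proof.
move=> mk kC; apply: (@isL2_dominated _ (L2fn u) (C ^+ 2)).
- by apply: cmeasurable_mulr => //; exact: cmeasurable_L2fn.
- exact: isL2_L2fn.
- apply: aeW => x; rewrite sqnorm_mulr ler_wpM2r ?sqnorm_ge0//.
  have C0 : 0 <= C by exact: le_trans (normr_ge0 _) (kC x).
  by rewrite -(real_normK (num_real (k x))) ler_sqr ?nnegrE.
Qed.

Lemma mul_dom_indic D u : measurable D -> mul_dom (\1_D) u.
Proof.
move=> mD; apply: (@mul_dom_bounded _ _ 1).
  exact: measurable_indic.
by move=> x; rewrite indicE; case: (_ \in _); rewrite ?normr1 ?normr0.
Qed.

Lemma ind_exists D u : {v : L2 mu | measurable D -> mulf (\1_D) u = v}.
Proof. by exists (mulf (\1_D) u). Qed.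

Definition ind D u : L2 mu := sval (ind_exists D u).

Lemma mulf_indic D u : measurable D -> mulf (\1_D) u = ind D u.
Proof. exact: (svalP (ind_exists D u)). Qed.

Lemma indE D u : measurable D ->
  {ae mu, forall x, L2fn (ind D u) x = (\1_D x : R)%:C%C * L2fn u x}.
Proof. by move=> mD; rewrite -mulf_indic//; apply: mulfE; exact: mul_dom_indic. Qed.

Lemma L2fnB u v : {ae mu, forall x, L2fn (u - v) x = L2fn u x - L2fn v x}.
Proof.
rewrite -scaleN1r; apply: filterS2 (L2fnD u (-1 *: v)) (L2fnZ (-1) v) => x -> ->.
by rewrite mulN1r.
Qed.

Lemma ae_mulf_dom k u v : measurable_fun setT k ->
  {ae mu, forall x, L2fn v x = (k x)%:C%C * L2fn u x} -> mul_dom k u /\ mulf k u = v.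
Proof.
move=> mk vk; have du : mul_dom k u.
  apply: (@isL2_ae _ (L2fn v)); [|exact: isL2_L2fn|by apply: filterS vk => x ->].
  by apply: cmeasurable_mulr => //; exact: cmeasurable_L2fn.
by split=> //; apply: L2_eqP; apply: filterS2 (mulfE du) vk => x -> ->.
Qed.

(** The squared distance is the mass of the complement of [A n] under the finite measure with
    density the squared modulus of [v]; continuity from above applies. *)
Lemma ind_cvg (A : nat -> set X) v e : (forall n, measurable (A n)) ->
  (forall m n, (m <= n)%N -> A m `<=` A n) -> (forall x, exists n, A n x) ->
  0 < e -> exists N, forall n, (N <= n)%N -> hn (v - ind (A n) v) < e.
Proof.
move=> mA ndA covA e0.
have r0 x : (0 <= (sqnorm (L2fn v x))%:E)%E by rewrite lee_fin sqnorm_ge0.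
have mr := measurable_sqnorm (cmeasurable_L2fn v).
have [m mE] := density_measure mu mr r0.
have mf : (m setT < +oo)%E by rewrite mE; have [] := L2fnP v.
have mfn n : (m (~` A n) < +oo)%E.
  by apply: le_lt_trans mf; rewrite le_measure ?inE//; exact: measurableC.
have mcv : m (~` A n) @[n --> \oo] --> m (\bigcap_n ~` A n).
  apply: nonincreasing_cvg_mu => //.
  - by move=> n; exact: measurableC.
  - by apply: bigcap_measurable => // n _; exact: measurableC.
  - by move=> i j ij; apply/subsetPset/subsetC/ndA.
have ndis n : (nsq (v - ind (A n) v))%:E = m (~` A n).
  rewrite mE (@nsq_ae _ (fun x => (\1_(~` A n) x : R)%:C%C * L2fn v x)).
  - rewrite [RHS]integral_mkcond; apply: eq_integral => x _.
    rewrite patchE sqnorm_mulr indicE; case: (x \in _) => /=.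
      by rewrite expr1n mul1r.
    by rewrite expr0n mul0r.
  - apply: cmeasurable_mulr (cmeasurable_L2fn v).
    by apply: measurable_indic; exact: measurableC.
  - apply: filterS2 (L2fnB v (ind (A n) v)) (indE v (mA n)) => x -> ->.
    rewrite !indicE in_setC; case: (x \in _) => /=; first by rewrite mul1r mul0r subrr.
    by rewrite mul1r mul0r subr0.
move: mcv; rewrite (_ : \bigcap_n _ = set0); last first.
  by rewrite -subset0 => x h; have [n An] := covA x; exact: (h n).
rewrite measure0 => /fine_cvgP[_ /cvgrPdist_lt/(_ (e ^+ 2))[|N _ hN]].
  by rewrite exprn_gt0.
exists N => n /hN /=; rewrite -ndis /= sub0r normrN ger0_norm ?nsq_ge0//.
by rewrite -hnorm_sqr ltr_sqr ?nnegrE ?hnorm_ge0// ltW.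
Qed.

End L2_space.

Section L2_complete.
Context {d : measure_display} {X : measurableType d} {R : realType}.
Variable mu : {measure set X -> \bar R}.
Implicit Types (u v : L2 mu).

Local Notation rd := (@rdot R _ (L2dot mu)).
Local Notation nsq := (@nsq R _ (L2dot mu)).
Local Notation hn := (@hnorm R _ (L2dot mu)).

Lemma normr_Re_le (z : R[i]) (C : R) : 0 <= C -> sqnorm z <= C ^+ 2 ->
  `|complex.Re z| <= C /\ `|complex.Im z| <= C.
Proof.
move=> C0; rewrite sqnormE => h; split; rewrite -ler_sqr ?nnegrE//.
  by rewrite real_normK ?num_real//; have := sqr_ge0 (complex.Im z); lra.
by rewrite real_normK ?num_real//; have := sqr_ge0 (complex.Re z); lra.
Qed.

(* Off the null set where [\sum_n 4^n |u_(n+1) - u_n|^2] diverges, the sequence converges at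
   speed 2^-n, with a square integrable constant. *)
Lemma L2_complete (u : nat -> L2 mu) :
  (forall n, nsq (u n.+1 - u n) <= 1 / 16 ^+ n) ->
  exists v, forall e, 0 < e -> exists N, forall n, (N <= n)%N -> hn (v - u n) <= e.
Proof.
move=> hu.
pose a n x := L2fn (u n.+1) x - L2fn (u n) x.
have ma n : cmeasurable (a n).
  rewrite (_ : a n = fun x => L2fn (u n.+1) x + -1 * L2fn (u n) x); last first.
    by apply/funext => x; rewrite mulN1r.
  apply: cmeasurableD (cmeasurable_L2fn _) _.
  exact: cmeasurableM (cmeasurable_cst _) (cmeasurable_L2fn _).
have na n : (\int[mu]_x (sqnorm (a n x))%:E)%E = (nsq (u n.+1 - u n))%:E.
  by rewrite (@nsq_ae _ _ _ _ _ (a n))//; exact: L2fnB.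
(* With the weight 4^n the integrals are still at most 4^n / 16^n = 4^-n, and a single term already
   gives [sqnorm (a n x) <= g x / 4^n] where [g] is finite. *)
pose s n x : \bar R := (4 ^+ n * sqnorm (a n x))%:E.
have s0 n x : (0 <= s n x)%E by rewrite lee_fin mulr_ge0 ?sqnorm_ge0// exprn_ge0.
have ms n : measurable_fun setT (s n).
  by rewrite /s; under eq_fun do rewrite EFinM; apply: measurable_funeM; exact: measurable_sqnorm.
pose g x := (\sum_(0 <= n <oo) s n x)%E.
have g0 x : (0 <= g x)%E by exact: nneseries_ge0.
have mg : measurable_fun setT g by exact: ge0_emeasurable_sum.
have ig : (\int[mu]_x g x < +oo)%E.
  rewrite integral_nneseries//.
  apply: (@le_lt_trans _ _ (\sum_(0 <= n <oo) (1 / 4 ^+ n : R)%:E)%E).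
    apply: lee_nneseries => n *; first exact: integral_ge0.
    rewrite /s; under eq_integral do rewrite EFinM.
    rewrite ge0_integralZl//; last 2 first.
    - exact: measurable_sqnorm.
    - by move=> x _; rewrite lee_fin sqnorm_ge0.
    rewrite na -EFinM lee_fin.
    apply: le_trans (ler_wpM2l _ (hu n)) _; first by rewrite exprn_ge0.
    rewrite (_ : 16 = 4 * 4 :> R); last by ring.
    by rewrite exprMn !div1r invfM mulrA divff ?mul1r// expf_neq0.
  have cv : (fun n => \sum_(0 <= k < n) (1 / 4 ^+ k : R)%:E)%E @ \oo --> (1 / (1 - 4^-1) : R)%:E.
    rewrite (_ : (fun n => _) = EFin \o series (geometric 1 (4^-1 : R))).
      apply: cvg_EFin; first by near=> n.
      by apply: cvg_geometric_series; rewrite ger0_norm ?invr_ge0// invf_lt1// ltr1n.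
    apply/funext => n /=; rewrite sumEFin; congr EFin; apply: eq_bigr => k _.
    by rewrite /geometric /= exprVn.
  by rewrite (cvg_lim _ cv)// ltry.
pose G := [set x | (g x < +oo)%E].
have mG : measurable G by rewrite -[G]setTI; exact: emeasurable_fun_infty_o.
have aG : {ae mu, forall x, G x}.
  have : mu.-integrable setT g.
    by apply/integrableP; split=> //; under eq_integral do rewrite gee0_abs//.
  move=> /(integrable_ae measurableT); apply: filterS => x /(_ I).
  by rewrite ge0_fin_numE.
pose K x : R := Num.sqrt (fine (g x)).
have aK n x : G x -> sqnorm (a n x) <= (K x / 2 ^+ n) ^+ 2.
  move=> Gx; have gf : g x \is a fin_num by rewrite ge0_fin_numE.
  rewrite expr_div_n sqr_sqrtr; last by rewrite fine_ge0.
  rewrite ler_pdivlMr ?exprn_gt0// exprAC mulrC (_ : 2 ^+ 2 = 4 :> R); last by ring.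
  rewrite -lee_fin fineK//.
  apply: le_trans (nneseries_lim_ge n.+1 _) => //.
  by rewrite big_nat_recr//= leeDr// sume_ge0.
have K0 x : 0 <= K x by exact: sqrtr_ge0.
(* The indicator of [G] makes the sequence converge at every point, so that the pointwise limit is
   measurable. *)
pose cr x n := \1_G x * complex.Re (L2fn (u n) x).
pose ci x n := \1_G x * complex.Im (L2fn (u n) x).
have hcr x : exists l, cr x @ \oo --> l /\ forall n, `|l - cr x n| <= 2 * K x / 2 ^+ n.
  apply: geometric_cauchy => n; rewrite /cr indicE; have [|_] := boolP (x \in G); last first.
    by rewrite !mul0r subrr normr0 divr_ge0 ?exprn_ge0.
  rewrite inE !mul1r => Gx; have [] := normr_Re_le _ (aK n x Gx).
    by rewrite divr_ge0 ?exprn_ge0.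
  by rewrite /a ReD ReN.
have hci x : exists l, ci x @ \oo --> l /\ forall n, `|l - ci x n| <= 2 * K x / 2 ^+ n.
  apply: geometric_cauchy => n; rewrite /ci indicE; have [|_] := boolP (x \in G); last first.
    by rewrite !mul0r subrr normr0 divr_ge0 ?exprn_ge0.
  rewrite inE !mul1r => Gx; have [] := normr_Re_le _ (aK n x Gx).
    by rewrite divr_ge0 ?exprn_ge0.
  by rewrite /a ImD ImN.
have [lr hlr] := choice hcr; have [li hli] := choice hci.
have mlim (c : X -> nat -> R) (l : X -> R) : (forall n, measurable_fun setT (c ^~ n)) ->
    (forall x, c x @ \oo --> l x) -> measurable_fun setT l.
  move=> mc cl; apply: (measurable_fun_cvg mc) => x _; exact: cl.
pose f x : R[i] := (lr x +i* li x)%C.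
have mf : cmeasurable f.
  split.
  - apply: (mlim cr) => [n|x]; last by have [] := hlr x.
    apply: measurable_funM; first exact: measurable_indic.
    by have [] := cmeasurable_L2fn (u n).
  - apply: (mlim ci) => [n|x]; last by have [] := hli x.
    apply: measurable_funM; first exact: measurable_indic.
    by have [] := cmeasurable_L2fn (u n).
have fu n x : G x -> sqnorm (f x - L2fn (u n) x) <= 8 / 4 ^+ n * fine (g x).
  move=> Gx; rewrite sqnormE ReD ReN ImD ImN /=.
  have := (hlr x).2 n; have := (hli x).2 n.
  rewrite /cr /ci indicE mem_set// !mul1r => h1 h2.
  have q0 : 0 <= 2 * K x / 2 ^+ n by rewrite divr_ge0 ?mulr_ge0 ?exprn_ge0.
  have -> : 8 / 4 ^+ n * fine (g x) = 2 * (2 * K x / 2 ^+ n) ^+ 2.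
    rewrite !exprMn sqr_sqrtr ?fine_ge0// exprVn exprAC (_ : 2 ^+ 2 = 4 :> R); last by ring.
    ring.
  rewrite -(real_normK (num_real (lr x - _))) -(real_normK (num_real (li x - _))).
  by rewrite mulrC mulrDr !mulr1 lerD// ler_sqr ?nnegrE.
have mfu n : cmeasurable (fun x => f x - L2fn (u n) x).
  rewrite (_ : (fun x => _) = fun x => f x + -1 * L2fn (u n) x); last first.
    by apply/funext => x; rewrite mulN1r.
  apply: cmeasurableD mf _.
  exact: cmeasurableM (cmeasurable_cst _) (cmeasurable_L2fn _).
set I := fine (\int[mu]_x g x)%E.
have If : (\int[mu]_x g x = I%:E)%E.
  by rewrite fineK// ge0_fin_numE// integral_ge0.
have I0 : 0 <= I by rewrite fine_ge0// integral_ge0.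
have ifu n : (\int[mu]_x (sqnorm (f x - L2fn (u n) x))%:E <= (8 / 4 ^+ n * I)%:E)%E.
  apply: (@le_trans _ _ (\int[mu]_x ((8 / 4 ^+ n)%:E * g x))%E).
    apply: ae_ge0_le_integral => //.
    - by move=> x _; rewrite lee_fin sqnorm_ge0.
    - exact: measurable_sqnorm.
    - by move=> x _; rewrite mule_ge0// lee_fin divr_ge0 ?exprn_ge0.
    - exact: measurable_funeM.
    - apply: filterS aG => x Gx _; rewrite -[g x]fineK; last by rewrite ge0_fin_numE.
      by rewrite -EFinM lee_fin fu.
  rewrite ge0_integralZl//.
  by rewrite If -EFinM.
have isf : isL2 mu f.
  have hd : isL2 mu (fun x => f x - L2fn (u 0%N) x).
    by split=> //; apply: le_lt_trans (ifu 0%N) _; rewrite ltry.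
  pose w := L2of mu (fun x => f x - L2fn (u 0%N) x).
  apply: (@isL2_ae _ _ _ mu _ (L2fn (w + u 0%N))) => //; first exact: isL2_L2fn.
  by apply: filterS2 (L2fnD w (u 0%N)) (L2ofE hd) => x -> ->; rewrite subrK.
exists (L2of mu f) => e e0.
have nv n : nsq (L2of mu f - u n) <= 8 / 4 ^+ n * I.
  rewrite -lee_fin; apply: le_trans (ifu n).
  rewrite (@nsq_ae _ _ _ _ _ (fun x => f x - L2fn (u n) x))//.
  by apply: filterS2 (L2fnB (L2of mu f) (u n)) (L2ofE isf) => x -> ->.
have q1 : `|4^-1 : R| < 1 by rewrite ger0_norm ?invr_ge0// invf_lt1// ltr1n.
have := cvg_expr q1 => /cvgrPdist_lt /(_ (e ^+ 2 / (8 * I + 1))) [|N _ hN].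
  by rewrite divr_gt0 ?exprn_gt0//; lra.
exists N => n /hN /=; rewrite sub0r normrN ger0_norm ?exprn_ge0 ?invr_ge0// => hx.
rewrite -ler_sqr ?nnegrE ?hnorm_ge0 ?(ltW e0)// hnorm_sqr; apply: le_trans (nv n) _.
rewrite -exprVn; have : 0 <= (4^-1 : R) ^+ n by rewrite exprn_ge0 ?invr_ge0.
move: hx; rewrite ltr_pdivlMr; last by lra.
nra.
Unshelve. all: by end_near. Qed.

End L2_complete.

(** * Riesz representation and adjoints of contractions *)

Section riesz_arithmetic.
Context {R : realType}.
Implicit Types (M x y c e m r : R).

Lemma riesz_below M x y : y <= M * x -> - M ^+ 2 <= x ^+ 2 - 2 * y.
Proof. by have := sqr_ge0 (x - M); nra. Qed.

Lemma riesz_expand a b r y l1 l2 :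
  a + r ^+ 2 * b + 2 * (r * y) - 2 * (l1 + r * l2) =
  a - 2 * l1 + 2 * r * (y - l2) + r ^+ 2 * b.
Proof. ring. Qed.

(** [Jm] is the value at the midpoint, which the infimum [m] bounds below; hence two near-minimizers
    are close to each other. *)
Lemma riesz_parallelogram Jv Jw Jm c n m :
  Jv = Jw + 2 * 1 * c + 1 ^+ 2 * n -> Jm = Jw + 2 * 2^-1 * c + 2^-1 ^+ 2 * n ->
  m <= Jm -> n <= 2 * (Jv - m) + 2 * (Jw - m).
Proof. by rewrite expr2; lra. Qed.

(** The factor 1/4 in the slack of the minimizing sequence yields exactly the rate that
    [L2_complete] asks for. *)
Lemma riesz_step a b m n x : a < m + 4^-1 / 16 ^+ n.+1 -> b < m + 4^-1 / 16 ^+ n ->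
  x <= 2 * (a - m) + 2 * (b - m) -> x <= 1 / 16 ^+ n :> R.
Proof.
have : 4^-1 / 16 ^+ n.+1 <= 4^-1 / 16 ^+ n :> R.
  rewrite ler_pM2l ?invr_gt0// lef_pV2 ?posrE ?exprn_gt0//.
  by rewrite ler_eXn2l// ltr1n.
by rewrite div1r; lra.
Qed.

(* [c = 0] because the quadratic polynomial [2 r c + r^2 n] in [r] is nonnegative. *)
Lemma riesz_quadratic c n : 0 <= n ->
  (forall r, 0 <= 2 * r * c + r ^+ 2 * n) -> c = 0.
Proof.
move=> n0 key; have s0 : 0 < n + 1 by lra.
have := key (- c / (n + 1)).
have -> : 2 * (- c / (n + 1)) * c + (- c / (n + 1)) ^+ 2 * n =
   - ((c / (n + 1)) ^+ 2 * (n + 2)).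
  by field; rewrite gt_eqF.
rewrite oppr_ge0 pmulr_lle0; last by lra.
move=> h; have /eqP : (c / (n + 1)) ^+ 2 = 0 by apply/eqP; rewrite eq_le h sqr_ge0.
by rewrite sqrf_eq0 mulf_eq0 invr_eq0 (gt_eqF s0) orbF => /eqP.
Qed.

(** Transfers the variational inequality from a near-minimizer to the limit: [z] is the error of
    this replacement, and it and the slack of the near-minimizer take half of [e] each. *)
Lemma riesz_limit m J r y n l z h e N :
  m <= J + 2 * r * (y - z - l) + r ^+ 2 * n -> J < m + 4^-1 / 16 ^+ N ->
  (16 ^+ N)^-1 < e / 2 -> `|z| <= h * (e / 2 / (2 * `|r| * h + 1)) -> 0 <= h -> 0 < e ->
  - (2 * r * (y - l) + r ^+ 2 * n) <= e.
Proof.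
move=> h1 h2 h3 h4 h0 e0.
have d0 : 4^-1 / 16 ^+ N <= (16 ^+ N)^-1 :> R.
  by rewrite ler_piMl ?invr_ge0 ?exprn_ge0// invf_le1// ler1n.
have C0 : 0 < 2 * `|r| * h + 1 by rewrite ltr_wpDl ?mulr_ge0.
have h5 : 2 * `|r| * `|z| <= e / 2.
  apply: le_trans (ler_wpM2l _ h4) _; first by rewrite mulr_ge0.
  rewrite [leLHS](_ : _ = e / 2 * (2 * `|r| * h / (2 * `|r| * h + 1))); last by ring.
  by rewrite ger_pMr ?divr_gt0// ler_pdivrMr// mul1r; lra.
have h6 : - (2 * r * z) <= e / 2.
  apply: le_trans (ler_norm _) _; rewrite normrN !normrM (ger0_norm (_ : 0 <= 2))//.
by lra.
Qed.

End riesz_arithmetic.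

Section riesz.
Context {d : measure_display} {X : measurableType d} {R : realType}.
Variable mu : {measure set X -> \bar R}.
Implicit Types (u v w : L2 mu).

Local Notation rd := (@rdot R _ (L2dot mu)).
Local Notation nsq := (@nsq R _ (L2dot mu)).
Local Notation hn := (@hnorm R _ (L2dot mu)).

(* The representer minimizes [nsq u - 2 * l u]. *)
Lemma riesz_real (l : L2 mu -> R) (M : R) :
  (forall u v, l (u + v) = l u + l v) ->
  (forall (r : R) u, l (r%:C%C *: u) = r * l u) ->
  (forall u, l u <= M * hn u) ->
  exists w, forall u, rd u w = l u.
Proof.
move=> lD lZ lM.
pose J u := nsq u - 2 * l u.
have Jlow u : - M ^+ 2 <= J u by rewrite /J -hnorm_sqr; exact: riesz_below.
have infJ : has_inf (range J).
  by split; [exists (J 0); exists 0|exists (- M ^+ 2) => _ [u _ <-]].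
set m := inf (range J).
have mJ u : m <= J u by apply: inf_lbound; [exact: infJ.2|exists u].
have seq n : exists u, J u < m + 4^-1 / 16 ^+ n.
  have [|_ [u _ <-] h] := @inf_adherent _ (range J) (4^-1 / 16 ^+ n) _ infJ.
    by rewrite divr_gt0 ?invr_gt0 ?exprn_gt0.
  by exists u.
have [u hu] := choice seq.
have JD v w (r : R) : J (v + r%:C%C *: w) = J v + 2 * r * (rd v w - l w) + r ^+ 2 * nsq w.
  by rewrite /J nsqD nsqZ rdotZr lD lZ riesz_expand.
have par v w : nsq (v - w) <= 2 * (J v - m) + 2 * (J w - m).
  apply: (riesz_parallelogram _ (JD w (v - w) 2^-1) (mJ _)).
  by rewrite -JD rmorph1 scale1r addrC subrK.
have [w hw] : exists v, forall e, 0 < e -> exists N, forall n, (N <= n)%N -> hn (v - u n) <= e.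
  by apply: L2_complete => n; exact: riesz_step (hu n.+1) (hu n) (par _ _).
exists w => v.
have q1 : `|16^-1 : R| < 1 by rewrite ger0_norm ?invr_ge0// invf_lt1// ltr1n.
(* Minimality of the limit [w] along the line through it in the direction [v]. *)
have key (r : R) : 0 <= 2 * r * (rd w v - l v) + r ^+ 2 * nsq v.
  rewrite -[leRHS]opprK oppr_ge0; apply/ler_addgt0Pl => e e0; rewrite addr0.
  have C0 : 0 < 2 * `|r| * hn v + 1 by rewrite ltr_wpDl ?mulr_ge0 ?hnorm_ge0.
  have [N hN] := hw (e / 2 / (2 * `|r| * hn v + 1)) (divr_gt0 (divr_gt0 e0 (ltr0n R 2)) C0).
  have := cvg_expr q1 => /cvgrPdist_lt /(_ (e / 2)) [|N' _ hN'].
    by rewrite divr_gt0.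
  have {}hN := hN _ (leq_maxl N N'); have {}hN' := hN' _ (leq_maxr N N').
  set n := maxn N N' in hN hN'.
  move: hN' => /=; rewrite sub0r normrN ger0_norm ?exprn_ge0 ?invr_ge0// exprVn => hN'.
  apply: (riesz_limit (z := rd (w - u n) v) (h := hn v) (J := J (u n)) (m := m) _ (hu n) hN') => //.
  - have -> : rd w v - rd (w - u n) v = rd (u n) v by rewrite rdotBl opprB addrC subrK.
    by rewrite -JD.
  - apply: le_trans (rdot_le _ _ _) _; rewrite mulrC.
    by rewrite ler_wpM2l ?hnorm_ge0.
  - exact: hnorm_ge0.
by apply/subr0_eq; rewrite rdotC; exact: riesz_quadratic (nsq_ge0 _ _) key.
Qed.

(** [Vs v] represents the functional sending [u] to [rd (V u) v], which is bounded by [hn v]. *)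
Lemma bounded_adjoint (V : L2 mu -> L2 mu) :
  (forall a u v, V (a *: u + v) = a *: V u + V v) -> (forall u, hn (V u) <= hn u) ->
  exists Vs : L2 mu -> L2 mu, forall u v, rd (V u) v = rd u (Vs v).
Proof.
move=> Vl Vb.
have VD u v : V (u + v) = V u + V v by rewrite -[u in LHS]scale1r Vl scale1r.
have V0 : V 0 = 0 by have := VD 0 0; rewrite addr0 -{1}[V 0]addr0 => /addrI.
have VZ a u : V (a *: u) = a *: V u by rewrite -[_ *: _ in LHS]addr0 Vl V0 addr0.
have /choice[Vs h] : forall v, exists w, forall u, rd u w = rd (V u) v.
  move=> v; apply: (@riesz_real (fun u => rd (V u) v) (hn v)).
  - by move=> u u'; rewrite VD rdotDl.
  - by move=> r u; rewrite VZ rdotZl.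
  - move=> u; apply: le_trans (ler_norm _) _; apply: le_trans (rdot_le _ _ _) _.
    by rewrite mulrC ler_wpM2l ?hnorm_ge0.
by exists Vs.
Qed.

End riesz.

(** * Multiplication operators *)

Lemma measurable_fun_sqrt d (T : measurableType d) (R : realType) (f : T -> R) :
  measurable_fun setT f -> measurable_fun setT (fun x => Num.sqrt (f x)).
Proof.
move=> mf; apply: measurableT_comp mf; apply: continuous_measurable_fun.
exact: sqrt_continuous.
Qed.

Section multiplication.
Context {d : measure_display} {X : measurableType d} {R : realType}.
Variable mu : {measure set X -> \bar R}.
Implicit Types (u v w : L2 mu) (k g : X -> R) (A B D : set X).

Local Notation rd := (@rdot R _ (L2dot mu)).
Local Notation nsq := (@nsq R _ (L2dot mu)).
Local Notation hn := (@hnorm R _ (L2dot mu)).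

Lemma mul_domP k u v : measurable_fun setT k ->
  (mul_dom k u /\ mulf k u = v) <->
  {ae mu, forall x, L2fn v x = (k x)%:C%C * L2fn u x}.
Proof.
move=> mk; split=> [[du <-]|]; first exact: mulfE.
exact: ae_mulf_dom.
Qed.

Lemma mul_dom_lin k a u v : measurable_fun setT k -> mul_dom k u -> mul_dom k v ->
  mul_dom k (a *: u + v) /\ mulf k (a *: u + v) = a *: mulf k u + mulf k v.
Proof.
move=> mk du dv; apply/mul_domP => //.
have h1 := L2fnD (a *: mulf k u) (mulf k v); have h2 := L2fnZ a (mulf k u).
have h3 := L2fnD (a *: u) v; have h4 := L2fnZ a u.
have h5 := mulfE du; have h6 := mulfE dv.
near=> x.
have -> : L2fn (a *: mulf k u + mulf k v) x = L2fn (a *: mulf k u) x + L2fn (mulf k v) x by near: x.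
have -> : L2fn (a *: u + v) x = L2fn (a *: u) x + L2fn v x by near: x.
have -> : L2fn (a *: mulf k u) x = a * L2fn (mulf k u) x by near: x.
have -> : L2fn (a *: u) x = a * L2fn u x by near: x.
have -> : L2fn (mulf k u) x = (k x)%:C%C * L2fn u x by near: x.
have -> : L2fn (mulf k v) x = (k x)%:C%C * L2fn v x by near: x.
by rewrite mulrDr mulrCA.
Unshelve. all: by end_near. Qed.

Lemma L2fn0 : {ae mu, forall x, L2fn (0 : L2 mu) x = 0}.
Proof.
have := L2fnZ 0 (0 : L2 mu); rewrite scale0r; apply: filterS => x ->.
by rewrite mul0r.
Qed.

Lemma mul_dom0 k : measurable_fun setT k -> mul_dom k (0 : L2 mu) /\ mulf k 0 = 0 :> L2 mu.
Proof. by move=> mk; apply/mul_domP => //; apply: filterS L2fn0 => x ->; rewrite mulr0. Qed.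

Lemma mul_domZ k a u : measurable_fun setT k -> mul_dom k u ->
  mul_dom k (a *: u) /\ mulf k (a *: u) = a *: mulf k u.
Proof.
move=> mk du; have [d0 m0] := mul_dom0 mk.
by have := mul_dom_lin a mk du d0; rewrite m0 !addr0.
Qed.

Lemma mul_domD k u v : measurable_fun setT k -> mul_dom k u -> mul_dom k v ->
  mul_dom k (u + v) /\ mulf k (u + v) = mulf k u + mulf k v.
Proof. by move=> mk du dv; have := mul_dom_lin 1 mk du dv; rewrite !scale1r. Qed.

Lemma mul_domB k u v : measurable_fun setT k -> mul_dom k u -> mul_dom k v ->
  mul_dom k (u - v) /\ mulf k (u - v) = mulf k u - mulf k v.
Proof.
move=> mk du dv; have [dN mN] := mul_domZ (-1) mk dv.
by have := mul_domD mk du dN; rewrite mN !scaleN1r.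
Qed.

Lemma mulf_sym k u v : mul_dom k u -> mul_dom k v -> rd (mulf k u) v = rd u (mulf k v).
Proof.
move=> du dv; apply: rdot_ae; apply: filterS2 (mulfE du) (mulfE dv) => x -> ->.
by rewrite rmorphM /= oppr0 mulrCA mulrA.
Qed.

Lemma ind_lin D a u v : measurable D -> ind D (a *: u + v) = a *: ind D u + ind D v.
Proof.
by move=> mD; rewrite -!mulf_indic//; apply: (mul_dom_lin a _ _ _).2;
  [exact: measurable_indic|exact: mul_dom_indic..].
Qed.

Lemma indD D u v : measurable D -> ind D (u + v) = ind D u + ind D v.
Proof. by move=> mD; have := ind_lin 1 u v mD; rewrite !scale1r. Qed.

Lemma ind0 D : measurable D -> ind D 0 = 0 :> L2 mu.
Proof. by move=> mD; rewrite -mulf_indic//; apply: (mul_dom0 _).2; exact: measurable_indic. Qed.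

Lemma indZ D a u : measurable D -> ind D (a *: u) = a *: ind D u.
Proof. by move=> mD; have := ind_lin a u 0 mD; rewrite ind0// !addr0. Qed.

Lemma ind_sym D u v : measurable D -> rd (ind D u) v = rd u (ind D v).
Proof. by move=> mD; rewrite -!mulf_indic//; apply: mulf_sym; exact: mul_dom_indic. Qed.

Lemma indI A B u : measurable A -> measurable B -> ind A (ind B u) = ind (A `&` B) u.
Proof.
move=> mA mB; apply: L2_eqP.
apply: filterS3 (indE (ind B u) mA) (indE u mB) (indE u (measurableI A B mA mB)) => x -> -> ->.
by rewrite indicI mulrA rmorphM.
Qed.

Lemma indT u : ind setT u = u.
Proof.
by apply: L2_eqP; apply: filterS (indE u measurableT) => x ->; rewrite indicT mul1r.
Qed.

Lemma ind_set0 u : ind set0 u = 0.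
Proof.
apply: L2_eqP; apply: filterS2 (indE u measurable0) L2fn0 => x -> ->.
by rewrite indic0 mul0r.
Qed.

Lemma indK D u : measurable D -> ind D (ind D u) = ind D u.
Proof. by move=> mD; rewrite indI// setIid. Qed.

Lemma ind_ind0 A B u : measurable A -> measurable B -> A `&` B = set0 ->
  ind A (ind B u) = 0.
Proof. by move=> mA mB AB; rewrite indI// AB ind_set0. Qed.

Lemma indU A B u : measurable A -> measurable B -> A `&` B = set0 ->
  ind (A `|` B) u = ind A u + ind B u.
Proof.
move=> mA mB AB; apply: L2_eqP; have mU := measurableU A B mA mB.
have h := L2fnD (ind A u) (ind B u).
have h2 : {ae mu, forall x, L2fn (ind A u + ind B u) x = (\1_A x + \1_B x : R)%:C%C * L2fn u x}.
  by apply: filterS3 h (indE u mA) (indE u mB) => x -> -> ->; rewrite -mulrDl rmorphD.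
apply: filterS2 (indE u mU) h2 => x -> ->.
congr (_%:C%C * _); rewrite !indicE in_setU.
have [xA|xA] := boolP (x \in A); have [xB|xB] := boolP (x \in B) => /=; rewrite ?addr0 ?add0r//.
have : (A `&` B) x by split; rewrite -in_setE.
by rewrite AB.
Qed.

Lemma indC D u : measurable D -> u = ind D u + ind (~` D) u.
Proof.
move=> mD; rewrite -indU ?setICr ?setUv ?indT//; exact: measurableC.
Qed.

Lemma nsq_mulf k u : mul_dom k u ->
  (nsq (mulf k u))%:E = (\int[mu]_x ((k x ^+ 2)%:E * (sqnorm (L2fn u x))%:E))%E.
Proof.
move=> du; rewrite (@nsq_ae _ _ _ _ _ (fun x => (k x)%:C%C * L2fn u x)).
- by apply: eq_integral => x _; rewrite sqnorm_mulr EFinM.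
- by case: du.
- exact: mulfE.
Qed.

Lemma nsq_ind D u : measurable D ->
  (nsq (ind D u))%:E = (\int[mu]_(x in D) (sqnorm (L2fn u x))%:E)%E.
Proof.
move=> mD; rewrite -mulf_indic// nsq_mulf; last exact: mul_dom_indic.
rewrite [RHS]integral_mkcond; apply: eq_integral => x _; rewrite patchE indicE.
by case: (x \in D); rewrite ?expr1n ?mul1e// expr0n mul0e.
Qed.

Lemma mul_dom_iff k u : measurable_fun setT k ->
  mul_dom k u <-> (\int[mu]_x ((k x ^+ 2)%:E * (sqnorm (L2fn u x))%:E) < +oo)%E.
Proof.
move=> mk; rewrite /mul_dom /isL2.
under eq_integral do rewrite sqnorm_mulr EFinM.
split=> [[]//|h]; split=> //.
by apply: cmeasurable_mulr => //; exact: cmeasurable_L2fn.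
Qed.

(** The dominating function is [u + i g u], a single element of L2 whose squared modulus is
    [1 + g ^+ 2] times that of [u]. *)
Lemma mul_dom_le k g u (C : R) : measurable_fun setT k -> measurable_fun setT g ->
  mul_dom g u -> (forall x, k x ^+ 2 <= C * (1 + g x ^+ 2)) -> mul_dom k u.
Proof.
move=> mk mg du kg.
apply: (@isL2_dominated _ _ _ mu _ (L2fn (u + 'i%C *: mulf g u)) C).
- by apply: cmeasurable_mulr => //; exact: cmeasurable_L2fn.
- exact: isL2_L2fn.
have h1 := L2fnD u ('i%C *: mulf g u); have h2 := L2fnZ 'i%C (mulf g u).
apply: filterS3 h1 h2 (mulfE du) => x -> -> ->; rewrite sqnorm_mulr.
have -> : sqnorm (L2fn u x + 'i%C * ((g x)%:C%C * L2fn u x)) = (1 + g x ^+ 2) * sqnorm (L2fn u x).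
  by rewrite !sqnormE; case: (L2fn u x) => a b /=; ring.
by rewrite mulrA ler_wpM2r ?sqnorm_ge0.
Qed.

Lemma mulf_rdot_sqrt g u (s := fun x => Num.sqrt (g x)) : measurable_fun setT g ->
  (forall x, 0 <= g x) -> mul_dom g u ->
  mul_dom s u /\ rd (mulf g u) u = nsq (mulf s u).
Proof.
move=> mg g0 du.
have ms : measurable_fun setT s by exact: measurable_fun_sqrt.
have ds : mul_dom s u.
  apply: (@mul_dom_le _ g _ 1) => // x; rewrite sqr_sqrtr//.
  by have := sqr_ge0 (g x - 1); have := sqr_ge0 (g x); nra.
split=> //; apply: rdot_ae; apply: filterS2 (mulfE du) (mulfE ds) => x -> ->.
rewrite rmorphM /= oppr0 -/(s x) [RHS]mulrACA -rmorphM /= -expr2 sqr_sqrtr//.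
by rewrite mulrA.
Qed.

Lemma mulf_rdot_ge0 g u : measurable_fun setT g -> (forall x, 0 <= g x) ->
  mul_dom g u -> 0 <= rd (mulf g u) u.
Proof. by move=> mg g0 du; rewrite (mulf_rdot_sqrt mg g0 du).2 nsq_ge0. Qed.

Lemma mulf_rdot_int g u : measurable_fun setT g -> (forall x, 0 <= g x) ->
  mul_dom g u ->
  (rd (mulf g u) u)%:E = (\int[mu]_x ((g x)%:E * (sqnorm (L2fn u x))%:E))%E.
Proof.
move=> mg g0 du; have [ds ->] := mulf_rdot_sqrt mg g0 du.
by rewrite nsq_mulf//; apply: eq_integral => x _; rewrite sqr_sqrtr.
Qed.

Lemma measurable_sublevel k (C : R) : measurable_fun setT k ->
  measurable [set x | `|k x| <= C].
Proof.
move=> mk; rewrite -[X in measurable X]setTI; apply: measurable_fun_le => //.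
exact: measurableT_comp.
Qed.

Lemma trunc_cvg k u (e : R) : measurable_fun setT k -> 0 < e ->
  exists N, forall n, (N <= n)%N -> hn (u - ind [set x | `|k x| <= n%:R] u) < e.
Proof.
move=> mk e0; apply: ind_cvg => //.
- by move=> n; exact: measurable_sublevel.
- by move=> m n mn x /= h; apply: le_trans h _; rewrite ler_nat.
- by move=> x; exists (truncn `|k x|).+1; exact/ltW/truncnS_gt.
Qed.

Lemma mulf_ind D k u : measurable D -> measurable_fun setT k -> mul_dom k u ->
  mul_dom k (ind D u) /\ mulf k (ind D u) = ind D (mulf k u).
Proof.
move=> mD mk du; apply/mul_domP => //.
apply: filterS3 (indE (mulf k u) mD) (mulfE du) (indE u mD) => x -> -> ->.
by rewrite mulrCA.
Qed.

Lemma mul_dom_trunc k (C : R) D u : measurable D -> measurable_fun setT k ->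
  (forall x, D x -> `|k x| <= C) ->
  mul_dom k (ind D u) /\ hn (mulf k (ind D u)) <= C * hn (ind D u).
Proof.
move=> mD mk kC.
have kk : {ae mu, forall x, sqnorm ((k x)%:C%C * L2fn (ind D u) x) <= C ^+ 2 * sqnorm (L2fn (ind D u) x)}.
  apply: filterS (indE u mD) => x ->; rewrite !sqnorm_mulr indicE.
  have [xD|_] := boolP (x \in D); last by rewrite expr0n !mul0r !mulr0.
  rewrite expr1n mul1r ler_wpM2r ?sqnorm_ge0//; move: xD; rewrite inE => /kC h.
  by rewrite -(real_normK (num_real (k x))) ler_sqr ?nnegrE//; exact: le_trans (normr_ge0 _) h.
have dk : mul_dom k (ind D u).
  apply: (@isL2_dominated _ _ _ mu _ (L2fn (ind D u)) (C ^+ 2)) => //.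
    by apply: cmeasurable_mulr => //; exact: cmeasurable_L2fn.
  exact: isL2_L2fn.
(* An empty [D] puts no constraint on [C], which may then be negative. *)
split=> //; have [[x Dx]|D0] := pselect (exists x, D x); last first.
  have -> : D = set0 by rewrite -subset0 => x Dx; apply: D0; exists x.
  by rewrite ind_set0 (mul_dom0 mk).2 hnorm0 mulr0.
have C0 : 0 <= C by exact: le_trans (normr_ge0 _) (kC x Dx).
apply: hnorm_leM => //; apply: nsq_le_ae; first exact: sqr_ge0.
by apply: filterS2 (mulfE dk) kk => t ->.
Qed.

End multiplication.

(** * Multiplication operators compressed by a partial isometry *)

(* [V (f \o g) Vs] models both [|A|] (with [V = id]) and [|A^*|] (with [V] the phase of [A]),
   and their functional calculus. *)
Section compression.
Context {d : measure_display} {X : measurableType d} {R : realType}.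
Variable mu : {measure set X -> \bar R}.
Implicit Types (u v w e : L2 mu) (k : X -> R) (A B D : set X).

Local Notation dot := (L2dot mu).
Local Notation rd := (@rdot R _ (L2dot mu)).
Local Notation nsq := (@nsq R _ (L2dot mu)).
Local Notation hn := (@hnorm R _ (L2dot mu)).

Variables (V Vs : L2 mu -> L2 mu) (Y : set X) (g : X -> R).
Hypothesis V_lin : forall a u v, V (a *: u + v) = a *: V u + V v.
Hypothesis V_adj : forall u v, rd (V u) v = rd u (Vs v).
Hypothesis mY : measurable Y.
(** Thus [V] is a partial isometry whose initial space consists of the functions supported in
    [Y]. *)
Hypothesis VsV : forall u, Vs (V u) = ind Y u.
Hypothesis mg : measurable_fun setT g.
Hypothesis g0 : forall x, 0 <= g x.
Hypothesis gY : forall x, g x != 0 -> Y x.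

Local Notation iu u := ('i%C *: u).

Lemma comprD u v : V (u + v) = V u + V v.
Proof. by rewrite -[u in LHS]scale1r V_lin scale1r. Qed.

Lemma compr0 : V 0 = 0.
Proof. by have := comprD 0 0; rewrite addr0 -{1}[V 0]addr0 => /addrI. Qed.

Lemma comprZ a u : V (a *: u) = a *: V u.
Proof. by rewrite -[a *: u]addr0 V_lin compr0 addr0. Qed.

Lemma comprB u v : V (u - v) = V u - V v.
Proof. by rewrite -scaleN1r comprD comprZ scaleN1r. Qed.

Lemma adjD u v : Vs (u + v) = Vs u + Vs v.
Proof. by apply: (@rdot_inj R _ dot) => z; rewrite rdotC -V_adj !rdotDr rdotDl !V_adj !(rdotC _ z). Qed.

Lemma adjr (r : R) u : Vs (r%:C%C *: u) = r%:C%C *: Vs u.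
Proof. by apply: (@rdot_inj R _ dot) => z; rewrite rdotC -V_adj rdotZr rdotZl V_adj rdotC. Qed.

Lemma adji u : Vs (iu u) = iu (Vs u).
Proof.
apply: (@rdot_inj R _ dot) => z; rewrite rdotC -V_adj rdot_ir -comprZ V_adj.
by rewrite [RHS]rdotC [RHS]rdot_ir.
Qed.

(** [Vs] is given as adjoint for the real inner product only; its complex linearity is inherited
    from [V]. *)
Lemma adj_lin a u v : Vs (a *: u + v) = a *: Vs u + Vs v.
Proof.
rewrite adjD; congr (_ + _); case: a => x y.
have -> : (x +i* y)%C = x%:C%C + y%:C%C * 'i%C.
  by apply/eqP; rewrite eq_complex /=; apply/andP; split; apply/eqP; ring.
by rewrite !scalerDl -!scalerA adjD !adjr adji.
Qed.

Lemma adjB u v : Vs (u - v) = Vs u - Vs v.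
Proof. by rewrite addrC -scaleN1r adj_lin scaleN1r addrC. Qed.

Lemma nsq_compr u : nsq (V u) = nsq (ind Y u).
Proof.
rewrite !nsq_rdot V_adj VsV.
by rewrite -[in RHS]ind_sym// indK// ind_sym.
Qed.

Lemma nsq_ind_le D u : measurable D -> nsq (ind D u) <= nsq u.
Proof.
move=> mD; rewrite [in leRHS](indC u mD) nsqD.
have -> : rd (ind D u) (ind (~` D) u) = 0.
  by rewrite ind_sym// ind_ind0 ?setICr ?rdot0r//; exact: measurableC.
by rewrite mulr0 addr0 lerDl nsq_ge0.
Qed.

Lemma hnorm_compr_le u : hn (V u) <= hn u.
Proof. by apply: hnorm_le; rewrite nsq_compr nsq_ind_le. Qed.

Lemma hnorm_adj_le u : hn (Vs u) <= hn u.
Proof.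
have [->|n0] := eqVneq (Vs u) 0; first by rewrite hnorm0 hnorm_ge0.
have h := hnorm_gt0 dot n0; rewrite -(ler_pM2l h) -expr2 hnorm_sqr.
rewrite nsq_rdot -V_adj; apply: le_trans (ler_norm _) _; apply: le_trans (rdot_le _ _ _) _.
by rewrite ler_wpM2r ?hnorm_ge0// hnorm_compr_le.
Qed.

Lemma compr_ind u : V (ind Y u) = V u.
Proof.
have mC := measurableC mY.
rewrite [in RHS](indC u mY) comprD (_ : V (ind (~` Y) u) = 0) ?addr0//.
by apply: (@nsq_eq0 R _ dot); rewrite nsq_compr ind_ind0 ?setICr ?nsq0.
Qed.

Lemma adj_ind u : ind Y (Vs u) = Vs u.
Proof.
apply: (@rdot_inj R _ dot) => z.
by rewrite ind_sym// rdotC -V_adj compr_ind V_adj rdotC.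
Qed.

Lemma adjK u : Vs (V (Vs u)) = Vs u.
Proof. by rewrite VsV adj_ind. Qed.

Lemma compr_ker u : Vs (u - V (Vs u)) = 0.
Proof. by rewrite adjB adjK subrr. Qed.

Definition cop k : operator (L2 mu) :=
  [set x | mul_dom k (Vs x.1) /\ x.2 = V (mulf k (Vs x.1))].

Section one_symbol.
Variable k : X -> R.
Hypothesis mk : measurable_fun setT k.

Lemma cop_is_operator : is_operator (cop k).
Proof.
split.
- have [d0 m0] := mul_dom0 mu mk; rewrite /cop /=; have -> : Vs 0 = 0.
    by have := adjr 0 0; rewrite !scaler0 scale0r.
  by rewrite m0 compr0.
- move=> a [x1 x2] [y1 y2] [/= dx ->] [/= dy ->]; rewrite /cop /= adj_lin.
  by have [dd ->] := mul_dom_lin a mk dx dy; rewrite V_lin.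
- by move=> u v v' [/= _ ->] [/= _ ->].
Qed.

Lemma adj_mulf u : mul_dom k (Vs u) -> ind Y (mulf k (Vs u)) = mulf k (Vs u).
Proof. by move=> du; have [_ <-] := mulf_ind mY mk du; rewrite adj_ind. Qed.

Lemma cop_dense : densely_defined dot (cop k).
Proof.
move=> u r r0; pose A n := [set x | `|k x| <= n%:R].
have mA n : measurable (A n) by exact: measurable_sublevel.
have [N /(_ N (leqnn N)) hN] := trunc_cvg (Vs u) mk r0.
(* The component in the kernel of [Vs] is kept, and only the one in the range of [V] is
   truncated. *)
exists (u - V (Vs u) + V (ind (A N) (Vs u))); split.
  exists (V (mulf k (Vs (u - V (Vs u) + V (ind (A N) (Vs u)))))); split=> //=.
  rewrite adjD compr_ker add0r VsV indI// setIC -indI// adj_ind.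
  by apply: (mul_dom_trunc _ (mA N) mk _).1 => x; exact.
apply: le_lt_trans hN; rewrite opprD opprB addrA addrC.
rewrite [X in hn X](_ : _ = V (Vs u - ind (A N) (Vs u))); last first.
  by rewrite comprB (addrCA u) subrr addr0 addrC.
exact: hnorm_compr_le.
Qed.

End one_symbol.


(** On these sets [g] is bounded and bounded away from 0; they exhaust [g != 0] and carry the test
    vectors. *)
Definition level n := [set x | n.+1%:R^-1 < g x <= n.+1%:R].

Lemma measurable_level n : measurable (level n).
Proof.
have mle (C : R) : measurable [set x | g x <= C].
  by rewrite -[X in measurable X]setTI; apply: measurable_fun_le => //; exact: measurable_cst.
rewrite (_ : level n = ~` [set x | g x <= n.+1%:R^-1] `&` [set x | g x <= n.+1%:R]).
  by apply: measurableI => //; exact: measurableC.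
by apply/seteqP; split=> x; rewrite /level /setI /=;
  [move=> /andP[h ->]; split=> //; apply/negP; rewrite -ltNge|move=> [/negP h ->]; rewrite ltNge h].
Qed.

Lemma level_exhaust x : g x != 0 -> exists n, level n x.
Proof.
move=> gx; have gx0 : 0 < g x by rewrite lt_neqAle eq_sym gx g0.
(* The successor of this number exceeds both [g x] and its inverse. *)
exists (truncn (g x + (g x)^-1)); rewrite /level /=; apply/andP; split.
  rewrite invf_plt ?posrE//; apply: lt_trans (truncnS_gt _).
  by rewrite ltrDr.
by apply/ltW; apply: lt_trans (truncnS_gt _); rewrite ltrDl invr_gt0.
Qed.

Lemma mul_dom_level n u : mul_dom g (ind (level n) u).
Proof.
apply: (mul_dom_trunc (C := n.+1%:R) u (measurable_level n) mg _).1 => x /andP[_ h].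
by rewrite ger0_norm.
Qed.

Let pos := [set x | g x != 0].

Lemma measurable_pos : measurable pos.
Proof.
rewrite (_ : pos = \bigcup_n level n); first exact/bigcupT_measurable/measurable_level.
apply/seteqP; split=> [x /level_exhaust[n h]|x [n _ /andP[h _]]]; first by exists n.
by rewrite /pos /= gt_eqF//; apply: lt_trans h; rewrite invr_gt0.
Qed.

(* Two test conditions that identify [x2] as [V (g w)]: they are how the adjoints below and the
   square root are computed. *)
Lemma compr_key w x2 :
  (forall n e, rd (mulf g (ind (level n) e)) w = rd (ind (level n) e) (Vs x2)) ->
  (forall z, {ae mu, forall x, (g x)%:C%C * L2fn (Vs z) x = 0} -> rd z x2 = 0) ->
  mul_dom g w /\ V (mulf g w) = x2.
Proof.
move=> h1 h2.
(* Testing against all vectors supported in a level identifies [Vs x2] with the product of [g] and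
   [w] there. *)
have e1 n : ind (level n) (Vs x2) = mulf g (ind (level n) w).
  apply: (@rdot_inj R _ dot) => e; have mn := measurable_level n.
  have de := mul_dom_level n e; have dw := mul_dom_level n w.
  have loc (z : L2 mu) : mul_dom g (ind (level n) z) ->
      mulf g (ind (level n) z) = ind (level n) (mulf g (ind (level n) z)).
    by move=> dz; have [_ <-] := mulf_ind mn mg dz; rewrite (indK z mn).
  apply: etrans (ind_sym (Vs x2) e mn) _.
  apply: etrans (rdotC dot (Vs x2) (ind (level n) e)) _.
  apply: etrans (esym (h1 n e)) _; rewrite (loc e de) (loc w dw).
  apply: etrans (ind_sym _ w mn) _; apply: etrans _ (esym (ind_sym _ e mn)).
  apply: etrans (mulf_sym de dw) _; exact: rdotC.
have e2 : {ae mu, forall x, forall n, (\1_(level n) x : R)%:C%C * L2fn (Vs x2) x =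
    (g x)%:C%C * ((\1_(level n) x : R)%:C%C * L2fn w x)}.
  apply: ae_foralln => n; have mn := measurable_level n.
  apply: filterS3 (indE (Vs x2) mn) (mulfE (mul_dom_level n w)) (indE w mn) => x <- h <-.
  by rewrite -h e1.
have mp := measurable_pos.
have e3 : {ae mu, forall x, L2fn (ind pos (Vs x2)) x = (g x)%:C%C * L2fn w x}.
  apply: filterS2 (indE (Vs x2) mp) e2 => x -> e2; have [gx|gx] := boolP (g x == 0).
    by rewrite indicE memNset ?mul0r ?(eqP gx) ?mul0r// /pos /= gx.
  have [n nx] := level_exhaust gx; have := e2 n.
  by rewrite !indicE !mem_set// !mul1r.
have [dw mw] := ae_mulf_dom mg e3; split=> //; rewrite mw.
(* The image of [x2 - V q] under [Vs] is supported where [g] vanishes, so [h2] makes this vector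
   orthogonal to [x2]; it is orthogonal to [V q] as well. *)
set q := ind pos (Vs x2); suff d0 : x2 - V q = 0 by exact: (esym (subr0_eq d0)).
apply: (@nsq_eq0 R _ dot).
have qY : ind Y q = q.
  by rewrite /q indI// (_ : Y `&` pos = pos)//; apply/setIidr => x; exact: gY.
have zq : Vs (x2 - V q) = Vs x2 - q by rewrite adjB VsV qY.
have Vz : Vs (x2 - V q) = ind (~` pos) (Vs x2).
  by rewrite zq {1}(indC (Vs x2) mp) -/q addrC addKr.
rewrite nsq_rdot rdotBr h2; last first.
  rewrite Vz; apply: filterS (indE (Vs x2) (measurableC mp)) => x ->.
  rewrite indicE in_setC; have [gx|gx] := boolP (g x == 0); first by rewrite (eqP gx) mul0r.
  by rewrite mem_set//= mul0r mulr0.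
rewrite sub0r rdotC V_adj Vz /q -ind_sym; last exact: measurableC.
by rewrite ind_ind0 ?setICl ?rdot0l ?oppr0//; exact: measurableC.
Qed.

Lemma cop_sym x y : cop g x -> cop g y -> rd y.2 x.1 = rd y.1 x.2.
Proof.
by move=> [dx ->] [dy ->]; rewrite V_adj mulf_sym// [RHS]rdotC V_adj rdotC.
Qed.

Lemma level_cop n e : cop g (V (ind (level n) e), V (mulf g (ind (level n) e))).
Proof.
have mn := measurable_level n.
have YE : Vs (V (ind (level n) e)) = ind (level n) e.
  rewrite VsV indI// (_ : Y `&` level n = level n)//; apply/setIidr => x /andP[h _].
  by apply: gY; rewrite gt_eqF//; apply: lt_trans h; rewrite invr_gt0.
by rewrite /cop /= YE; split=> //; exact: mul_dom_level.
Qed.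

Lemma ker_cop z : {ae mu, forall x, (g x)%:C%C * L2fn (Vs z) x = 0} -> cop g (z, 0).
Proof.
move=> gz; have [dz mz] : mul_dom g (Vs z) /\ mulf g (Vs z) = 0.
  by apply: ae_mulf_dom => //; apply: filterS2 gz (L2fn0 mu) => x -> ->.
by rewrite /cop /= mz compr0.
Qed.

Lemma sub_cop x :
  (forall n e, rd (V (mulf g (ind (level n) e))) x.1 = rd (V (ind (level n) e)) x.2) ->
  (forall z, cop g (z, 0) -> rd z x.2 = 0) -> cop g x.
Proof.
move=> h1 h2; have [dw e] : mul_dom g (Vs x.1) /\ V (mulf g (Vs x.1)) = x.2.
  apply: compr_key => [n e|z hz]; first by rewrite -V_adj h1 V_adj.
  by apply: h2; exact: ker_cop.
by split.
Qed.

(** An element of the adjoint need only be tested on level vectors and on the kernel, by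
    [sub_cop]. *)
Lemma cop_selfadjoint : selfadjoint dot (cop g).
Proof.
split; [exact: cop_is_operator|exact: cop_dense|].
have opT := cop_is_operator mg.
apply/seteqP; split=> [x xA|x Tx].
  apply: sub_cop => [n e|z Tz].
    exact: (adjoint_rdot xA (level_cop n e)).
  by have := adjoint_rdot xA Tz; rewrite /= rdot0l => <-.
apply: adjoint_rdotP => [y Ty|y Ty]; first exact: is_operator_scale.
exact: cop_sym.
Qed.

Lemma cop_positive : positive_op dot (cop g).
Proof.
move=> x Tx; have [_ _ sT] := cop_selfadjoint.
have Ax : adjoint dot (cop g) x by rewrite sT.
have := Ax _ Tx; case: Tx => dx e.
have ge : 0 <= rd x.2 x.1 by rewrite e V_adj; exact: mulf_rdot_ge0.
move=> sd; have im (z : R[i]) : z = (z^*)%C -> complex.Im z = 0.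
  by case: z => a b /(congr1 (@complex.Im R)) /= h; lra.
rewrite lecE; apply/andP; split; last exact: ge.
by rewrite (im _ (etrans sd (L2dotC x.1 x.2))).
Qed.

(** * Uniqueness of the positive square root *)

Section square_root.
Variable P : operator (L2 mu).
Hypothesis sP : selfadjoint dot P.
Hypothesis pP : positive_op dot P.
Hypothesis PT : comp_op P P = comp_op (cop g) (cop g).

Lemma selfadjoint_sym x y : P x -> P y -> rd y.2 x.1 = rd y.1 x.2.
Proof.
by move=> Px Py; have [_ _ aP] := sP; apply: (adjoint_rdot _ Py); rewrite aP.
Qed.

Section one_level.
Variable n : nat.
Let mn := measurable_level n.
Let E e : L2 mu := ind (level n) e.
Let G e : L2 mu := mulf g (E e).
Let N : R := n.+1%:R.
(** Multiplication by [N - g] on the level; the lower bound [N^-1] of [g] there makes its norm at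
    most [N - N^-1], strictly below [N]. *)
Let S e : L2 mu := N%:C%C *: E e - G e.

Let N_gt0 : 0 < N. Proof. by rewrite /N ltr0n. Qed.

Let N_ge1 : 1 <= N. Proof. by rewrite /N ler1n. Qed.

Let N_sub : 0 <= N - N^-1.
Proof. by rewrite subr_ge0; apply: le_trans N_ge1; rewrite invf_le1. Qed.

Let EK e : E (E e) = E e. Proof. exact: indK. Qed.

Let EG e : E (G e) = G e.
Proof. by have [_ h] := mulf_ind mn mg (mul_dom_level n e); rewrite /G /E -h (indK e mn). Qed.

Let EB u v : E (u - v) = E u - E v.
Proof. by rewrite /E -scaleN1r indD// indZ// scaleN1r. Qed.

Let ES e : E (S e) = S e.
Proof. by rewrite /S EB EG /E indZ// indK. Qed.

Let GS e : G (S e) = N%:C%C *: G e - G (G e).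
Proof.
rewrite {1}/G ES /S.
have [dN mN] := mul_domZ N%:C%C mg (mul_dom_level n e).
have dG : mul_dom g (G e) by rewrite -EG; exact: mul_dom_level.
have [_ ->] := mul_domB mg dN dG; rewrite mN; congr (_ - _).
by rewrite {2}/G EG.
Qed.

Let hnS e : hn (S e) <= (N - N^-1) * hn (E e).
Proof.
apply: hnorm_leM => //; apply: nsq_le_ae; first exact: sqr_ge0.
have h1 := L2fnB (N%:C%C *: E e) (G e); have h2 := L2fnZ N%:C%C (E e).
have h3 := mulfE (mul_dom_level n e); have h4 := indE e mn.
have h5 : {ae mu, forall x, L2fn (S e) x = (N - g x)%:C%C * L2fn (E e) x}.
  by apply: filterS3 h1 h2 h3 => x -> -> ->; rewrite -mulrBl -rmorphB.
apply: filterS2 h5 h4 => x -> ->; rewrite !sqnorm_mulr indicE.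
have [|_] := boolP (x \in level n); last by rewrite expr0n !mul0r !mulr0.
rewrite inE => /andP[l1 l2]; apply: ler_wpM2r; first by apply: mulr_ge0; [exact: sqr_ge0|exact: sqnorm_ge0].
have a1 : 0 <= N - g x by rewrite subr_ge0.
have a2 : N - g x <= N - N^-1 by apply: lerB => //; exact: ltW.
by rewrite !expr2; apply: ler_pM.
Qed.

Let root e : exists v, P (V (E e), v) /\ P (v, V (G (G e))).
Proof.
have : comp_op (cop g) (cop g) (V (E e), V (G (G e))).
  exists (V (G e)); split; first exact: level_cop.
  by rewrite /= -{1}(EG e); exact: level_cop.
by rewrite -PT.
Qed.

(** Let [D u] be the difference of [P] and [cop g] on [V (E u)]. As both have the same square, [P]
    sends [D u] to [- D (G u)], and positivity of [P] gives [N * hn (D u) <= hn (D (S u))]. Along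
    the iterates of [S], however, [D] is bounded by a multiple of the powers of [N - N^-1], so it
    vanishes. *)
Lemma level_root e : P (V (ind (level n) e), V (mulf g (ind (level n) e))).
Proof.
have [f fP] := choice root; have [opP _ _] := sP; have [_ _ fun_P] := opP.
pose D u := f u - V (G u).
suff D0 : D (E e) = 0.
  have fE : f (E e) = f e.
    by apply: fun_P (fP e).1; have := (fP (E e)).1; rewrite EK.
  have GE : G (E e) = G e by rewrite /G EK.
  by move: D0; rewrite /D GE fE => /subr0_eq <-; exact: (fP e).1.
have PD u : P (D u, - D (G u)).
  have := is_operator_sub opP (fP u).2 (fP (G u)).1.
  by rewrite /D opprB EG.
have DS u : D (S u) = N%:C%C *: D u - D (G u).
  rewrite /D GS comprB comprZ.
  have -> : f (S u) = N%:C%C *: f u - f (G u).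
    apply: fun_P (fP (S u)).1 _; rewrite ES /S comprB comprZ -{1}(EG u).
    exact: (is_operator_sub opP (is_operator_scale N%:C%C opP (fP u).1) (fP (G u)).1).
  by rewrite scalerBr !opprB addrACA [RHS]addrACA; congr (_ + _); rewrite addrC.
have lowD u : N * hn (D u) <= hn (D (S u)).
  apply: hnorm_ge_rdot; rewrite DS rdotBl rdotZl lerBrDr gerDl -oppr_ge0 -rdotNl.
  exact: positive_rdot pP (PD u).
(* By symmetry both sides are the quadratic form of the common square. *)
have hnf u : nsq (f u) = nsq (V (G u)).
  have := selfadjoint_sym (fP u).1 (fP u).2; rewrite /= -/(nsq _) => e1.
  have cG : cop g (V (G u), V (G (G u))) by rewrite -{1}(EG u); exact: level_cop.
  by rewrite -e1; exact: (cop_sym (level_cop n u) cG).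
have upD u : hn (D u) <= 2 * N * hn (E u).
  apply: le_trans (hnormB _ _ _) _; rewrite (_ : hn (f u) = hn (V (G u))).
    rewrite -mulrA mulr2n mulrDl !mul1r.
    have h : hn (V (G u)) <= N * hn (E u).
      apply: le_trans (hnorm_compr_le _) _.
      apply: (mul_dom_trunc (C := N) u mn mg _).2 => x /andP[_ h].
      by rewrite ger0_norm.
    exact: lerD.
  by rewrite /hnorm -/(rd _ _) -/(rd _ _) -/(nsq _) -/(nsq _) hnf.
have /= := @pow_contract _ _ dot (N - N^-1) N (fun j : nat => D (iter j S (E e))) (2 * N * hn (E e)).
apply.
- by rewrite N_sub gtrDl oppr_lt0 invr_gt0.
- by move=> j; exact: lowD.
- move=> m; apply: le_trans (upD _) _.
  rewrite mulrCA ler_wpM2l ?mulr_ge0 ?(ltW N_gt0)//.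
  have Ek (j : nat) : E (iter j S (E e)) = iter j S (E e) by case: j => [|j] /=; [exact: EK|exact: ES].
  rewrite Ek; elim: m => [|m ih]; first by rewrite expr0 mul1r.
  rewrite exprS -mulrA /=; apply: le_trans (hnS _) _.
  by rewrite Ek ler_wpM2l.
Qed.

End one_level.

(** A kernel vector of [cop g] is killed by the square of [P], hence by [P]. With [level_root], the
    symmetry of [P] then meets both conditions of [sub_cop], and selfadjoint operators are
    maximal. *)
Lemma square_root_unique : P = cop g.
Proof.
apply/esym/(selfadjoint_max cop_selfadjoint sP) => x Px.
apply: sub_cop => [n e|z Tz]; first exact: selfadjoint_sym Px (level_root n e).
have T0 : cop g (0, 0) by have [] := cop_is_operator mg.
have : comp_op (cop g) (cop g) (z, 0) by exists 0.
rewrite -PT => -[v [/= Pzv Pv0]].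
have v0 : v = 0.
  apply: (@nsq_eq0 R _ dot); have := selfadjoint_sym Pv0 Pzv.
  by rewrite /= rdot0r.
by rewrite v0 in Pzv; have := selfadjoint_sym Px Pzv; rewrite /= rdot0l => <-.
Qed.

End square_root.


(** * The spectral measure of [cop g] and its functional calculus *)

Implicit Types C : set R.

Let Q u : L2 mu := u - V (Vs u).

(** [Q] projects onto the kernel of [Vs], on which [cop g] vanishes; this part belongs to the
    spectral value 0. *)
Definition cop_spectral C u : L2 mu :=
  V (ind (g @^-1` C) (Vs u)) + (\1_C (0 : R) : R)%:C%C *: Q u.

Let F := cop_spectral.

Let mpre C : measurable C -> measurable (g @^-1` C).
Proof. by move=> mC; rewrite -[X in measurable X]setTI; exact: mg. Qed.

Let QV e : Q (V e) = 0.
Proof. by rewrite /Q VsV compr_ind subrr. Qed.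

Let QQ u : Q (Q u) = Q u.
Proof. by rewrite {1}/Q compr_ker compr0 subr0. Qed.

Let Q_sym u v : rd (Q u) v = rd u (Q v).
Proof. by rewrite /Q rdotBl rdotBr V_adj; congr (_ - _); rewrite rdotC -V_adj rdotC. Qed.

Let Q_lin a u v : Q (a *: u + v) = a *: Q u + Q v.
Proof. by rewrite /Q adj_lin V_lin scalerBr opprD addrACA. Qed.

Let QZ a u : Q (a *: u) = a *: Q u.
Proof.
have Q0 : Q 0 = 0 by rewrite -{1}compr0 QV.
by rewrite -[a *: u]addr0 Q_lin Q0 addr0.
Qed.

Lemma adj_spectral C u : measurable C -> Vs (F C u) = ind (g @^-1` C) (Vs u).
Proof.
move=> mC; have mp := mpre mC.
by rewrite adjD VsV adjr compr_ker scaler0 addr0 indI// setIC -indI// adj_ind.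
Qed.

Let QF C u : Q (F C u) = (\1_C (0 : R) : R)%:C%C *: Q u.
Proof.
rewrite /F /cop_spectral -[V _]scale1r Q_lin QV scaler0 add0r QZ QQ //.
Qed.

Lemma spectral_lin C a u v : measurable C -> F C (a *: u + v) = a *: F C u + F C v.
Proof.
move=> mC; rewrite /F /cop_spectral adj_lin ind_lin ?V_lin ?Q_lin; last exact: mpre.
by rewrite !scalerDr addrACA !scalerA (mulrC _ a).
Qed.

Lemma spectral_rdot_sym C u v : measurable C -> rd (F C u) v = rd u (F C v).
Proof.
move=> mC; rewrite /F /cop_spectral rdotDl rdotDr rdotZl rdotZr Q_sym; congr (_ + _).
apply: etrans (V_adj _ _) _; apply: etrans (ind_sym _ _ (mpre mC)) _.
by apply: etrans (rdotC _ _ _) _; rewrite -V_adj rdotC.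
Qed.


Lemma cop_spectral_nsq C u : measurable C ->
  nsq (F C u) = nsq (ind (g @^-1` C) (Vs u)) + \1_C (0 : R) * nsq (Q u).
Proof.
move=> mC; have mp := mpre mC; rewrite /F /cop_spectral nsqD nsqZ nsq_compr.
rewrite rdotZr V_adj compr_ker rdot0r !mulr0 addr0.
have -> : ind Y (ind (g @^-1` C) (Vs u)) = ind (g @^-1` C) (Vs u).
  by rewrite indI// setIC -indI// adj_ind.
by congr (_ + _ * _); rewrite indicE; case: (_ \in _); rewrite ?expr1n ?expr0n.
Qed.

Let F_idem C u : measurable C -> F C (F C u) = F C u.
Proof.
move=> mC; have mp := mpre mC.
rewrite {1}/F /cop_spectral (adj_spectral _ mC) QF (indK _ mp) scalerA.
rewrite -rmorphM /=; congr (_ + _%:C%C *: _).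
by rewrite indicE; case: (_ \in _); rewrite ?mulr1 ?mulr0.
Qed.

Let F_add (A C : set R) u : measurable A -> measurable C -> A `&` C = set0 ->
  F (A `|` C) u = F A u + F C u.
Proof.
move=> mA mC AC; rewrite /F /cop_spectral preimage_setU indU; last 3 first.
- exact: mpre.
- exact: mpre.
- by rewrite -preimage_setI AC preimage_set0.
have -> : (\1_(A `|` C) (0 : R) : R) = \1_A (0 : R) + \1_C (0 : R).
  rewrite !indicE in_setU.
  have [xA|xA] := boolP (0 \in A); have [xB|xB] := boolP (0 \in C) => /=; rewrite ?addr0 ?add0r//.
  by have : (A `&` C) 0 by [split; rewrite -in_setE]; rewrite AC.
by rewrite comprD rmorphD /= scalerDl addrACA.
Qed.

Let F0 u : F set0 u = 0.
Proof.
by rewrite /F /cop_spectral preimage_set0 ind_set0 compr0 indic0 scale0r addr0.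
Qed.

Let mVs u : measurable_fun setT (fun x => sqnorm (L2fn (Vs u) x)).
Proof. by apply/measurable_EFinP; apply: measurable_sqnorm; exact: cmeasurable_L2fn. Qed.

Let nQ u : {nonneg R} := NngNum (nsq_ge0 dot (Q u)).

(** [m] is the image under [g] of the measure with density the squared modulus of [Vs u], plus an
    atom of mass [nsq (Q u)] at 0. *)
Lemma cop_spectral_measure u : exists m : {measure set R -> \bar R},
  (forall C, measurable C -> m C = (nsq (F C u))%:E) /\
  (forall f : R -> \bar R, measurable_fun setT f -> (forall t, (0 <= f t)%E) ->
    (\int[m]_t f t = \int[mu]_x (f (g x) * (sqnorm (L2fn (Vs u) x))%:E) +
      (nsq (Q u))%:E * f 0%R)%E).
Proof.
have s0 x : 0 <= sqnorm (L2fn (Vs u) x) by exact: sqnorm_ge0.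
have [nu nuE] := image_density_measure mu mg (mVs u) s0.
exists (measure_add nu (mscale (nQ u) (dirac (0 : R)))); split=> [C mC|f mf f0].
  rewrite cop_spectral_nsq// EFinD EFinM; apply: etrans (measure_addE _ _ _) _.
  rewrite nuE// -nsq_ind; last exact: mpre.
  by congr (_ + _)%E; rewrite /= /mscale /= muleC.
rewrite ge0_integral_measure_add//; congr (_ + _)%E.
  exact: (integral_image_density mg (mVs u) s0 nuE).
by rewrite ge0_integral_mscale// integral_dirac// diracT mul1e.
Qed.

Lemma cop_is_spectral_measure : is_spectral_measure dot F.
Proof.
split.
- move=> C mC; split.
  + by move=> a u v; exact: spectral_lin.
  + by move=> u; exact: F_idem.
  + move=> u v; apply/dot_eqP; split; first exact: spectral_rdot_sym.
    have Fi : F C (iu v) = iu (F C v).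
      have F00 : F C 0 = 0.
        by have := spectral_lin (-1) 0 0 mC; rewrite scaler0 addr0 scaleN1r addNr.
      by have := spectral_lin 'i%C v 0 mC; rewrite F00 !addr0.
    by rewrite spectral_rdot_sym// Fi.
- apply/funext => u; rewrite /F /cop_spectral preimage_setT indT indicT scale1r.
  by rewrite /Q addrC subrK.
- move=> G mG tG u.
  have [m [mE _]] := cop_spectral_measure u.
  have dij i j x : (i < j)%N -> G i x -> G j x -> False.
    move=> ij Gi Gj; have : (G i `&` G j) x by [].
    by move/trivIsetP : tG => /(_ i j I I) ->; rewrite ?neq_ltn ?ij.
  (* The remainder after [n] terms is [F (T n) u], and these tails decrease to the empty set, so
     their mass tends to 0. *)
  pose T n := \bigcup_(k in [set k | (n <= k)%N]) G k.
  have mT n : measurable (T n) by apply: bigcup_measurable => k _.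
  have FT n : F (\bigcup_k G k) u - \sum_(k < n) F (G k) u = F (T n) u.
    elim: n => [|n ih].
      by rewrite big_ord0 subr0; congr (F _ u); apply: eq_bigcupl; split.
    rewrite big_ord_recr /= opprD addrA ih.
    rewrite (_ : T n = G n `|` T n.+1); last first.
      apply/seteqP; split=> x.
        move=> [k /= nk Gk]; have [e|ne] := eqVneq n k; first by left; rewrite e.
        by right; exists k => //=; rewrite ltn_neqAle ne.
      by move=> [Gn|[k /= nk Gk]]; [exists n => /=|exists k => //=; exact: ltnW].
    have dis : G n `&` T n.+1 = set0.
      rewrite -subset0 => x [Gn [k /= nk Gk]].
      exact: dij nk Gn Gk.
    by rewrite (F_add u (mG n) (mT n.+1) dis) addrAC subrr add0r.
  have mcv : m (T n) @[n --> \oo] --> m (\bigcap_n T n).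
    apply: nonincreasing_cvg_mu => //.
    + by rewrite mE// ltry.
    + exact: bigcap_measurable.
    + move=> i j ij; apply/subsetPset => x [k /= jk Gk]; exists k => //=.
      exact: leq_trans jk.
  move: mcv; rewrite (_ : \bigcap_n _ = set0); last first.
    rewrite -subset0 => x h; have [k _ Gk] := h 0%N I; have [l /= kl Gl] := h k.+1 I.
    exact: dij kl Gk Gl.
  rewrite measure0 => /fine_cvgP[_ /cvgrPdist_lt cv].
  apply/cvgrPdist_lt => e e0; have := cv (e ^+ 2) (exprn_gt0 _ e0).
  apply: filterS => n /=; rewrite FT mE//= !sub0r !normrN !ger0_norm ?nsq_ge0 ?hnorm_ge0//.
  by rewrite -hnorm_sqr ltr_sqr ?nnegrE ?hnorm_ge0// ltW.
Qed.

Section calculus.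
Variable k : R -> R.
Hypothesis mk : measurable_fun setT k.
(** Silences the atom at 0, so that [Q] contributes neither to the domain nor to the integral. *)
Hypothesis k0 : k 0 = 0.
Hypothesis k_ge0 : forall t, 0 <= t -> 0 <= k t.

Let kg x := k (g x).
Let mkg : measurable_fun setT kg. Proof. exact: measurableT_comp. Qed.
Let kg0 x : 0 <= kg x. Proof. exact: k_ge0. Qed.
Let hF := cop_is_spectral_measure.

Lemma integral_cop_spectral u (f : R -> \bar R) : measurable_fun setT f ->
  (forall t, (0 <= f t)%E) ->
  (\int[smeasure dot F u]_t f t = \int[mu]_x (f (g x) * (sqnorm (L2fn (Vs u) x))%:E) +
      (nsq (Q u))%:E * f 0%R)%E.
Proof.
move=> mf f0; have [m [mE <-//]] := cop_spectral_measure u.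
by apply: eq_integral_on_measurable => C mC; rewrite mE// (smeasureE hF).
Qed.

Lemma cop_spectral_dom u : spectral_dom dot F k u <-> mul_dom kg (Vs u).
Proof.
rewrite mul_dom_iff// /spectral_dom /=.
rewrite (@integral_cop_spectral u (fun t => (k t ^+ 2)%:E)).
- by rewrite k0 expr0n mule0 adde0.
- by apply/measurable_EFinP; exact: measurable_funX.
- by move=> t; rewrite lee_fin sqr_ge0.
Qed.

Lemma cop_sint u : mul_dom kg (Vs u) ->
  sint dot F k u = rd (mulf kg (Vs u)) (Vs u).
Proof.
move=> du; rewrite /sint (integral_smeasure hF).
(* The integral formula is for nonnegative functions; the negative half-line, where the sign of [k]
   is unknown, is a null set. *)
have -> : (\int[smeas hF u]_t (k t)%:E = \int[smeas hF u]_t (`|k t|)%:E)%E.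
  apply: ae_eq_integral => //.
  - exact/measurable_EFinP.
  - by apply/measurable_EFinP; exact: measurableT_comp.
  exists `]-oo, 0[%classic; split=> //.
    rewrite (smeasE hF)// cop_spectral_nsq//.
    rewrite (_ : g @^-1` `]-oo, 0[%classic = set0).
      by rewrite ind_set0 nsq0 indicE memNset ?mul0r ?addr0//= in_itv /= ltxx.
    by rewrite -subset0 => x /=; rewrite in_itv /= ltNge g0.
  move=> t /= h; rewrite in_itv /=; apply: contrapT => t0; apply: h => _.
  by rewrite ger0_norm// k_ge0// leNgt; exact/negP.
rewrite -(integral_smeasure hF) integral_cop_spectral; last 2 first.
- by apply/measurable_EFinP; exact: measurableT_comp.
- by move=> t; rewrite lee_fin.
rewrite k0 normr0 mule0 adde0 -[RHS]/(fine (rd (mulf kg (Vs u)) (Vs u))%:E).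
by rewrite mulf_rdot_int//; congr fine; apply: eq_integral => x _; rewrite ger0_norm; last exact: kg0.
Qed.

Lemma cop_sint2 u v : mul_dom kg (Vs u) -> mul_dom kg (Vs v) ->
  sint2 dot F k u v = rd (mulf kg (Vs u)) (Vs v).
Proof.
move=> du dv; have [dD mD] := mul_domD mkg du dv; have [dB mB] := mul_domB mkg du dv.
rewrite /sint2 !cop_sint ?adjB ?adjD// mD mB.
rewrite !(rdotDl, rdotDr) !(rdotNl, rdotNr).
rewrite (mulf_sym dv du) (rdotC _ (Vs v)).
move: (rd (mulf kg (Vs u)) (Vs u)) (rd (mulf kg (Vs u)) (Vs v)) (rd (mulf kg (Vs v)) (Vs v)) => a b c.
by field.
Qed.

Lemma spectral_integral_cop : spectral_integral dot F k = cop kg.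
Proof.
apply/seteqP; split=> x.
  move=> /(spectral_integralP hF)[/cop_spectral_dom dx h]; split=> //.
  apply: (dense_rdot_inj (cop_dense mkg)) => v [v' [/= dv _]].
  by rewrite h ?cop_sint2 ?V_adj//; exact/cop_spectral_dom.
move=> [dx e]; apply/(spectral_integralP hF); split; first exact/cop_spectral_dom.
by move=> v /cop_spectral_dom dv; rewrite e cop_sint2// V_adj.
Qed.

End calculus.

(** For [u] in this range, [Vs u] is supported where [g <= a]. This is the hypothesis [F_low] of the
    uniqueness of spectral measures. *)
Lemma cop_spectral_low (a : R) u : 0 <= a -> F `]-oo, a] u = u ->
  exists u', [/\ F `]-oo, a] u' = u', cop g (u, u') & hn u' <= a * hn u].
Proof.
move=> a0 Fu; set C := `]-oo, a]%classic.
have mC : measurable C by exact: measurable_itv.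
have mp := mpre mC.
have eu : Vs u = ind (g @^-1` C) (Vs u) by rewrite -[in LHS]Fu adj_spectral.
have ga x : (g @^-1` C) x -> `|g x| <= a by rewrite /C /= in_itv /= => h; rewrite ger0_norm.
have [du hu] := mul_dom_trunc (Vs u) mp mg ga; rewrite -eu in du hu.
have Vsu : Vs (V (mulf g (Vs u))) = mulf g (Vs u) by rewrite VsV adj_mulf.
exists (V (mulf g (Vs u))); split; [|by split|].
  rewrite /F /cop_spectral QV scaler0 addr0 Vsu; congr V.
  by have [_ <-] := mulf_ind mp mg du; rewrite -eu.
apply: le_trans (hnorm_compr_le _) _; apply: le_trans hu _.
by rewrite ler_wpM2l// hnorm_adj_le.
Qed.

Lemma cop_spectral_integral : cop g = spectral_integral dot F id.
Proof. by rewrite spectral_integral_cop. Qed.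

Lemma pow_cop (a : R) : 0 < a -> pow_op dot (cop g) a = cop (fun x => g x `^ a).
Proof.
move=> a0; have hF := cop_is_spectral_measure.
have : [set E | is_spectral_measure dot E /\ cop g = spectral_integral dot E id]
    (spectral_measure dot (cop g)).
  by apply: xgetPex; exists F; split=> //; exact: cop_spectral_integral.
move=> [hE TE]; rewrite /pow_op.
rewrite (spectral_integral_unique cop_selfadjoint cop_positive hE hF TE
  cop_spectral_integral cop_spectral_low).
rewrite spectral_integral_cop//.
- by rewrite powR0// gt_eqF.
- by move=> t _; exact: powR_ge0.
Qed.

End compression.

(** * Polar decomposition of a multiplication followed by a partial isometry *)

Section polar_decomposition.
Context {d : measure_display} {X : measurableType d} {R : realType}.
Variable mu : {measure set X -> \bar R}.
Implicit Types (u v w e f z : L2 mu) (k : X -> R).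

Local Notation dot := (L2dot mu).
Local Notation rd := (@rdot R _ (L2dot mu)).
Local Notation nsq := (@nsq R _ (L2dot mu)).
Local Notation hn := (@hnorm R _ (L2dot mu)).
Local Notation mulc := (cop (mu := mu) id id).

Variables (V Vs : L2 mu -> L2 mu) (g : X -> R).
Local Notation Y := [set x | g x != 0].
Hypothesis V_lin : forall a u v, V (a *: u + v) = a *: V u + V v.
Hypothesis V_adj : forall u v, rd (V u) v = rd u (Vs v).
Hypothesis VsV : forall u, Vs (V u) = ind Y u.
Hypothesis mg : measurable_fun setT g.
Hypothesis g0 : forall x, 0 <= g x.

Let mY : measurable Y. Proof. exact: measurable_pos. Qed.
Let gY x : g x != 0 -> Y x. Proof. by []. Qed.

(** The identity meets the hypotheses on [V] with [Y] the whole space, so plain multiplications are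
    compressions too. *)
Let id_lin (a : R[i]) u v : id (a *: u + v) = a *: id u + id v. Proof. by []. Qed.
Let id_adj u v : rd (id u) v = rd u (id v). Proof. by []. Qed.
Let id_id u : id (id u) = ind setT u. Proof. by rewrite indT. Qed.
Let gT x : g x != 0 -> setT x. Proof. by []. Qed.

Definition polar_op : operator (L2 mu) :=
  [set x | mul_dom g x.1 /\ x.2 = V (mulf g x.1)].

Definition polar_adj : operator (L2 mu) :=
  [set x | mul_dom g (Vs x.1) /\ x.2 = mulf g (Vs x.1)].

Let VsV_ind n e : Vs (V (ind (level g n) e)) = ind (level g n) e.
Proof.
have mn := measurable_level mg n.
rewrite VsV indI// (_ : Y `&` level g n = level g n)//; apply/setIidr => x /andP[h _].
by rewrite /= gt_eqF//; apply: lt_trans h; rewrite invr_gt0.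
Qed.

Let ind_mulf u : mul_dom g u -> ind Y (mulf g u) = mulf g u.
Proof.
move=> du; apply: L2_eqP.
apply: filterS2 (indE (mulf g u) mY) (mulfE du) => x -> ->.
rewrite indicE; have [gx|gx] := boolP (g x == 0); first by rewrite (eqP gx) mul0r mulr0.
by rewrite mem_set// mul1r.
Qed.

Lemma polar_op_is_operator : is_operator polar_op.
Proof.
have V0 := compr0 V_lin.
split.
- by have [d0 m0] := mul_dom0 mu mg; rewrite /polar_op /= m0 V0.
- move=> a [x1 x2] [y1 y2] [/= dx ->] [/= dy ->]; rewrite /polar_op /=.
  by have [dd ->] := mul_dom_lin a mg dx dy; rewrite V_lin.
- by move=> u v v' [/= _ ->] [/= _ ->].
Qed.

Lemma polar_op_dense : densely_defined dot polar_op.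
Proof.
move=> u r r0; have [v [[z [/= dz _]] h]] := cop_dense id_lin id_adj measurableT id_id mg u r0.
by exists v; split=> //; exists (V (mulf g v)).
Qed.

Lemma polar_key_ker z : {ae mu, forall x, (g x)%:C%C * L2fn z x = 0} ->
  mul_dom g z /\ mulf g z = 0.
Proof.
move=> gz; apply: ae_mulf_dom => //.
by apply: filterS2 gz (L2fn0 mu) => x -> ->.
Qed.

(** The hard inclusion is [compr_key] for the identity: level vectors and functions killed by [g]
    provide its two test conditions. *)
Lemma adjoint_polar_op : adjoint dot polar_op = polar_adj.
Proof.
have V0 := compr0 V_lin.
apply/seteqP; split=> x.
  move=> xA; have [dx e] : mul_dom g (Vs x.1) /\ id (mulf g (Vs x.1)) = x.2.
    apply: (compr_key id_lin id_adj measurableT id_id mg g0 gT) => [n e|z hz].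
      have := adjoint_rdot xA (_ : polar_op (ind (level g n) e, V (mulf g (ind (level g n) e)))).
      by rewrite /= V_adj; apply; split=> //; exact: mul_dom_level.
    have [dz mz] := polar_key_ker hz.
    have := adjoint_rdot xA (_ : polar_op (z, 0)); rewrite /= rdot0l => -> //.
    by split=> //=; rewrite mz V0.
  by split.
move=> [dx e]; apply: adjoint_rdotP => [y yA|y [dy e2]].
  exact: (is_operator_scale _ polar_op_is_operator yA).
by rewrite e e2 V_adj mulf_sym.
Qed.

Lemma adjoint_polar_adj : adjoint dot polar_adj = polar_op.
Proof.
have V0 := compr0 V_lin.
apply/seteqP; split=> x.
  move=> xA; have [dx e] : mul_dom g x.1 /\ V (mulf g x.1) = x.2.
    apply: (compr_key V_lin V_adj mY VsV mg g0 gY) => [n e|z hz].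
      have := adjoint_rdot xA (_ : polar_adj (V (ind (level g n) e), mulf g (ind (level g n) e))).
      rewrite /= V_adj; apply; rewrite /polar_adj /= VsV_ind; split=> //; exact: mul_dom_level.
    have [dz mz] := polar_key_ker hz.
    have pz : polar_adj (z, 0) by split=> //=; rewrite mz.
    by have := adjoint_rdot xA pz; rewrite /= rdot0l => <-.
  by split.
move=> [dx e]; apply: adjoint_rdotP => [y [dy e2]|y [dy e2]].
  have [dd md] := mul_domZ 'i%C mg dy.
  by rewrite /polar_adj /= (adji V_lin V_adj) e2 md.
by rewrite e e2 mulf_sym// [RHS]rdotC V_adj rdotC.
Qed.

Lemma polar_op_closed : closed_op dot polar_op.
Proof. by rewrite -adjoint_polar_adj; exact: closed_adjoint. Qed.

Lemma comp_polar_op :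
  comp_op (mulc g) (mulc g) = comp_op (adjoint dot polar_op) polar_op.
Proof.
rewrite adjoint_polar_op; apply/seteqP; split=> -[x z].
  move=> [v [[/= dx ->] [/= dv ->]]]; exists (V (mulf g x)); split=> //=.
  by rewrite /polar_adj /= VsV ind_mulf.
move=> [v [[/= dx ->] [/= dv ->]]]; exists (mulf g x); split=> //=.
by rewrite VsV ind_mulf// in dv *.
Qed.

Lemma comp_polar_adj : comp_op (cop V Vs g) (cop V Vs g) =
  comp_op (adjoint dot (adjoint dot polar_op)) (adjoint dot polar_op).
Proof.
rewrite adjoint_polar_op adjoint_polar_adj; apply/seteqP; split=> -[x z].
  move=> [v [[/= dx ->] [/= dv ->]]]; exists (mulf g (Vs x)).
  by rewrite VsV ind_mulf// in dv *.
move=> [v [[/= dx ->] [/= dv ->]]]; exists (V (mulf g (Vs x))); split=> //.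
by rewrite /cop /= VsV ind_mulf.
Qed.

(** [mulc g] shows that the choice behind [abs_op] is not vacuous, and [square_root_unique] then
    identifies what was chosen. *)
Lemma abs_polar_op : abs_op dot polar_op = mulc g.
Proof.
have sM := cop_selfadjoint id_lin id_adj measurableT id_id mg g0 gT.
have pM := cop_positive id_lin id_adj measurableT id_id mg g0 gT.
have [sP pP eP] : is_abs dot polar_op (abs_op dot polar_op).
  by apply: xgetPex; exists (mulc g); split=> //; exact: comp_polar_op.
apply: (square_root_unique id_lin id_adj measurableT id_id mg g0 gT sP pP).
by rewrite eP comp_polar_op.
Qed.

Lemma abs_polar_adj : abs_op dot (adjoint dot polar_op) = cop V Vs g.
Proof.
have sM := cop_selfadjoint V_lin V_adj mY VsV mg g0 gY.
have pM := cop_positive V_lin V_adj mY VsV mg g0 gY.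
have [sP pP eP] : is_abs dot (adjoint dot polar_op) (abs_op dot (adjoint dot polar_op)).
  by apply: xgetPex; exists (cop V Vs g); split=> //; exact: comp_polar_adj.
apply: (square_root_unique V_lin V_adj mY VsV mg g0 gY sP pP).
by rewrite eP comp_polar_adj.
Qed.

Lemma pow_abs_polar_op (a : R) : 0 < a ->
  pow_op dot (abs_op dot polar_op) a = mulc (fun x => g x `^ a).
Proof. by move=> a0; rewrite abs_polar_op (pow_cop id_lin id_adj measurableT id_id mg g0 gT). Qed.

Lemma pow_abs_polar_adj (a : R) : 0 < a ->
  pow_op dot (abs_op dot (adjoint dot polar_op)) a = cop V Vs (fun x => g x `^ a).
Proof. by move=> a0; rewrite abs_polar_adj (pow_cop V_lin V_adj mY VsV mg g0 gY). Qed.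

Let V_ker u : V (ind (~` Y) u) = 0.
Proof.
rewrite -(compr_ind V_lin V_adj mY VsV) ind_ind0 ?(compr0 V_lin) ?setICr//.
exact: measurableC.
Qed.

Lemma polar_kerE u : V u = 0 <-> polar_op (u, 0).
Proof.
split=> [Vu|[/= du e]].
  have iu : ind Y u = 0 by rewrite -VsV Vu -(V_ker 0) VsV ind_ind0 ?setICr//; exact: measurableC.
  have [du mu0] : mul_dom g u /\ mulf g u = 0.
    apply: polar_key_ker; have := L2fn0 mu; rewrite -[X in L2fn X]iu.
    move=> h; have h' := indE u mY; apply: filterS2 h h' => x -> /esym.
    rewrite indicE; have [gx|gx] := boolP (g x == 0); first by rewrite (eqP gx) mul0r.
    by rewrite mem_set// mul1r => ->; rewrite mulr0.
  by split=> //=; rewrite mu0 (compr0 V_lin).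
have gu : mulf g u = 0.
  by rewrite -(ind_mulf du) -VsV -e -(V_ker 0) VsV ind_ind0 ?setICr//; exact: measurableC.
have iu : ind Y u = 0.
  apply: L2_eqP; have h := L2fn0 mu; rewrite -[X in L2fn X]gu in h.
  have h' : {ae mu, forall x, (g x)%:C%C * L2fn u x = 0}.
    by apply: filterS2 h (mulfE du) => x -> <-.
  apply: filterS3 (indE u mY) (L2fn0 mu) h'.
  move=> x -> -> /eqP; rewrite mulf_eq0 => /orP[/eqP [gx]|/eqP ->]; last by rewrite mulr0.
  by rewrite indicE memNset ?mul0r// /= gx eqxx.
by rewrite -(compr_ind V_lin V_adj mY VsV) iu (compr0 V_lin).
Qed.

Lemma polar_is_phase : is_phase dot polar_op V.
Proof.
split.
- split; [by []|exists 1 => u; rewrite mul1r; exact: (hnorm_compr_le V_adj mY VsV)|move=> u h].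
  have mC := measurableC mY.
  have u0 : ind (~` Y) u = 0.
    apply: (@nsq_eq0 R _ dot); rewrite nsq_rdot ind_sym// indK//.
    by rewrite /rdot (h _ (V_ker u)).
  rewrite /hnorm -/(rd _ _) -/(rd _ _) -/(nsq _) -/(nsq _).
  by rewrite (nsq_compr V_adj mY VsV) [in RHS](indC u mY) u0 addr0.
- exact: polar_kerE.
- by rewrite abs_polar_op; apply/seteqP; split=> x; [move=> [dx e]; exists (mulf g x.1)|move=> [v [[/= dx ->] e]]].
Qed.

(** Any phase [U] has the kernel of [polar_op], hence vanishes off [Y] as [V] does, and it agrees
    with [V] on all products with [g]. Every vector supported in a level is such a product, and
    these are dense among the functions supported in [Y]. *)
Lemma phase_polar_op : phase dot polar_op = V.
Proof.
have : is_phase dot polar_op (phase dot polar_op).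
  by apply: xgetPex; exists V; exact: polar_is_phase.
move: (phase dot polar_op) => U [[lU [M bU] _] kU eU].
have [_ _ eV] := polar_is_phase.
have lU' (a : R[i]) u v : U (a *: u + v) = a *: U u + U v by exact: lU.
have UB := comprB lU'.
apply/funext => u; have mC := measurableC mY.
have U0 : U (ind (~` Y) u) = 0 by apply/kU/polar_kerE; exact: V_ker.
have -> : U u = U (ind Y u).
  have e := UB u (ind (~` Y) u); rewrite U0 subr0 in e; rewrite -e; congr (U _).
  by apply/eqP; rewrite subr_eq; apply/eqP; exact: indC.
rewrite -(compr_ind V_lin V_adj mY VsV u); apply: subr0_eq.
apply: (@small_hnorm R _ dot) => r r0.
have c0 : 0 < `|M| + 1 by have := normr_ge0 M; lra.
(* [ind_cvg] needs sets that cover the space; the complement of [Y] is harmless because [ind Y u]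
   vanishes on it. *)
pose A n := ~` Y `|` level g n.
have mA n : measurable (A n) by apply: measurableU => //; exact: measurable_level.
have sA m n : (m <= n)%N -> A m `<=` A n.
  move=> mn x [/= nY|/andP[h1 h2]]; [by left|right; apply/andP; split].
    by apply: le_lt_trans h1; rewrite lef_pV2 ?posrE// ler_nat.
  by apply: le_trans h2 _; rewrite ler_nat.
have eA x : exists n, A n x.
  have [gx|gx] := boolP (g x == 0); first by exists 0%N; left; rewrite /= gx.
  by have [n nx] := level_exhaust g0 gx; exists n; right.
have [N /(_ N (leqnn N)) hN] := ind_cvg (ind Y u) mA sA eA (divr_gt0 r0 c0).
set q := ind (A N) (ind Y u) in hN.
have mN := measurable_level mg N.
have qE : q = ind (level g N) q.
  rewrite /q !indI//; last exact: measurableI.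
  congr (ind _ u); apply/seteqP; split=> x.
    by move=> [[/= nY|lx] Yx]; [|split=> //; split=> //; right].
  by move=> [lx [h Yx]].
(* Bounded division by [g], which exhibits [q] as a product with [g]. *)
pose s x := \1_(level g N) x / g x.
have ms : measurable_fun setT s.
  have -> : s = (\1_(level g N) \* (fun x => g x `^ (-1))).
    by apply/funext => x /=; rewrite powR_inv1.
  apply: measurable_funM; first exact: measurable_indic.
  exact: (measurableT_comp (@measurable_powR R _) mg).
have sb x : `|s x| <= N.+1%:R.
  rewrite /s indicE; have [|_] := boolP (x \in level g N); last by rewrite mul0r normr0.
  rewrite inE => /andP[h1 h2]; rewrite mul1r ger0_norm ?invr_ge0//.
  have gx : 0 < g x by apply: lt_trans h1; rewrite invr_gt0.
  by rewrite invf_ple ?posrE// ltW.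
have ds := mul_dom_bounded q ms sb.
have [dz mz] : mul_dom g (mulf s q) /\ mulf g (mulf s q) = q.
  apply: ae_mulf_dom => //; have h := indE q mN; rewrite -qE in h.
  apply: filterS2 h (mulfE ds) => x h ->; rewrite {1}h /s indicE mulrA -rmorphM /=.
  congr (_%:C%C * _); have [|_] := boolP (x \in level g N); last by rewrite /= mul0r mulr0.
  rewrite inE => /andP[h1 _]; rewrite /= mul1r divff// gt_eqF//.
  by apply: lt_trans h1; rewrite invr_gt0.
have Uq : U q = V q.
  have : polar_op (mulf s q, V q) by split=> //=; rewrite mz.
  by rewrite eU abs_polar_op => -[v [[/= _ ->]]]; rewrite /graph_of /= mz => ->.
have -> : U (ind Y u) - V (ind Y u) = U (ind Y u - q) - V (ind Y u - q).
  by rewrite UB (comprB V_lin) Uq opprB addrA subrK.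
apply: le_trans (hnormB _ _ _) _.
have h1 : hn (U (ind Y u - q)) <= `|M| * hn (ind Y u - q).
  by apply: le_trans (bU _) _; rewrite ler_wpM2r ?hnorm_ge0// ler_norm.
have h2 : hn (V (ind Y u - q)) <= hn (ind Y u - q) by exact: (hnorm_compr_le V_adj mY VsV).
apply: le_trans (lerD h1 h2) _; rewrite -[X in _ + X]mul1r -mulrDl.
by rewrite mulrC -ler_pdivlMr// ltW.
Qed.

Lemma aluthge_polar_op (a : R) : 0 < a < 1 -> aluthge dot a polar_op =
  comp_op (mulc (fun x => g x `^ a))
    (comp_op (graph_of V) (mulc (fun x => g x `^ (1 - a)))).
Proof.
by move=> /andP[a0 a1]; rewrite /aluthge !pow_abs_polar_op ?subr_gt0// phase_polar_op.
Qed.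

(** The powers of both moduli are explicit, and [V] is isometric on functions supported in [Y], so
    it drops out of the norm. *)
Lemma polar_p_hyponormal (p : R) : 0 < p ->
  p_hyponormal dot p polar_op <->
  (forall f : L2 mu, mul_dom (fun x => g x `^ p) f ->
    mul_dom (fun x => g x `^ p) (Vs f) /\
    nsq (mulf (fun x => g x `^ p) (Vs f)) <= nsq (mulf (fun x => g x `^ p) f)).
Proof.
move=> p0; set k := fun x => g x `^ p.
have mk : measurable_fun setT k by exact: (measurableT_comp (@measurable_powR R _) mg).
have nV e : mul_dom k (Vs e) -> nsq (V (mulf k (Vs e))) = nsq (mulf k (Vs e)).
  by move=> de; rewrite (nsq_compr V_adj mY VsV) (adj_mulf V_lin V_adj mY VsV mk de).
rewrite /p_hyponormal (pow_abs_polar_op p0) (pow_abs_polar_adj p0); split.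
  move=> [_ _ _ h1 h2] f df.
  have [g' [/= dVf e]] : dom (cop V Vs k) f by apply: h1; exists (mulf k f).
  split; first exact: dVf.
  rewrite -(nV f dVf); apply: (@nsq_le R _ dot).
  exact: (h2 f _ _ (conj df erefl) (conj dVf erefl)).
move=> h; split; [exact: polar_op_is_operator|exact: polar_op_dense|exact: polar_op_closed| |].
  move=> f [f' [/= df _]]; exists (V (mulf k (Vs f))).
  exact: (conj (h f df).1 erefl).
move=> f f1 f2 [/= df ->] [/= dVf ->]; apply: hnorm_le.
by rewrite (nV f dVf); exact: (h f df).2.
Qed.

End polar_decomposition.

(** * Polar form of a weighted composition operator *)

Lemma sqnormM (R : realType) (a b : R[i]) : sqnorm (a * b) = sqnorm a * sqnorm b.
Proof. by rewrite !sqnormE; case: a b => [a1 a2] [b1 b2] /=; ring. Qed.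

Lemma double_inj (R : realType) (a b c : R) : c + 2 * a = c + 2 * b -> a = b.
Proof. by move=> e; lra. Qed.

Section weighted_composition_polar.
Context {d : measure_display} {X : measurableType d} {R : realType}.
Variable mu : {measure set X -> \bar R}.
Implicit Types (u v f z : L2 mu) (k : X -> R).

Local Notation dot := (L2dot mu).
Local Notation rd := (@rdot R _ (L2dot mu)).
Local Notation nsq := (@nsq R _ (L2dot mu)).
Local Notation hn := (@hnorm R _ (L2dot mu)).

Variables (w : X -> R[i]) (phi : X -> X) (h : X -> \bar R).
Hypothesis mw : cmeasurable w.
Hypothesis mphi : measurable_fun setT phi.
Hypothesis hh : is_hphi mu phi w h.

Let mh : measurable_fun setT h. Proof. by case: hh. Qed.
Let h0 x : (0 <= h x)%E. Proof. by case: hh. Qed.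
Let hE D : measurable D ->
  (\int[mu]_(x in phi @^-1` D) (sqnorm (w x))%:E = \int[mu]_(x in D) h x)%E.
Proof. by move=> mD; case: hh => _ _ /(_ D mD). Qed.

Let mpre D : measurable D -> measurable (phi @^-1` D).
Proof. by move=> mD; rewrite -[X in measurable X]setTI; exact: mphi. Qed.

Let mcomp (k : X -> R[i]) : cmeasurable k -> cmeasurable (fun x => k (phi x)).
Proof.
by move=> [kr ki]; split; [exact: (measurableT_comp kr mphi)|exact: (measurableT_comp ki mphi)].
Qed.

Let msw : measurable_fun setT (fun x => (sqnorm (w x))%:E). Proof. exact: measurable_sqnorm. Qed.

Lemma preimage_ae0 D : measurable D -> (\int[mu]_(x in D) h x = 0)%E ->
  {ae mu, forall x, w x != 0 -> ~ D (phi x)}.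
Proof.
move=> mD D0; have := hE mD; rewrite D0 => w0.
have mwD : measurable_fun (phi @^-1` D) (fun x => (sqnorm (w x))%:E) by exact: measurable_funTS.
have : (\int[mu]_(x in phi @^-1` D) `|(sqnorm (w x))%:E| = 0)%E.
  by under eq_integral do rewrite gee0_abs ?lee_fin ?sqnorm_ge0//.
move/(ae_eq_integral_abs mu (mpre mD) mwD); apply: filterS => x /= wx wx0 Dx.
move/eqP: wx0; apply; apply: Normc.eq0_normc; apply/eqP; rewrite -sqrf_eq0; apply/eqP.
by case: (wx Dx).
Qed.

(** A null set has integral 0 against [h], so its preimage is null for the measure with density
    [sqnorm w]. This makes composition with [phi] compatible with almost everywhere equality. *)
Lemma ae_comp (P : X -> Prop) : {ae mu, forall x, P x} ->
  {ae mu, forall x, w x != 0 -> P (phi x)}.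
Proof.
move=> [N [mN N0 sN]]; have h0N : (\int[mu]_(x in N) h x = 0)%E.
  by apply: null_set_integral => //; exact: measurable_funTS.
apply: filterS (preimage_ae0 mN h0N) => x hx wx; apply: contrapT => nP.
by apply: hx => //; exact: sN.
Qed.

Section finite.
Hypothesis hoo : {ae mu, forall x, (h x < +oo)%E}.

Let g x := Num.sqrt (fine (h x)).
Let Y := [set x | g x != 0].

Let mfh : measurable_fun setT (fun x => fine (h x)).
Proof. exact: measurableT_comp. Qed.
Let mg : measurable_fun setT g. Proof. exact: measurable_fun_sqrt. Qed.
Let g0 x : 0 <= g x. Proof. exact: sqrtr_ge0. Qed.
Let gg x : g x ^+ 2 = fine (h x). Proof. by rewrite sqr_sqrtr// fine_ge0. Qed.
Let mY : measurable Y. Proof. exact: measurable_pos. Qed.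

Lemma integral_comp (F : X -> \bar R) : measurable_fun setT F -> (forall x, (0 <= F x)%E) ->
  (\int[mu]_x (F (phi x) * (sqnorm (w x))%:E) = \int[mu]_x (F x * (g x ^+ 2)%:E))%E.
Proof.
move=> mF F0.
have mr : measurable_fun setT (fun x => sqnorm (w x)) by exact/measurable_EFinP.
have [m mE] := image_density_measure mu mphi mr (fun x => sqnorm_ge0 (w x)).
rewrite -(integral_image_density mphi mr (fun x => sqnorm_ge0 (w x)) mE mF F0).
rewrite (@integral_density _ _ _ mu (fun x => fine (h x)) m)//.
- by apply: eq_integral => x _; rewrite gg.
- by move=> x; rewrite fine_ge0.
move=> D mD; rewrite mE// hE//; apply: ae_eq_integral => //.
- exact: measurable_funTS.
- by apply: measurable_funTS; exact/measurable_EFinP.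
- by apply: filterS hoo => x hx _; rewrite fineK// ge0_fin_numE.
Qed.

(** [h] integrates to 0 over its own zero set; finiteness is needed as well, since [fine] sends
    infinity to 0. *)
Lemma comp_neq0 : {ae mu, forall x, w x != 0 -> g (phi x) != 0}.
Proof.
have m0 : measurable [set x | h x = 0%E].
  by have := mh measurableT (emeasurable_set1 0%E); rewrite setTI.
have i0 : (\int[mu]_(x in [set x | h x = 0%E]) h x = 0)%E.
  by apply: integral0_eq => x.
apply: filterS2 (preimage_ae0 m0 i0) (ae_comp hoo) => x nx hx wx.
rewrite sqrtr_eq0 -ltNge fine_gt0// hx// andbT lt_neqAle h0 andbT eq_sym.
by apply/eqP; exact: nx.
Qed.

(** The weight of the partial isometry. By [comp_neq0] the inverse of 0 occurs, up to a null set,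
    only where [w] vanishes. *)
Let wt x : R[i] := w x * ((g (phi x))^-1)%:C%C.

Let mwt (k : X -> R[i]) : cmeasurable k -> cmeasurable (fun x => wt x * k (phi x)).
Proof.
move=> mk; apply: cmeasurableM; last exact: mcomp.
rewrite (_ : wt = fun x => (g (phi x) `^ (-1))%:C%C * w x); last first.
  by apply/funext => x; rewrite powR_inv1// mulrC.
apply: cmeasurable_mulr => //.
exact: (measurableT_comp (measurableT_comp (@measurable_powR R _) mg) mphi).
Qed.

(** The change of variables supplies the factor [g ^+ 2], which cancels the squared inverse of [g]
    and leaves the indicator of [Y]. *)
Let int_wt u : (\int[mu]_x (sqnorm (wt x * L2fn u (phi x)))%:E = (nsq (ind Y u))%:E)%E.
Proof.
pose F x : \bar R := ((g x `^ (-1)) ^+ 2 * sqnorm (L2fn u x))%:E.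
have mF : measurable_fun setT F.
  apply/measurable_EFinP; apply: measurable_funM.
    by apply: measurable_funX; exact: (measurableT_comp (@measurable_powR R _) mg).
  by apply/measurable_EFinP; exact: measurable_sqnorm (cmeasurable_L2fn u).
have F0 x : (0 <= F x)%E by rewrite lee_fin mulr_ge0 ?sqr_ge0 ?sqnorm_ge0.
transitivity (\int[mu]_x (F (phi x) * (sqnorm (w x))%:E))%E.
  apply: eq_integral => x _; rewrite /wt /F -EFinM powR_inv1//; congr _%:E.
  by rewrite [w x * _]mulrC -mulrA sqnorm_mulr sqnormM [sqnorm (w x) * _]mulrC mulrA.
rewrite integral_comp// nsq_ind// [RHS]integral_mkcond; apply: eq_integral => x _.
rewrite patchE /F -EFinM powR_inv1// mulrAC -exprMn.
have [gx|gx] := boolP (g x == 0); first by rewrite memNset /Y /= ?gx// (eqP gx) mulr0 expr0n mul0r.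
by rewrite mem_set// mulVf// expr1n mul1r.
Qed.

Let wt_isL2 u : isL2 mu (fun x => wt x * L2fn u (phi x)).
Proof. by split; [exact: mwt (cmeasurable_L2fn u)|rewrite int_wt ltry]. Qed.

Let U u : L2 mu := L2of mu (fun x => wt x * L2fn u (phi x)).

Let UE u : {ae mu, forall x, L2fn (U u) x = wt x * L2fn u (phi x)}.
Proof. exact: L2ofE. Qed.

Let nsqU u : nsq (U u) = nsq (ind Y u).
Proof.
apply: EFin_inj; rewrite -int_wt; apply: nsq_ae (UE u).
exact: mwt (cmeasurable_L2fn u).
Qed.

Let wt0 x : w x = 0 -> wt x = 0. Proof. by rewrite /wt => ->; rewrite mul0r. Qed.

Let U_lin a u v : U (a *: u + v) = a *: U u + U v.
Proof.
apply: L2_eqP; have h1 := ae_comp (L2fnD (a *: u) v); have h2 := ae_comp (L2fnZ a u).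
have h3 : {ae mu, forall x, L2fn (U (a *: u + v)) x =
    a * (wt x * L2fn u (phi x)) + wt x * L2fn v (phi x)}.
  apply: filterS3 (UE (a *: u + v)) h1 h2 => x -> e1 e2.
  have [/eqP wx|wx] := boolP (w x == 0); first by rewrite (wt0 wx) !mul0r mulr0 addr0.
  by rewrite (e1 wx) (e2 wx) mulrDr mulrCA.
have h4 : {ae mu, forall x, L2fn (a *: U u + U v) x =
    a * L2fn (U u) x + L2fn (U v) x}.
  by apply: filterS2 (L2fnD (a *: U u) (U v)) (L2fnZ a (U u)) => x -> ->.
have h5 : {ae mu, forall x, L2fn (a *: U u + U v) x =
    a * (wt x * L2fn u (phi x)) + wt x * L2fn v (phi x)}.
  by apply: filterS3 h4 (UE u) (UE v) => x -> -> ->.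
by apply: filterS2 h3 h5 => x -> ->.
Qed.

Let rdU u v : rd (U u) (U v) = rd (ind Y u) v.
Proof.
have UD : U (u + v) = U u + U v by rewrite -[u in LHS]scale1r U_lin scale1r.
have := nsqU (u + v); rewrite UD indD// !nsqD !nsqU (ind_sym _ (ind Y v))// indK// -ind_sym//.
exact: double_inj.
Qed.

Lemma wcomp_polar : exists V Vs : L2 mu -> L2 mu,
  [/\ forall a u v, V (a *: u + v) = a *: V u + V v,
      forall u v, rd (V u) v = rd u (Vs v),
      forall u, Vs (V u) = ind [set x | g x != 0] u,
      forall u, {ae mu, forall x,
        L2fn (V u) x = w x * ((g (phi x))^-1)%:C%C * L2fn u (phi x)} &
      wcomp mu phi w = polar_op V g].
Proof.
have hU u : hn (U u) <= hn u by apply: hnorm_le; rewrite nsqU nsq_ind_le.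
have [Us UsP] := bounded_adjoint U_lin hU; exists U, Us; split=> //.
  move=> u; apply: (@rdot_inj R _ dot) => z.
  by rewrite rdotC -UsP rdotC rdU.
have key u : mul_dom g u ->
    {ae mu, forall x, L2fn (U (mulf g u)) x = w x * L2fn u (phi x)}.
  move=> du; have h1 := ae_comp (mulfE du).
  apply: filterS3 (UE (mulf g u)) h1 comp_neq0 => x -> e1 e2.
  have [/eqP wx|wx] := boolP (w x == 0); first by rewrite (wt0 wx) wx !mul0r.
  rewrite (e1 wx) /wt -mulrA [X in w x * X]mulrA -rmorphM mulVf ?mul1r//.
  exact: e2.
apply/seteqP; split=> -[u v] /=; last first.
  by move=> [/= du ->]; exact: key.
(* By change of variables, the finite norm of the image [v] is the norm of the product of [g] and
   [u]. *)
move=> e; have du : mul_dom g u.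
  apply/mul_dom_iff => //.
  under eq_integral do rewrite muleC.
  rewrite -integral_comp//; last by move=> x; rewrite lee_fin sqnorm_ge0.
    have [mv fv] := L2fnP v; apply: le_lt_trans fv; rewrite le_eqVlt; apply/orP; left; apply/eqP.
    under eq_integral do rewrite -EFinM -sqnormM.
    apply: eq_sqnorm_int => //; last by apply: filterS e => x ->; rewrite mulrC.
    by apply: cmeasurableM => //; exact: mcomp (cmeasurable_L2fn u).
  exact: measurable_sqnorm (cmeasurable_L2fn u).
split=> //=; apply: L2_eqP.
by apply: filterS2 e (key u du) => x -> ->.
Qed.

End finite.
End weighted_composition_polar.

(** * Finiteness of [h] for a densely defined operator *)

Section sigma_finite_part.
Context {d : measure_display} {X : measurableType d} {R : realType}.
Variable mu : {sigma_finite_measure set X -> \bar R}.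

Local Notation dot := (L2dot mu).
Local Notation hn := (@hnorm R _ (L2dot mu)).

Lemma sigma_finite_null D : measurable D ->
  (forall A, measurable A -> A `<=` D -> (mu A < +oo)%E -> mu A = 0%E) -> mu D = 0%E.
Proof.
move=> mD hD; have [F FT mF] := sigma_finiteT mu.
apply/negligibleP => //; rewrite -(setIT D) FT setI_bigcupr.
apply: negligible_bigcup => n; have [mFn fFn] := mF n.
have mI : measurable (D `&` F n) by exact: measurableI.
apply/negligibleP => //; apply: hD => //.
by apply: le_lt_trans fFn; apply: le_measure; rewrite ?inE.
Qed.

Lemma sqnorm_indicator_int A : measurable A ->
  (\int[mu]_x (sqnorm (\1_A x : R)%:C%C)%:E = mu A)%E.
Proof.
move=> mA; rewrite (eq_integral (fun x => (\1_A x)%:E)) ?integral_indic ?setIT//.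
by move=> x _; rewrite sqnormE /= expr0n addr0 indicE; case: (_ \in _); rewrite ?expr1n ?expr0n.
Qed.

Lemma isL2_indicator A : measurable A -> (mu A < +oo)%E ->
  isL2 mu (fun x => (\1_A x : R)%:C%C).
Proof.
by move=> mA fA; split; [split => //=; exact: measurable_indic|rewrite sqnorm_indicator_int].
Qed.

Variables (w : X -> R[i]) (phi : X -> X) (h : X -> \bar R).
Hypothesis mw : cmeasurable w.
Hypothesis mphi : measurable_fun setT phi.
Hypothesis hh : is_hphi mu phi w h.

(** An [f] of the domain vanishes almost everywhere on [h = +oo]: where moreover [sqnorm f] is
    bounded below, [h] has a finite integral. The indicator of a subset of finite measure thus has
    distance to the domain at least its own norm, so density makes it 0. *)
Lemma hphi_finite : densely_defined dot (wcomp mu phi w) -> {ae mu, forall x, (h x < +oo)%E}.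
Proof.
have [mh h0 hE] := hh; move=> dW.
have mD : measurable [set x | h x = +oo%E].
  by have := mh measurableT _ (emeasurable_set1 +oo%E); rewrite setTI.
suff D0 : mu [set x | h x = +oo%E] = 0%E.
  exists [set x | h x = +oo%E]; split=> // x /= nx; apply: contrapT => ne.
  by apply: nx; rewrite ltey; apply/eqP.
have null_on f : dom (wcomp mu phi w) f -> {ae mu, forall x, h x = +oo%E -> L2fn f x = 0}.
  move=> [v fv]; pose E n := [set x | h x = +oo%E] `&` [set x | n.+1%:R^-1 <= sqnorm (L2fn f x)].
  have ms : measurable_fun setT (fun x => sqnorm (L2fn f x)).
    by apply/measurable_EFinP; exact: measurable_sqnorm (cmeasurable_L2fn f).
  have mE n : measurable (E n).
    apply: measurableI => //; rewrite -[X in measurable X]setTI.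
    by apply: measurable_fun_le => //; exact: measurable_cst.
  have E0 n : mu (E n) = 0%E.
    apply/eqP; apply: contraT => En0.
    have : (pushforward (wmeasure mu w) phi (E n) < +oo)%E.
      rewrite /pushforward /wmeasure.
      have [mv iv] := L2fnP v.
      have mpre : measurable (phi @^-1` (E n)).
        by rewrite -[X in measurable X]setTI; exact: mphi.
      apply: (@le_lt_trans _ _ (\int[mu]_(x in phi @^-1` (E n)) (n.+1%:R%:E * (sqnorm (L2fn v x))%:E))%E).
        apply: ae_ge0_le_integral => //.
        - by move=> x _; rewrite lee_fin sqnorm_ge0.
        - by apply: measurable_funTS; exact: measurable_sqnorm.
        - by move=> x _; rewrite mule_ge0 ?lee_fin ?sqnorm_ge0.
        - by apply: measurable_funTS; apply: measurable_funeM; exact: measurable_sqnorm.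
        apply: filterS fv => x -> [_ /= fx]; rewrite -EFinM lee_fin sqnormM.
        rewrite mulrCA ler_peMr ?sqnorm_ge0//.
        by rewrite -ler_pdivrMl// mulr1.
      rewrite ge0_integralZl//; last 2 first.
      - by apply: measurable_funTS; exact: measurable_sqnorm.
      - by move=> x _; rewrite lee_fin sqnorm_ge0.
      rewrite lte_mul_pinfty//; apply: le_lt_trans iv.
      apply: ge0_subset_integral => //; first exact: measurable_sqnorm.
      by move=> x _; rewrite lee_fin sqnorm_ge0.
    rewrite hE// (eq_integral (fun=> +oo%E)); last first.
      by move=> x; rewrite inE => -[].
    by rewrite integral_cst// gt0_mulye ?ltxx// lt_neqAle eq_sym En0 measure_ge0.
  have nE : mu.-negligible (\bigcup_n E n).
    by apply: negligible_bigcup => n; apply/negligibleP; [exact: mE|exact: E0].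
  case: nE => N [mN N0 sN]; exists N; split=> // x /= nx; apply: sN.
  move/not_implyP: nx => [hx fx].
  have s0 : 0 < sqnorm (L2fn f x).
    rewrite lt_neqAle sqnorm_ge0 andbT eq_sym sqrf_eq0; apply/eqP => e.
    exact/fx/Normc.eq0_normc.
  exists (truncn (sqnorm (L2fn f x))^-1) => //; split => //=.
  by rewrite invf_ple ?posrE//; apply/ltW; exact: truncnS_gt.
apply: sigma_finite_null => // A mA AD fA.
set u := L2of mu (fun x => (\1_A x : R)%:C%C); have uE := L2ofE (isL2_indicator mA fA).
have iu : ind A u = u.
  apply: L2_eqP; apply: filterS2 (indE u mA) uE => x -> ->.
  by rewrite -rmorphM /= -[X in (X * X)%:C%C]/(\1_A x) indicE; case: (_ \in _); rewrite ?mulr1 ?mulr0.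
have u0 : u = 0.
  apply: (@small_hnorm R _ dot) => e e0; have [f [df hf]] := dW u e e0.
  have if0 : ind A f = 0.
    apply: L2_eqP; apply: filterS3 (indE f mA) (null_on f df) (L2fn0 mu) => x -> nx ->.
    rewrite indicE; have [|_] := boolP (x \in A); last by rewrite mul0r.
    by rewrite inE => /AD /nx ->; rewrite mulr0.
  have -> : u = ind A (u - f).
    by rewrite -scaleN1r indD// indZ// if0 scaler0 addr0.
  by apply: le_trans (ltW hf); apply: hnorm_le; exact: nsq_ind_le.
by rewrite -(sqnorm_indicator_int mA) -(nsq_ae (isL2_indicator mA fA).1 uE) -/u u0 nsq0.
Qed.

End sigma_finite_part.

(** * Real inequalities for the comparison of [h] and [h'] *)

Section young.
Context {R : realType}.
Implicit Types (p t a b e m : R).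

Lemma young_one p t : 0 < p < 1 -> 0 < t ->
  1 <= p * (t `^ (1 - p)) ^+ 2 + (1 - p) * ((t `^ p) ^+ 2)^-1.
Proof.
move=> /andP[p0 p1] t0; have q0 : 0 < 1 - p by rewrite subr_gt0.
(* Young's inequality with the exponents 1/p and 1/(1-p), for two powers of [t] whose product is
   1. *)
have := @conjugate_powR _ (t `^ (2 * (1 - p) * p)) (t `^ (- (2 * p) * (1 - p))) p^-1 (1 - p)^-1
  (powR_ge0 _ _) (powR_ge0 _ _).
rewrite !invr_gt0 !invrK => /(_ p0 q0) h.
have e : t `^ (2 * (1 - p) * p) * t `^ (- (2 * p) * (1 - p)) = 1.
  rewrite -powRD; last by rewrite (gt_eqF t0) implybT.
  by rewrite (_ : _ + _ = 0) ?powRr0//; ring.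
rewrite e in h; apply: le_trans (h _) _; first by ring.
rewrite -!powRrM !mulfK ?gt_eqF// [X in X <= _]addrC addrC mulrC [X in _ + X <= _]mulrC.
rewrite -!powR_mulrn ?powR_ge0// -!powRrM -powRN [p * 2]mulrC [(1 - p) * 2]mulrC.
by rewrite addrC lerD.
Qed.

(** [young_one] for the quotient of the maximum by [b]. The maximum is estimated by a sum, and [m]
    makes the term with [e] independent of [b]. *)
Lemma young_max p e m a b : 0 < p < 1 -> 0 <= a -> 0 < e -> 0 < b -> m^-1 <= b -> 0 < m ->
  1 <= p * ((a / b) `^ (1 - p)) ^+ 2 + p * ((e * m) `^ (1 - p)) ^+ 2 +
    (1 - p) * ((Num.max a e `^ (- p)) ^+ 2 * (b `^ p) ^+ 2).
Proof.
move=> p01 a0 e0 b0 mb m0; case/andP: (p01) => p0 p1.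
have q0 : 0 <= 1 - p by rewrite subr_ge0 ltW.
set c := Num.max a e; have c0 : 0 < c by rewrite lt_max e0 orbT.
have := young_one p01 (divr_gt0 c0 b0); move/le_trans; apply.
have -> : ((c / b) `^ p ^+ 2)^-1 = c `^ (- p) ^+ 2 * b `^ p ^+ 2.
  have bV : b^-1 `^ p = (b `^ p)^-1 by rewrite -[b^-1]powR_inv1 ?ltW// -powRrM mulN1r powRN.
  by rewrite powRM ?invr_ge0 ?ltW// bV powRN -exprVn invfM invrK exprMn.
rewrite lerD2r -mulrDr ler_pM2l//.
have key x y : 0 <= x -> x <= y -> (x `^ (1 - p)) ^+ 2 <= (y `^ (1 - p)) ^+ 2.
  move=> x0 xy; rewrite lerXn2r ?nnegrE ?powR_ge0//.
  by apply: ge0_ler_powR => //; rewrite nnegrE // (le_trans x0).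
rewrite /c; case: (leP a e) => _.
  apply: le_trans (key _ (e * m) _ _) _; first by rewrite divr_ge0// ltW.
    by rewrite ler_pM2l// invf_ple ?posrE.
  by rewrite lerDr sqr_ge0.
by rewrite lerDl sqr_ge0.
Qed.

(** The bounds give [a ^+ 2 <= a * b], hence [a <= b]. *)
Lemma le_square_mul (N a b H : R) : 0 <= a -> 0 <= b -> N <= a * b -> a ^+ 2 <= N -> b ^+ 2 = H ->
  N <= H.
Proof.
move=> a0 b0 h1 h2 <-; have [ab|ba] := leP a b.
  by apply: le_trans h1 _; rewrite expr2 ler_wpM2r.
have [a00|an] := eqVneq a 0; first by rewrite a00 ltNge b0 in ba.
have : a ^+ 2 <= a * b by apply: le_trans h2 _.
by rewrite expr2 ler_pM2l ?lt_neqAle 1?eq_sym ?an// leNgt ba.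
Qed.

End young.
Lemma le_of_small_multiples (R : realType) (a r : R) : 0 <= a ->
  (forall t, 0 < t -> a <= r + t ^+ 2 * a) -> a <= r.
Proof.
move=> a0 h; apply/ler_addgt0Pr => e e0.
have a1 : 0 < a + 1 by rewrite ltr_wpDl.
have c0 : 0 < e / (a + 1) by rewrite divr_gt0.
have := h (Num.sqrt (e / (a + 1))); rewrite sqrtr_gt0 (sqr_sqrtr (ltW c0)) => /(_ c0).
move/le_trans; apply; rewrite lerD2l mulrAC ler_pdivrMr// ler_pM2l//.
by rewrite lerDl.
Qed.

Lemma absorb_le (R : realType) (p a r s : R) : 0 < p ->
  a <= p * r + p * s * a + (1 - p) * a -> a <= r + s * a.
Proof. by move=> p0 h; rewrite -(ler_pM2l p0); lra. Qed.

Lemma ge0_integral_lin3 d (T : measurableType d) (R : realType)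
    (mu : {measure set T -> \bar R}) (a b c : R) (A B C : T -> \bar R) :
  0 <= a -> 0 <= b -> 0 <= c ->
  measurable_fun setT A -> measurable_fun setT B -> measurable_fun setT C ->
  (forall x, (0 <= A x)%E) -> (forall x, (0 <= B x)%E) -> (forall x, (0 <= C x)%E) ->
  (\int[mu]_x (a%:E * A x + b%:E * B x + c%:E * C x) =
   a%:E * \int[mu]_x A x + b%:E * \int[mu]_x B x + c%:E * \int[mu]_x C x)%E.
Proof.
move=> a0 b0 c0 mA mB mC A0 B0 C0.
have Z r (F : T -> \bar R) : 0 <= r -> (forall x, (0 <= F x)%E) -> forall x, setT x -> (0 <= r%:E * F x)%E.
  by move=> r0 F0 x _; rewrite mule_ge0 ?lee_fin.
rewrite ge0_integralD//; [|by move=> x _; rewrite adde_ge0 ?Z| |exact: Z|exact: measurable_funeM].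
  rewrite ge0_integralD ?ge0_integralZl ?lee_fin//; [exact: Z|exact: measurable_funeM|exact: Z|].
  exact: measurable_funeM.
by apply: emeasurable_funD; exact: measurable_funeM.
Qed.

(** * From [p]-hyponormality to [g <= g'] *)

Section modulus_inequality.
Context {d : measure_display} {X : measurableType d} {R : realType}.
Variable mu : {sigma_finite_measure set X -> \bar R}.
Implicit Types (u v f : L2 mu) (k q : X -> R) (D : set X).

Local Notation dot := (L2dot mu).
Local Notation rd := (@rdot R _ (L2dot mu)).
Local Notation nsq := (@nsq R _ (L2dot mu)).
Local Notation hn := (@hnorm R _ (L2dot mu)).

Lemma L2_restrict D q (C : R) : measurable D -> (mu D < +oo)%E -> measurable_fun setT q ->
  (forall x, D x -> `|q x| <= C) ->
  exists u : L2 mu, {ae mu, forall x, L2fn u x = (\1_D x * q x)%:C%C}.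
Proof.
move=> mD fD mq qC; have D2 := isL2_indicator mD fD.
have mk : measurable_fun setT (fun x => \1_D x * q x).
  by apply: measurable_funM mq; exact: measurable_indic.
have b x : `|\1_D x * q x| <= `|C|.
  rewrite indicE; have [|_] := boolP (x \in D); last by rewrite mul0r normr0.
  by rewrite inE mul1r => /qC h; apply: le_trans h _; exact: ler_norm.
have dm := mul_dom_bounded (L2of mu (fun x => (\1_D x : R)%:C%C)) mk b.
exists (mulf (fun x => \1_D x * q x) (L2of mu (fun x => (\1_D x : R)%:C%C))).
apply: filterS2 (mulfE dm) (L2ofE D2) => x -> ->; rewrite -rmorphM /= indicE.
by case: (_ \in _); rewrite ?mulr1 // mul0r mul0r.
Qed.

Variables (w w' : X -> R[i]) (phi : X -> X) (g g' : X -> R) (p : R).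
Variables (U Us : L2 mu -> L2 mu).
Hypothesis mw : cmeasurable w.
Hypothesis mw' : cmeasurable w'.
Hypothesis mphi : measurable_fun setT phi.
Hypothesis mg : measurable_fun setT g.
Hypothesis mg' : measurable_fun setT g'.
Hypothesis g0 : forall x, 0 <= g x.
Hypothesis g'0 : forall x, 0 <= g' x.
Hypothesis p01 : 0 < p < 1.
Hypothesis wg : forall F : X -> \bar R, measurable_fun setT F -> (forall x, (0 <= F x)%E) ->
  (\int[mu]_x (F (phi x) * (sqnorm (w x))%:E) = \int[mu]_x (F x * (g x ^+ 2)%:E))%E.
Hypothesis wg' : forall F : X -> \bar R, measurable_fun setT F -> (forall x, (0 <= F x)%E) ->
  (\int[mu]_x (F (phi x) * (sqnorm (w' x))%:E) = \int[mu]_x (F x * (g' x ^+ 2)%:E))%E.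
Hypothesis ae_phi : forall P : X -> Prop, {ae mu, forall x, P x} ->
  {ae mu, forall x, w x != 0 -> P (phi x)}.
Hypothesis w'E : {ae mu, forall x, w' x = w x * ((g x / g (phi x)) `^ (1 - p))%:C%C}.
Hypothesis UE : forall u, {ae mu, forall x,
  L2fn (U u) x = w x * ((g (phi x))^-1)%:C%C * L2fn u (phi x)}.
Hypothesis U_adj : forall u v, rd (U u) v = rd u (Us v).
Hypothesis hyp : forall f, mul_dom (fun x => g x `^ p) f ->
  mul_dom (fun x => g x `^ p) (Us f) /\
  nsq (mulf (fun x => g x `^ p) (Us f)) <= nsq (mulf (fun x => g x `^ p) f).

Let mgp (a : R) : measurable_fun setT (fun x => g x `^ a).
Proof. exact: (measurableT_comp (@measurable_powR R _) mg). Qed.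

Section test_set.
Variables (D : set X) (n : nat).
Hypothesis mD : measurable D.
Hypothesis fD : (mu D < +oo)%E.
Hypothesis Dn : D `<=` level g n.

Let gD x : D x -> 0 < g x /\ g x <= n.+1%:R.
Proof. by move=> /Dn /andP[h1 h2]; split=> //; apply: lt_trans h1; rewrite invr_gt0. Qed.

Let bD (a : R) x : 0 < a -> D x -> `|g x `^ a| <= n.+1%:R `^ a.
Proof.
move=> a0 /gD [h1 h2]; rewrite ger0_norm ?powR_ge0//.
by apply: ge0_ler_powR; rewrite ?nnegrE // ltW.
Qed.

(* [p]-hyponormality tested on [f = max(g, e)^(-2 p) U (g^(1 + p) 1_D)]. *)
Lemma test_inequality (e : R) : 0 < e ->
  (\int[mu]_x (((Num.max (g x) e `^ (- p)) ^+ 2 * (g (phi x) `^ p) ^+ 2 * \1_D (phi x))%:E *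
    (sqnorm (w x))%:E) <= \int[mu]_(x in D) (g x ^+ 2)%:E)%E.
Proof.
move=> e0; case/andP: (p01) => p0 p1.
have p10 : 0 < 1 + p by apply: addr_gt0.
(* [v] is g^(1+p) and [v1] is g, both cut to [D]; so [v] is g^p times [v1], and [nsq v1] is the
   right-hand side. *)
have [v vE] := L2_restrict mD fD (mgp (1 + p)) (fun x => bD p10).
have [v1 v1E] := L2_restrict mD fD mg (fun x Dx => ltac:(by rewrite ger0_norm ?(gD Dx).2//)
   : `|g x| <= n.+1%:R).
pose s x := Num.max (g x) e `^ (- p); pose k x := s x ^+ 2.
have mono x y : 0 <= x -> x <= y -> x `^ p <= y `^ p.
  move=> x0 xy; apply: ge0_ler_powR; rewrite ?nnegrE //; [exact: ltW|exact: le_trans xy].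
have ms : measurable_fun setT s.
  apply: (measurableT_comp (@measurable_powR R _)).
  by apply: measurable_maxr => //; exact: measurable_cst.
have mk : measurable_fun setT k by exact: measurable_funX.
have s0 x : 0 <= s x by exact: powR_ge0.
have k0 x : 0 <= k x by exact: sqr_ge0.
have mx x : 0 < Num.max (g x) e by rewrite lt_max e0 orbT.
have sb x : s x <= e `^ (- p).
  rewrite /s !powRN lef_pV2 ?posrE ?powR_gt0//.
  by apply: mono; [exact: ltW|rewrite le_max lexx orbT].
(* This gives g^(2p) k^2 <= k, hence the estimate [nf] of the right side of [hyp] by the pairing of
   [f] with [U v]. *)
have gs x : g x `^ p * s x <= 1.
  rewrite /s powRN ler_pdivrMr ?powR_gt0// mul1r.
  by apply: mono => //; rewrite le_max lexx.
have kb x : `|k x| <= (e `^ (- p)) ^+ 2.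
  by rewrite ger0_norm// /k lerXn2r ?nnegrE ?powR_ge0.
have mgk : measurable_fun setT (fun x => g x `^ p * k x) by exact: measurable_funM.
have gk0 x : 0 <= g x `^ p * k x by rewrite mulr_ge0 ?powR_ge0.
have gkb x : `|g x `^ p * k x| <= e `^ (- p).
  rewrite ger0_norm// /k expr2 mulrA.
  by apply: le_trans (sb x); rewrite ler_piMl.
have dk := mul_dom_bounded (U v) mk kb.
have dgk := mul_dom_bounded (U v) mgk gkb.
set f := mulf k (U v).
have [df fE] : mul_dom (fun x => g x `^ p) f /\
    mulf (fun x => g x `^ p) f = mulf (fun x => g x `^ p * k x) (U v).
  apply: (ae_mulf_dom (mgp p)); apply: filterS2 (mulfE dk) (mulfE dgk) => x -> ->.
  by rewrite mulrA -rmorphM.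
have nf : nsq (mulf (fun x => g x `^ p) f) <= rd f (U v).
  rewrite fE -lee_fin (nsq_mulf dgk) (mulf_rdot_int mk k0 dk).
  have mU := measurable_sqnorm (cmeasurable_L2fn (U v)).
  apply: ge0_le_integral; first exact: measurableT.
  - by move=> x _; rewrite mule_ge0 ?lee_fin ?sqr_ge0 ?sqnorm_ge0.
  - by apply: emeasurable_funM => //; apply/measurable_EFinP; exact: measurable_funX.
  - by apply: emeasurable_funM => //; exact/measurable_EFinP.
  move=> x _; rewrite lee_wpmul2r ?lee_fin ?sqnorm_ge0// {2}/k lerXn2r ?nnegrE//.
  by rewrite /k expr2 mulrA ler_piMl.
have [dVf hf] := hyp df.
have gp1 x : g x `^ (1 + p) = g x `^ p * g x.
  by rewrite powRD ?(gt_eqF p10)// powRr1// mulrC.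
have [dv1 v1v] : mul_dom (fun x => g x `^ p) v1 /\ mulf (fun x => g x `^ p) v1 = v.
  by apply: (ae_mulf_dom (mgp p)); apply: filterS2 vE v1E => x -> ->; rewrite gp1 mulrCA -rmorphM.
have nv1 : ((nsq v1)%:E = \int[mu]_(x in D) (g x ^+ 2)%:E)%E.
  have cq : cmeasurable (fun x => (\1_D x * g x)%:C%C).
    by split=> //=; apply: measurable_funM => //; exact: measurable_indic.
  rewrite (nsq_ae cq v1E) [RHS]integral_mkcond; apply: eq_integral => x _.
  rewrite patchE sqnormE /= expr0n addr0 indicE.
  by case: (x \in D); rewrite /= ?mul1r// mul0r expr0n.
(* On the preimage of [D], [U v] is [w] times the power [p] of [g (phi x)]: the remaining factor [g]
   of [v] cancels the inverse in [U]. *)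
have NE : ((rd f (U v))%:E = \int[mu]_x (((Num.max (g x) e `^ (- p)) ^+ 2 *
    (g (phi x) `^ p) ^+ 2 * \1_D (phi x))%:E * (sqnorm (w x))%:E))%E.
  rewrite (mulf_rdot_int mk k0 dk); apply: ae_eq_integral; first exact: measurableT.
  - apply: emeasurable_funM; first exact/measurable_EFinP.
    exact: measurable_sqnorm (cmeasurable_L2fn (U v)).
  - apply: emeasurable_funM; last exact: measurable_sqnorm.
    apply/measurable_EFinP; apply: measurable_funM; first apply: measurable_funM => //.
      by apply: measurable_funX; exact: (measurableT_comp (mgp p) mphi).
    exact: (measurableT_comp (measurable_indic mD) mphi).
  apply: filterS2 (UE v) (ae_phi vE) => x -> hx _.
  have [wx|wx] := eqVneq (w x) 0.
    by rewrite wx !mul0r sqnormE /= expr0n addr0 !mule0.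
  rewrite (hx wx) -mulrA -rmorphM /= [w x * _]mulrC sqnorm_mulr -!EFinM; congr _%:E.
  rewrite -/(s x) -/(k x) indicE; have [|_] := boolP (phi x \in D); last first.
    by rewrite mul0r mulr0 expr0n !mulr0 !mul0r mulr0.
  rewrite inE => /gD [gx _]; rewrite gp1 mul1r mulr1 [(g (phi x))^-1 * _]mulrC.
  by rewrite mulfK ?gt_eqF// mulrA.
rewrite -NE -nv1 lee_fin.
have a0 := hnorm_ge0 dot (mulf (fun x => g x `^ p) (Us f)).
(* Shifting g^p from [v] to [Us f] produces the vector whose norm [hyp] bounds. *)
have h1 : rd f (U v) <= hn (mulf (fun x => g x `^ p) (Us f)) * hn v1.
  rewrite rdotC U_adj -v1v (mulf_sym dv1 dVf) mulrC.
  by apply: le_trans (rdot_le _ _ _); exact: ler_norm.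
have h2 := le_trans hf nf; rewrite -hnorm_sqr in h2.
exact: (le_square_mul a0 (hnorm_ge0 dot v1) h1 h2 (hnorm_sqr dot v1)).
Qed.

Lemma integral_modulus_le :
  (\int[mu]_(x in D) (g x ^+ 2)%:E <= \int[mu]_(x in D) (g' x ^+ 2)%:E)%E.
Proof.
case/andP: (p01) => p0 p1; have q0 : 0 < 1 - p by rewrite subr_gt0.
set H := (\int[mu]_(x in D) (g x ^+ 2)%:E)%E; set H' := (\int[mu]_(x in D) (g' x ^+ 2)%:E)%E.
have H0 : (0 <= H)%E by apply: integral_ge0 => x _; rewrite lee_fin sqr_ge0.
have H'0 : (0 <= H')%E by apply: integral_ge0 => x _; rewrite lee_fin sqr_ge0.
have [H'y|H'y] := eqVneq H' +oo%E; first by rewrite H'y leey.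
(* Needed because multiples of [H] are subtracted from both sides at the end. *)
have Hfin : (H < +oo)%E.
  apply: (@le_lt_trans _ _ (\int[mu]_(x in D) cst (n.+1%:R ^+ 2)%:E x)%E); last first.
    by rewrite integral_cst// lte_mul_pinfty ?lee_fin ?sqr_ge0.
  apply: ge0_le_integral => //.
  - by move=> x _; rewrite lee_fin sqr_ge0.
  - by apply: measurable_funTS; apply/measurable_EFinP; exact: measurable_funX.
  by move=> x /gD [h1 h2]; rewrite /= lee_fin lerXn2r ?nnegrE.
have mDp : measurable_fun setT (fun x => \1_D (phi x) : R).
  exact: (measurableT_comp (measurable_indic mD) mphi).
have mDE : measurable_fun setT (fun x : X => (\1_D x)%:E : \bar R).
  by apply/measurable_EFinP; exact: measurable_indic.
have D0 x : (0 <= (\1_D x)%:E :> \bar R)%E by rewrite lee_fin.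
pose A x : \bar R := ((\1_D (phi x))%:E * (sqnorm (w x))%:E)%E.
pose B x : \bar R := ((\1_D (phi x))%:E * (sqnorm (w' x))%:E)%E.
have HE : H = (\int[mu]_x A x)%E.
  rewrite (wg mDE D0) /H integral_mkcond; apply: eq_integral => x _; rewrite patchE indicE.
  by case: (x \in D); rewrite ?mul1e ?mul0e.
have H'E : H' = (\int[mu]_x B x)%E.
  rewrite (wg' mDE D0) /H' integral_mkcond; apply: eq_integral => x _; rewrite patchE indicE.
  by case: (x \in D); rewrite ?mul1e ?mul0e.
have fH : H = (fine H)%:E by rewrite fineK// ge0_fin_numE.
have fH' : H' = (fine H')%:E by rewrite fineK// ge0_fin_numE// ltey.
rewrite fH fH' lee_fin; apply: le_of_small_multiples; first exact: fine_ge0.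
(* Chosen so that the error term of [young_max], with [n.+1%:R] for [m], is exactly [p * t ^+ 2]. *)
move=> t t0; pose e := t `^ (1 - p)^-1 / n.+1%:R.
have e0 : 0 < e by rewrite divr_gt0 ?powR_gt0.
have et : (e * n.+1%:R) `^ (1 - p) = t.
  by rewrite /e divfK// -powRrM mulVf ?gt_eqF// powRr1// ltW.
have hN := test_inequality e0; rewrite -/H in hN.
set T := fun x : X => (((Num.max (g x) e `^ (- p)) ^+ 2 * (g (phi x) `^ p) ^+ 2 *
  \1_D (phi x))%:E * (sqnorm (w x))%:E)%E in hN.
have mT : measurable_fun setT T.
  apply: emeasurable_funM; last exact: measurable_sqnorm.
  apply/measurable_EFinP; apply: measurable_funM => //; apply: measurable_funM.
    apply: measurable_funX; apply: (measurableT_comp (@measurable_powR R _)).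
    by apply: measurable_maxr => //; exact: measurable_cst.
  by apply: measurable_funX; exact: (measurableT_comp (mgp p) mphi).
have T0 x : (0 <= T x)%E.
  by rewrite mule_ge0 ?lee_fin ?sqnorm_ge0// mulr_ge0// mulr_ge0 ?sqr_ge0.
have mA : measurable_fun setT A.
  by apply: emeasurable_funM; [exact/measurable_EFinP|exact: measurable_sqnorm].
have mB : measurable_fun setT B.
  by apply: emeasurable_funM; [exact/measurable_EFinP|exact: measurable_sqnorm].
have A0 x : (0 <= A x)%E by rewrite mule_ge0 ?lee_fin ?sqnorm_ge0.
have B0 x : (0 <= B x)%E by rewrite mule_ge0 ?lee_fin ?sqnorm_ge0.
(* [young_max] for [g x] and [g (phi x)], times [sqnorm (w x)], integrated over the preimage of
   [D]. *)
have key : (H <= p%:E * H' + (p * t ^+ 2)%:E * H + (1 - p)%:E * \int[mu]_x T x)%E.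
  rewrite HE H'E -ge0_integral_lin3 ?mulr_ge0 ?sqr_ge0 ?(ltW q0) ?(ltW p0) ?(ltW t0)//.
  have mS : measurable_fun setT (fun x => p%:E * B x + (p * t ^+ 2)%:E * A x + (1 - p)%:E * T x)%E.
    by apply: emeasurable_funD; [apply: emeasurable_funD|]; exact: measurable_funeM.
  apply: ae_ge0_le_integral => //.
    have Z r y : 0 <= r -> (0 <= y)%E -> (0 <= r%:E * y)%E by move=> *; rewrite mule_ge0 ?lee_fin.
    move=> x _; apply: adde_ge0; [apply: adde_ge0|]; apply: Z => //; [exact: ltW| |exact: ltW].
    by rewrite mulr_ge0 ?sqr_ge0// ltW.
  apply: filterS w'E => x wx _; rewrite /A /B /T indicE.
  have [|_] := boolP (phi x \in D); last first.
    by rewrite !mulr0 !mul0e !mule0 !adde0.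
  rewrite inE => Dx; have [b0 _] := gD Dx; have /andP[h1 _] := Dn Dx.
  rewrite wx [w x * _]mulrC sqnorm_mulr !mul1e mulr1 -!EFinM -!EFinD lee_fin.
  have := young_max p01 (g0 x) e0 b0 (ltW h1) (ltr0Sn _ n); rewrite et.
  move: (sqnorm_ge0 (w x)) => s0 /(ler_wpM2r s0); rewrite mul1r; move/le_trans; apply.
  by rewrite !mulrDl -!mulrA.
have : (H <= p%:E * H' + (p * t ^+ 2)%:E * H + (1 - p)%:E * H)%E.
  by apply: le_trans key _; rewrite leeD2l// lee_wpmul2l// lee_fin ltW.
rewrite fH fH' -!EFinM -!EFinD lee_fin.
move: (fine H) (fine H') => a r h.
exact: absorb_le p0 h.
Qed.

End test_set.

(** On a finite-measure part of a level where [g' < g], the inequality of integrals contradicts the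
    strict pointwise one unless that part is null. *)
Lemma modulus_le : {ae mu, forall x, g x <= g' x}.
Proof.
pose N n := level g n `&` [set x | g' x < g x].
have mlt : measurable [set x | g' x < g x].
  by rewrite -[X in measurable X]setTI; exact: measurable_fun_ltr.
have mN n : measurable (N n).
  by apply: measurableI mlt; exact: measurable_level.
have N0 n : mu (N n) = 0%E.
  apply: sigma_finite_null (mN n) _ => A mA AN fA.
  have := integral_modulus_le mA fA (fun x Ax => (AN x Ax).1).
  pose F x : \bar R := (g x ^+ 2 - g' x ^+ 2)%:E.
  have mF : measurable_fun setT F.
    by apply/measurable_EFinP; apply: measurable_funB; exact: measurable_funX.
  have mg2 : measurable_fun setT (fun x => (g' x ^+ 2)%:E).
    by apply/measurable_EFinP; exact: measurable_funX.
  have F0 x : A x -> (0 < F x)%E.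
    by move=> /AN [_ /= gg]; rewrite lte_fin subr_gt0 ltrXn2r// nnegrE.
  have g20 x : A x -> (0 <= (g' x ^+ 2)%:E)%E by rewrite lee_fin sqr_ge0.
  have fin : (\int[mu]_(x in A) (g' x ^+ 2)%:E)%E \is a fin_num.
    rewrite ge0_fin_numE; last exact: integral_ge0.
    apply: (@le_lt_trans _ _ (\int[mu]_(x in A) cst (n.+1%:R ^+ 2)%:E x)%E); last first.
      by rewrite integral_cst// lte_mul_pinfty ?lee_fin ?sqr_ge0.
    apply: ge0_le_integral => //; first exact: measurable_funTS.
    move=> x /AN [/andP[_ h] /= gg]; rewrite lee_fin lerXn2r ?nnegrE//.
    exact: le_trans (ltW gg) h.
  have -> : (\int[mu]_(x in A) (g x ^+ 2)%:E =
      \int[mu]_(x in A) F x + \int[mu]_(x in A) (g' x ^+ 2)%:E)%E.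
    rewrite -ge0_integralD//.
    - by apply: eq_integral => x _; rewrite -EFinD subrK.
    - by move=> x /F0 /ltW.
    - exact: measurable_funTS.
    - exact: measurable_funTS.
  rewrite -[leRHS]add0e leeD2rE// => F1.
  have : (\int[mu]_(x in A) `|F x| = 0)%E.
    apply/eqP; rewrite eq_le integral_ge0// andbT.
    apply: le_trans F1; rewrite le_eqVlt; apply/orP; left; apply/eqP.
    by apply: eq_integral => x; rewrite inE => /F0 /ltW /gee0_abs.
  move/(ae_eq_integral_abs mu mA (measurable_funTS mF)) => -[M [mM M0 AM]].
  apply: (subset_measure0 mA mM _ M0) => x Ax; apply: AM => /= h.
  by have := F0 x Ax; rewrite h// ltxx.
have : mu.-negligible (\bigcup_n N n).
  by apply: negligible_bigcup => n; apply/negligibleP; [exact: mN|exact: N0].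
move=> [M [mM M0 NM]]; exists M; split=> // x /= /negP; rewrite -ltNge => gg; apply: NM.
have gx : g x != 0 by rewrite gt_eqF// (le_lt_trans _ gg).
by have [n nx] := level_exhaust g0 gx; exists n.
Qed.

End modulus_inequality.

(** * The closure of the Aluthge transform and its adjoint *)

(** For [b = 0] both sides are 0, because the inverse of 0 is 0 and the exponent [1 - p] is
    nonzero. *)
Lemma powR_inv_split (R : realType) (b p : R) : 0 <= b -> p < 1 ->
  b^-1 * b `^ p = b^-1 `^ (1 - p).
Proof.
rewrite le_eqVlt => /predU1P[<- p1|b0 _].
  by rewrite invr0 mul0r powR0// gt_eqF// subr_gt0.
rewrite -[b^-1]powR_inv1 ?ltW// -powRD; last by rewrite (gt_eqF b0) implybT.
by rewrite -powRrM; congr (_ `^ _); ring.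
Qed.

Lemma powR_sqr_le (R : realType) (b q : R) : 0 <= b -> 0 <= q -> q <= 1 ->
  (b `^ q) ^+ 2 <= 1 + b ^+ 2.
Proof.
move=> b0 q0 q1; have [b1|b1] := leP b 1.
  have e : 1 `^ q = 1 :> R by rewrite powR1.
  have : b `^ q <= 1 by rewrite -[X in _ <= X]e; apply: ge0_ler_powR; rewrite ?nnegrE.
  have := powR_ge0 b q; nra.
have : b `^ q <= b by apply: ler1_powR => //; exact: ltW.
have := powR_ge0 b q; nra.
Qed.

Section adjoint_closure.
Context {R : realType} {H : lmodType R[i]}.
Variable dot : {dot H for conjC}.
Implicit Types A B : operator H.

Lemma sub_adjoint_adjoint A : A `<=` adjoint dot (adjoint dot A).
Proof.
have dotC u v : dot u v = conjC (dot v u) by rewrite (hermC dot u v) expr0 mul1r.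
by move=> x Ax y yA; rewrite [LHS]dotC [RHS]dotC (yA x Ax).
Qed.

Lemma closure_op_sub A B : A `<=` B -> closure_op dot A `<=` closure_op dot B.
Proof.
by move=> AB x cx e e0; have [y [Ay h1 h2]] := cx e e0; exists y; split=> //; exact: AB.
Qed.

(** The second adjoint is closed and contains [A], hence contains the closure; and the third adjoint
    contains the first. *)
Lemma adjoint_closure A : adjoint dot A `<=` adjoint dot (closure_op dot A).
Proof.
have sA : closure_op dot A `<=` adjoint dot (adjoint dot A).
  rewrite -[X in _ `<=` X]closed_adjoint; apply: closure_op_sub.
  exact: sub_adjoint_adjoint.
by move=> x /sub_adjoint_adjoint; exact: adjoint_anti.
Qed.

End adjoint_closure.

Section aluthge_closure.
Context {d : measure_display} {X : measurableType d} {R : realType}.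
Variable mu : {measure set X -> \bar R}.
Implicit Types (u v f y : L2 mu) (k q : X -> R).

Local Notation dot := (L2dot mu).
Local Notation rd := (@rdot R _ (L2dot mu)).
Local Notation nsq := (@nsq R _ (L2dot mu)).
Local Notation hn := (@hnorm R _ (L2dot mu)).
Local Notation mulc := (cop (mu := mu) id id).

Variables (w w' : X -> R[i]) (phi : X -> X) (g g' : X -> R) (p : R).
Variables (U Us V Vs : L2 mu -> L2 mu).
Hypothesis mg : measurable_fun setT g.
Hypothesis mg' : measurable_fun setT g'.
Hypothesis g0 : forall x, 0 <= g x.
Hypothesis g'0 : forall x, 0 <= g' x.
Hypothesis p01 : 0 < p < 1.
Hypothesis ae_phi : forall P : X -> Prop, {ae mu, forall x, P x} ->
  {ae mu, forall x, w x != 0 -> P (phi x)}.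
Hypothesis w'E : {ae mu, forall x, w' x = w x * ((g x / g (phi x)) `^ (1 - p))%:C%C}.
Hypothesis UE : forall u, {ae mu, forall x,
  L2fn (U u) x = w x * ((g (phi x))^-1)%:C%C * L2fn u (phi x)}.
Hypothesis U_adj : forall u v, rd (U u) v = rd u (Us v).
Hypothesis V_lin : forall a u v, V (a *: u + v) = a *: V u + V v.
Hypothesis V_adj : forall u v, rd (V u) v = rd u (Vs v).
Hypothesis VsV : forall u, Vs (V u) = ind [set x | g' x != 0] u.
Hypothesis w'_polar : wcomp mu phi w' = polar_op V g'.
Hypothesis hyp : forall f, mul_dom (fun x => g x `^ p) f ->
  mul_dom (fun x => g x `^ p) (Us f) /\
  nsq (mulf (fun x => g x `^ p) (Us f)) <= nsq (mulf (fun x => g x `^ p) f).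
Hypothesis gg' : {ae mu, forall x, g x <= g' x}.

Let mgp (a : R) : measurable_fun setT (fun x => g x `^ a).
Proof. exact: (measurableT_comp (@measurable_powR R _) mg). Qed.

Let gp := fun x => g x `^ p.
Let gq := fun x => g x `^ (1 - p).
Let A : operator (L2 mu) := comp_op (mulc gq) (comp_op (graph_of U) (mulc gp)).

Let p0 : 0 < p. Proof. by case/andP: p01. Qed.
Let q0 : 0 < 1 - p. Proof. by case/andP: p01; rewrite subr_gt0. Qed.

(** The inverse in [U] and g^p at [phi x] combine to the power [1 - p] of the inverse; together with
    g^(1-p) at [x] this is the factor that turns [w] into [w']. *)
Lemma aluthge_wcomp u y : A (u, y) <-> mul_dom gp u /\ wcomp mu phi w' (u, y).
Proof.
have key : mul_dom gp u ->
    {ae mu, forall x, (gq x)%:C%C * L2fn (U (mulf gp u)) x = w' x * L2fn u (phi x)}.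
  move=> du; have h1 := ae_phi (mulfE du).
  apply: filterS3 (UE (mulf gp u)) h1 w'E => x -> e1 ->.
  have [wx|wx] := eqVneq (w x) 0; first by rewrite wx !mul0r mulr0.
  rewrite (e1 wx) mulrCA -!mulrA; congr (w x * _); rewrite !mulrA -!rmorphM /=.
  congr (_%:C%C * _); rewrite powRM ?invr_ge0// -powR_inv_split ?g0 ?(andP p01).2//.
  by rewrite mulrAC mulrC.
split.
  move=> [v [[z [[/= du ->]]]]]; rewrite /graph_of /= => -> [/= dv ->]; split=> //.
  by apply: filterS2 (mulfE dv) (key du) => x -> ->.
move=> [du uy]; have [dv e] : mul_dom gq (U (mulf gp u)) /\ mulf gq (U (mulf gp u)) = y.
  by apply: ae_mulf_dom; [exact: mgp|apply: filterS2 uy (key du) => x /= -> ->].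
exists (U (mulf gp u)); split; last exact: (conj dv (esym e)).
exists (mulf gp u); exact: (conj (conj du erefl) erefl).
Qed.

(** Cutting [u] to a set where g^p is bounded puts it in the domain of the transform. The cut
    commutes with multiplication by [g'], so the images converge along with the arguments. *)
Lemma closure_aluthge : closure_op dot A = polar_op V g'.
Proof.
apply/seteqP; split.
  rewrite -[X in _ `<=` X](polar_op_closed V_lin V_adj VsV mg' g'0).
  by apply: closure_op_sub => -[u y] /aluthge_wcomp [_]; rewrite w'_polar.
move=> [u y] [/= du ->] e e0.
have [N1 h1] := trunc_cvg u (mgp p) e0.
have [N2 h2] := trunc_cvg (mulf g' u) (mgp p) e0.
pose n := maxn N1 N2; set D := [set x | `|g x `^ p| <= n%:R].
have mD : measurable D by exact: measurable_sublevel.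
have [dD mDu] := mulf_ind mD mg' du.
exists (ind D u, V (mulf g' (ind D u))); split => /=.
- apply/aluthge_wcomp; split; last by rewrite w'_polar.
  by apply: (mul_dom_trunc (C := n%:R) u mD (mgp p) _).1.
- by apply: h1; exact: leq_maxl.
rewrite -(comprB V_lin) mDu; apply: le_lt_trans (hnorm_compr_le V_adj _ VsV _) _.
  exact: measurable_pos.
by apply: h2; exact: leq_maxr.
Qed.

(** The witness is [gp] times [Us (mulf gq f)]: [hyp], applied to [mulf gq f], both makes it defined
    and bounds its norm. *)
Lemma adjoint_aluthge f : mul_dom g f ->
  exists z, adjoint dot A (f, z) /\ nsq z <= nsq (mulf g f).
Proof.
move=> df; have dq : mul_dom gq f.
  apply: (mul_dom_le (C := 1) (mgp _) mg df) => x; rewrite mul1r /gq.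
  by apply: powR_sqr_le => //; [exact: ltW|rewrite gerBl ltW].
have [dpq epq] : mul_dom gp (mulf gq f) /\ mulf gp (mulf gq f) = mulf g f.
  apply: ae_mulf_dom; first exact: mgp.
  apply: filterS2 (mulfE df) (mulfE dq) => x -> ->; rewrite mulrA -rmorphM /= /gp /gq.
  rewrite -powRD; last by rewrite addrC subrK oner_eq0.
  by rewrite addrC subrK powRr1.
have [dU hU] := hyp dpq; exists (mulf gp (Us (mulf gq f))); split; last first.
  by rewrite -epq.
apply: adjoint_rdotP => -[u y].
  move=> /aluthge_wcomp [du]; rewrite w'_polar => uy; apply/aluthge_wcomp.
  split; first exact: (mul_domZ _ (mgp p) du).1.
  rewrite w'_polar; exact: (is_operator_scale 'i%C (polar_op_is_operator V_lin mg') uy).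
move=> [v [[z [[/= du ->]]]]]; rewrite /graph_of /= => -> [/= dv ->].
by rewrite (mulf_sym dv dq) U_adj (mulf_sym du dU).
Qed.

Lemma closure_aluthge_hyponormal : hyponormal dot (closure_op dot A).
Proof.
rewrite closure_aluthge; apply/(polar_p_hyponormal V_lin V_adj VsV mg' g'0 ltr01).
have -> : (fun x => g' x `^ 1) = g' by apply/funext => x; rewrite powRr1.
move=> f df.
have sg : {ae mu, forall x, sqnorm ((g x)%:C%C * L2fn f x) <= 1 * sqnorm (L2fn (mulf g' f) x)}.
  apply: filterS2 (mulfE df) gg' => x -> gx; rewrite mul1r !sqnorm_mulr.
  by rewrite ler_wpM2r ?sqnorm_ge0// lerXn2r ?nnegrE.
have dg : mul_dom g f.
  apply: (isL2_dominated _ _ sg); last exact: isL2_L2fn.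
  by apply: cmeasurable_mulr => //; exact: cmeasurable_L2fn.
have hg : nsq (mulf g f) <= nsq (mulf g' f).
  rewrite -[leRHS]mul1r; apply: nsq_le_ae => //.
  by apply: filterS2 (mulfE dg) sg => x ->.
have [z [zA hz]] := adjoint_aluthge dg.
(* The adjoint of the closure contains [(f, z)] and is also [polar_adj]; comparing the two
   identifies [z] with [mulf g' (Vs f)]. *)
have := adjoint_closure zA; rewrite closure_aluthge (adjoint_polar_op V_lin V_adj mg' g'0).
move=> [/= dV ez]; split; first exact: dV.
by rewrite -ez; exact: le_trans hz hg.
Qed.

End aluthge_closure.
Theorem theorem25 (R : realType) (d : measure_display) (X : measurableType d)
  (mu : {sigma_finite_measure set X -> \bar R}) (w : X -> R[i]) (phi : X -> X)
  (h : X -> \bar R) (p : R) (w' : X -> R[i]) (h' : X -> \bar R) :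
  cmeasurable w ->
  measurable_fun setT phi ->
  pushforward (wmeasure mu w) phi `<< mu ->
  is_hphi mu phi w h ->
  0 < p < 1 ->
  is_walpha mu phi w h (1 - p) w' ->
  is_hphi mu phi w' h' ->
  p_hyponormal (L2dot mu) p (wcomp mu phi w) ->
  {ae mu, forall x, (h' x < +oo)%E} ->
  hyponormal (L2dot mu)
    (closure_op (L2dot mu)
      (aluthge (L2dot mu) (1 - p) (wcomp mu phi w))).
Proof.
move=> mw mphi _ hh p01 [mw' w'E] hh' hyp hoo'.
have [p0 p1] := andP p01.
have hoo : {ae mu, forall x, (h x < +oo)%E}.
  by apply: (hphi_finite mw mphi hh); case: hyp.
have [U [Us [U_lin U_adj UsU UE wU]]] := wcomp_polar mw mphi hh hoo.
have [V [Vs [V_lin V_adj VsV VE w'V]]] := wcomp_polar mw' mphi hh' hoo'.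
have [mh h0 _] := hh; have [mh' h'0 _] := hh'.
pose g x := Num.sqrt (fine (h x)); pose g' x := Num.sqrt (fine (h' x)).
have mg : measurable_fun setT g by apply: measurable_fun_sqrt; exact: measurableT_comp.
have mg' : measurable_fun setT g' by apply: measurable_fun_sqrt; exact: measurableT_comp.
have g0 x : 0 <= g x by exact: sqrtr_ge0.
have g'0 x : 0 <= g' x by exact: sqrtr_ge0.
have gg x : g x ^+ 2 = fine (h x) by rewrite sqr_sqrtr// fine_ge0.
have {}w'E : {ae mu, forall x, w' x = w x * ((g x / g (phi x)) `^ (1 - p))%:C%C}.
  apply: filterS w'E => x ->; congr (_ * _%:C%C).
  (* The exponent [(1 - p) / 2] of the quotient for [h] becomes [1 - p] for its square root [g]. *)
  rewrite -!gg -expr_div_n -powR_mulrn ?divr_ge0// -powRrM; congr (_ `^ _).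
  by rewrite mulrCA divff ?mulr1// pnatr_eq0.
have q01 : 0 < 1 - p < 1 by rewrite subr_gt0 p1 gtrBl p0.
have hypU : forall f : L2 mu, mul_dom (fun x => g x `^ p) f ->
    mul_dom (fun x => g x `^ p) (Us f) /\
    nsq (L2dot mu) (mulf (fun x => g x `^ p) (Us f)) <=
    nsq (L2dot mu) (mulf (fun x => g x `^ p) f).
  by apply/(polar_p_hyponormal U_lin U_adj UsU mg g0 p0); rewrite -wU.
have ae_phi := ae_comp mw mphi hh.
have gg' : {ae mu, forall x, g x <= g' x}.
  exact: (modulus_le mw mw' mphi mg mg' g0 g'0 p01 (integral_comp mw mphi hh hoo)
    (integral_comp mw' mphi hh' hoo') ae_phi w'E UE U_adj hypU).
rewrite wU (aluthge_polar_op U_lin U_adj UsU mg g0 q01).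
rewrite (_ : 1 - (1 - p) = p); last by rewrite opprB addrC subrK.
exact: (closure_aluthge_hyponormal mg mg' g0 g'0 p01 ae_phi w'E UE U_adj V_lin V_adj VsV w'V
  hypU gg').
Qed.
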